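(* Let $\rho_0\in L^1(\mathbb R)\cap L^\infty(\mathbb R)$ be nonnegative with $\int_{\mathbb R}\rho_0=1$, $\mathcal F(\rho_0)<\infty$ and finite first moment $\int_{\mathbb R}|x|\rho_0(x)dx<\infty$, let $T>0$, and for each $L>0$ let $\rho_L:[0,T]\times[-L/2,L/2]\to[0,\infty)$ be an $L^1([0,T]\times\mathbb T_L)$ subsequential limit as $N\to\infty$ of the deterministic particle approximations $\rho^N_L$ starting from $(\rho_0)_L$ (the $L$-periodic extension of $\rho_0\chi_{[-L/2,L/2]}$), extended by zero outside $[-L/2,L/2]$. Then, as $L\to+\infty$, $\rho_L$ converge (up to subsequences) strongly in $L^1([0,T]\times\mathbb R)$ to a bounded function $\rho:[0,T]\times\mathbb R\to[0,+\infty)$. Moreover, let $\{\rho_0^\lambda\}_{\lambda\in\mathbb N}$ with $\rho_0^\lambda:\mathbb R\to(0,+\infty)$, $\|\rho_0^\lambda\|_{L^\infty}\le2\|\rho_0\|_{L^\infty}$, $\mathcal F(\rho_0^\lambda)\le2\mathcal F(\rho_0)$, $\int_{\mathbb R}\rho_0^\lambda=1$, uniformly bounded first moments, and $\rho_0^\lambda\to\rho_0$ in $L^1$ as $\lambda\to\infty$. Then, as $\lambda\to+\infty$, the densities $\rho^\lambda$, obtained as $\rho$ above but starting from $\rho_0^\lambda$ instead of $\rho_0$, converge (up to subsequences) strongly in $L^1([0,T]\times\mathbb R)$ to a bounded density $\bar\rho$.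
   Context: Standing assumptions: $K:\mathbb R\to\mathbb R$ satisfies $K(z)=K(|z|)$, $K\in C^0(\mathbb R)\cap C^2(\mathbb R\setminus\{0\})$, $K,K'\in L^\infty(\mathbb R)$, $K''\in L^\infty(\mathbb R\setminus\{0\})$, $\|K'\|_{L^1(\mathbb R)}<\infty$. $W:[0,\infty)\to[0,\infty)$ and $\phi(\rho):=\rho W'(\rho)-W(\rho)$ is $C^1$ with $\phi(0)=0$, $\phi$ strictly increasing, $\phi'(\rho)\rho\le c_0\phi(\rho)$, $\phi(\rho)\le\max\{\rho,c_0W(\rho)\}$ for some $c_0>0$, and there are $c_1,c_2>0$, $\hat\rho<1<\bar\rho$ with $\phi(\rho)\le c_1\rho$ for $\rho\le\hat\rho$ and $\phi(\rho)\ge c_2\rho$ for $\rho\ge\bar\rho$. $\mathcal F(\rho)=\frac12\iint_{\mathbb R^2}K(x-y)\rho(x)\rho(y)\,dx\,dy+\int_{\mathbb R}W(\rho)\,dx$. $\mathbb T_L=\mathbb R/L\mathbb Z\cong[-L/2,L/2)$. Deterministic particle approximation starting from $\rho_{0,L}\ge0$ with $c_L=\int_{\mathbb T_L}\rho_{0,L}\le1$: set $x_0=-L/2$, $x_k=\sup\{x:\int_{x_{k-1}}^x\rho_{0,L}<c_L/N\}$, $k=1,\dots,N$; particles $x_k(t)$ (indices mod $N$) solve $\dot x_k=-\frac{c_L}{N}\sum_{j\ne k}K'(x_k-x_j)-\frac{N}{c_L}[\phi(\rho_k)-\phi(\rho_{k-1})]$, $x_k(0)=x_k$, with $\rho_k(t)=\frac{c_L}{N(x_{k+1}(t)-x_k(t))}$,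 and $\rho^N_L(t,x)=\sum_{k=0}^{N-1}\rho_k(t)\chi_{[x_k(t),x_{k+1}(t))}(x)$ (well defined on $[0,T]$ for $N$ large). *)

(* Defs.v *)
From mathcomp Require Import all_boot all_order all_algebra.
From mathcomp Require Import all_classical all_reals all_analysis.
Import Order.TTheory GRing.Theory Num.Theory numFieldNormedType.Exports.

Set Implicit Arguments.
Unset Strict Implicit.
Unset Printing Implicit Defensive.

Local Open Scope classical_set_scope.
Local Open Scope ring_scope.

Section Defs.
Context {R : realType}.
Local Notation mu := (@lebesgue_measure R).

Definition kernel_assumptions (K : R -> R) : Prop :=
  (forall z, K z = K `|z|) /\
  continuous K /\
  (forall z, z != 0 ->
     [/\ derivable K z 1, derivable (derive1 K) z 1 &
         {for z, continuous (derive1 (derive1 K))}]) /\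
  (exists M, forall z, `|K z| <= M) /\
  (exists M, forall z, z != 0 -> `|derive1 K z| <= M) /\
  (exists M, forall z, z != 0 -> `|derive1 (derive1 K) z| <= M) /\
  mu.-integrable setT (EFin \o derive1 K).

Definition phiW (W : R -> R) (r : R) : R := r * derive1 W r - W r.

(* Standing assumptions on W (only its values on [0,+oo) matter). *)
Definition W_assumptions (W : R -> R) (c0 c1 c2 rhat rbar : R) : Prop :=
  (forall r, 0 <= r -> 0 <= W r) /\
  (forall r, 0 < r -> derivable W r 1) /\
  (* phi is C^1 on [0,+oo) *)
  {within `[0, +oo[, continuous (phiW W)} /\
  (forall r, 0 < r -> derivable (phiW W) r 1) /\
  {in `]0, +oo[, continuous (derive1 (phiW W))} /\
  cvg (derive1 (phiW W) x @[x --> 0^'+]) /\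
  phiW W 0 = 0 /\
  (forall x y, 0 <= x -> x < y -> phiW W x < phiW W y) /\
  0 < c0 /\
  (forall r, 0 < r -> derive1 (phiW W) r * r <= c0 * phiW W r) /\
  (forall r, 0 <= r -> phiW W r <= Num.max r (c0 * W r)) /\
  0 < c1 /\ 0 < c2 /\ 0 < rhat /\ rhat < 1 /\ 1 < rbar /\
  (forall r, 0 <= r -> r <= rhat -> phiW W r <= c1 * r) /\
  (forall r, rbar <= r -> c2 * r <= phiW W r).

Definition energy (K W : R -> R) (rho : R -> R) : \bar R :=
  ((2^-1)%:E * \int[mu]_x \int[mu]_y (K (x - y) * rho x * rho y)%:E
   + \int[mu]_x (W (rho x))%:E)%E.

(* Representative in [-L/2, L/2) of x modulo L (torus T_L). *)
Definition trep (L x : R) : R := x - L * (Num.floor ((x + L / 2) / L))%:~R.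

Definition perext (L : R) (rho0 : R -> R) (x : R) : R := rho0 (trep L x).

Definition massL (rho0 : R -> R) (L : R) : R :=
  \int[mu]_(x in `[- (L / 2), L / 2]) rho0 x.

Definition sint (f : R -> R) (a b : R) : R :=
  if a <= b then \int[mu]_(x in `[a, b]) f x
  else - \int[mu]_(x in `[b, a]) f x.

Fixpoint init_pos (f : R -> R) (L c : R) (N : nat) (k : nat) : R :=
  match k with
  | 0 => - (L / 2)
  | k'.+1 => sup [set x | sint f (init_pos f L c N k') x < c / N%:R]
  end.

(* positions with indices taken mod N: x_{k + mN} = x_k + m L *)
Definition ppos (L : R) (N : nat) (x : nat -> R -> R) (k : nat) (t : R) : R :=
  x (k %% N)%N t + L * ((k %/ N)%N)%:R.

Definition pdens (L : R) (N : nat) (c : R) (x : nat -> R -> R) (k : nat) (t : R) : R :=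
  c / (N%:R * (ppos L N x k.+1 t - ppos L N x k t)).

(* right-hand side of the particle ODE for particle k (0 <= k < N);
   differences on the torus are taken via their representative in [-L/2,L/2) *)
Definition pvel (K W : R -> R) (L : R) (N : nat) (c : R) (x : nat -> R -> R)
  (k : nat) (t : R) : R :=
  - (c / N%:R) * (\sum_(j < N | (j : nat) != k) derive1 K (trep L (x k t - x j t)))
  - (N%:R / c) * (phiW W (pdens L N c x k t)
                  - phiW W (pdens L N c x ((k + N).-1 %% N)%N t)).

Definition particle_solution (K W : R -> R) (L T c : R) (N : nat)
  (x0 : nat -> R) (x : nat -> R -> R) : Prop :=
  (0 < N)%N /\
  (forall k, (k < N)%N -> x k 0 = x0 k) /\
  (forall k, (k < N)%N -> {within `[0, T], continuous (x k)}) /\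
  (forall t, 0 <= t -> t <= T -> forall k, (k < N)%N ->
       ppos L N x k t < ppos L N x k.+1 t) /\
  (forall t, 0 < t -> t < T -> forall k, (k < N)%N ->
       derivable (x k) t 1 /\ derive1 (x k) t = pvel K W L N c x k t).

(* rho^N_L(t, y), y read on the torus T_L *)
Definition pdensity (L : R) (N : nat) (c : R) (x : nat -> R -> R) (t y : R) : R :=
  \sum_(k < N)
    (if `[< exists m : int, ppos L N x k t <= y + m%:~R * L < ppos L N x k.+1 t >]
     then pdens L N c x k t else 0).

Definition particle_limit (K W : R -> R) (rho0 : R -> R) (L T : R)
  (rhoL : R -> R -> R) : Prop :=
  let c := massL rho0 L in
  measurable_fun [set: R * R] (fun z : R * R => rhoL z.1 z.2) /\
  (forall t y, 0 <= t -> t <= T -> - (L / 2) <= y -> y < L / 2 -> 0 <= rhoL t y) /\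
  exists Ns : nat -> nat, (forall j, (Ns j < Ns j.+1)%N) /\
  exists xs : nat -> nat -> R -> R,
    (forall j, particle_solution K W L T c (Ns j)
                 (init_pos (perext L rho0) L c (Ns j)) (xs j)) /\
    ((fun j => \int[mu]_(t in `[0%R, T%R]) \int[mu]_(y in `[(- (L / 2))%R, (L / 2)%R[)
         (`|pdensity L (Ns j) c (xs j) t y - rhoL t y|)%:E) @ \oo --> 0)%E.

Definition zext (L : R) (f : R -> R -> R) (t y : R) : R :=
  if (- (L / 2) <= y) && (y < L / 2) then f t y else 0.

Definition l1dist (T : R) (f g : R -> R -> R) : \bar R :=
  (\int[mu]_(t in `[0%R, T%R]) \int[mu]_y (`|f t y - g t y|)%:E)%E.

Definition full_limit (K W : R -> R) (rho0 : R -> R) (T : R) (rho : R -> R -> R) : Prop :=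
  measurable_fun [set: R * R] (fun z : R * R => rho z.1 z.2) /\
  exists Ls : nat -> R, (forall n, 0 < Ls n) /\ (Ls n @[n --> \oo] --> +oo) /\
  exists rhos : nat -> R -> R -> R,
    (forall n, particle_limit K W rho0 (Ls n) T (rhos n)) /\
    (l1dist T (zext (Ls n) (rhos n)) rho @[n --> \oo] --> 0%E).

End Defs.

(* Main.v *)
Require Import Defs.
From mathcomp Require Import all_boot all_order all_algebra.
From mathcomp Require Import all_classical all_reals all_analysis.
From mathcomp Require Import measurable_realfun.
From mathcomp Require Import ring lra zify.
Import Order.TTheory GRing.Theory Num.Theory numFieldNormedType.Exports.
Set Implicit Arguments.
Unset Strict Implicit.
Unset Printing Implicit Defensive.
Local Open Scope classical_set_scope.
Local Open Scope ring_scope.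

(* The discrete entropy H = sum_k (x_(k+1) - x_k) W(rho_k) decreases up to the bounded
   interaction drift, and its dissipation V = (N/c) sum_k D_k^2 of the pressure jumps
   D_k = phi(rho_k) - phi(rho_(k-1)) is therefore bounded in L^1(0, T).  This gives, uniformly
   in N, L and the initial datum:
   - an L^infty bound, since at the particle with maximal density
     ln rho_k + C3 H - C4 t strictly decreases;
   - control of the mean displacement of the particles in time;
   - control of sum_k |D_k|, hence, by the modulus of continuity of phi^-1, closeness of the
     density to a tent average of the empirical measure, up to O(h) in L^1;
   - tightness, from the first moment of the positions.
   Tent averages are equicontinuous, so their values on a finite space-time grid with finite
   precision determine the densities up to a small L^1 error: the family is totally bounded.
   The limits in N, L and lambda are all within 1/n of particle densities, so a single
   compactness theorem for the latter proves both parts. *)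

(** * Distances on the torus *)

Section torus.
Context {R : realType}.
Implicit Types (L x y w h : R) (m : int).

(** Two features of the data shape the estimates. The derivative of [phi] may vanish, so dissipation
    controls oscillations of the pressure and not of the density; hence only the weak inverse bound
    [|a - b| <= d + Cd * |phi a - phi b|], whose constant depends on the tolerance [d]. Moreover
    [K'] may jump at the origin, so neighbours feel drifts that differ by a multiple of [A c / N]
    however close they are; relative to the length of the cell this is a multiple of its density,
    and a growth rate of [ln rho] linear in [rho] would by itself allow blow-up in finite time. The
    remedy is one-dimensional: some density is at most [c / L <= 1], so the jumps [D_k] bound the
    largest pressure, and linear growth of [phi] bounds the largest density by a constant plus a
    multiple of [V], which is integrable in time. Compactness in time comes from the displacements
    and not from an equation for the density. *)

Lemma trep_itv L x : 0 < L -> - (L / 2) <= trep L x < L / 2.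
Proof.
move=> L0; rewrite /trep; set q := (x + L / 2) / L.
have := floor_itv q; rewrite floorD1_gt floor_le /= => _.
have h1 : (Num.floor q)%:~R <= q by apply: floor_le.
have h2 : q < (Num.floor q)%:~R + 1 by rewrite -intrD1 floorD1_gt.
have e : x + L / 2 = L * q by rewrite /q; field; rewrite gt_eqF.
have h1' : L * (Num.floor q)%:~R <= x + L / 2 by rewrite e ler_pM2l.
have h2' : x + L / 2 < L * (Num.floor q)%:~R + L.
  rewrite e; have : 0 < L * ((Num.floor q)%:~R + 1 - q) by apply: mulr_gt0 => //; lra.
  by lra.
by apply/andP; split; lra.
Qed.

Lemma trep_uniq L x w m : 0 < L -> - (L / 2) <= w -> w < L / 2 ->
  w = x + m%:~R * L -> trep L x = w.
Proof.
move=> L0 w1 w2 wE; rewrite /trep.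
suff -> : Num.floor ((x + L / 2) / L) = - m by rewrite intrN wE; ring.
apply: floor_def.
have -> : (x + L / 2) / L = (w + L / 2) / L - m%:~R.
  by rewrite wE; field; rewrite gt_eqF.
have a1 : 0 <= (w + L / 2) / L by apply: divr_ge0; lra.
have a2 : (w + L / 2) / L < 1 by rewrite ltr_pdivrMr //; lra.
by rewrite intrD1 intrN; apply/andP; split; lra.
Qed.

Lemma trep_ex L x : exists m, trep L x = x + m%:~R * L.
Proof. by eexists (- _); rewrite /trep intrN mulNr mulrC. Qed.

Lemma trepD L x m : 0 < L -> trep L (x + m%:~R * L) = trep L x.
Proof.
move=> L0; have [k kE] := trep_ex L x.
have /andP[h1 h2] := trep_itv x L0.
by apply: (@trep_uniq _ _ _ (k - m)) => //; rewrite kE intrB; ring.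
Qed.

Lemma trep_id L x : 0 < L -> - (L / 2) <= x -> x < L / 2 -> trep L x = x.
Proof. by move=> L0 h1 h2; apply: (@trep_uniq _ _ _ 0) => //; rewrite mul0r addr0. Qed.

Lemma int_abs_ge1 m : m != 0 -> (1 : R) <= `|m%:~R|.
Proof.
by move=> m0; rewrite -intr_norm -[X in X <= _](_ : 1%:~R = 1) // ler_int; lia.
Qed.

(** The representative has absolute value at most [L / 2], and every other element of its class
    differs from it by at least [L]. *)
Lemma trep_abs_le L x m : 0 < L -> `|trep L x| <= `|x + m%:~R * L|.
Proof.
move=> L0; have [k kE] := trep_ex L x.
have /andP[h1 h2] := trep_itv x L0.
have [->|km] := eqVneq m k; first by rewrite -kE.
have ab : `|trep L x| <= L / 2 by rewrite ler_norml; apply/andP; split; lra.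
have e : x + m%:~R * L = trep L x + (m - k)%:~R * L by rewrite kE intrB; ring.
have : L <= `|(m - k)%:~R * L|.
  rewrite normrM (gtr0_norm L0) ler_peMl ?int_abs_ge1 ?subr_eq0 //; exact: ltW.
move=> h3; rewrite e.
have := ler_normB (trep L x + (m - k)%:~R * L) (trep L x).
by rewrite [X in `|X|]addrC addKr; lra.
Qed.

(** [|trep L x|] is the distance from [x] to the lattice of multiples of [L], hence 1-Lipschitz,
    although [trep] itself jumps at [L / 2]. *)
Lemma trep_abs_lip L x y : 0 < L -> `|trep L x| <= `|trep L y| + `|x - y|.
Proof.
move=> L0; have [k kE] := trep_ex L y.
apply: (le_trans (@trep_abs_le _ x k L0)).
have -> : x + k%:~R * L = trep L y + (x - y) by rewrite kE; ring.
exact: ler_normD.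
Qed.

Definition tent h x : R := Num.max 0 (h - `|x|).

(* The primitive of [tent h] that vanishes at minus infinity. *)
Definition tent_prim h x : R :=
  if x <= - h then 0 else if x <= 0 then (x + h) ^+ 2 / 2
  else if x <= h then h ^+ 2 - (h - x) ^+ 2 / 2 else h ^+ 2.

Lemma tent_ge0 h x : 0 <= tent h x.
Proof. by rewrite /tent le_max lexx. Qed.

Lemma tent_le h x : 0 < h -> tent h x <= h.
Proof. by move=> h0; rewrite /tent ge_max ltW //= gerBl. Qed.

Lemma tent_far h x : h <= `|x| -> tent h x = 0.
Proof. by move=> hx; apply/max_idPl; rewrite subr_le0. Qed.

Lemma tent_prim_lo h x : x <= - h -> tent_prim h x = 0.
Proof. by move=> hx; rewrite /tent_prim hx. Qed.

Lemma tent_prim_hi h x : 0 < h -> h <= x -> tent_prim h x = h ^+ 2.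
Proof.
move=> h0 hx; rewrite /tent_prim.
case: (leP x (- h)) => a1; first by exfalso; lra.
case: (leP x 0) => a2; first by exfalso; lra.
by case: (leP x h) => // a3; have -> : x = h; [lra|rewrite subrr expr0n /= mul0r subr0].
Qed.

Lemma tent_prim_nd h x y : 0 < h -> x <= y -> tent_prim h x <= tent_prim h y.
Proof.
move=> h0 xy; rewrite /tent_prim.
case: (leP x (- h)) => a1; case: (leP y (- h)) => b1 //; try lra;
case: (leP x 0) => a2; case: (leP y 0) => b2; try lra; try nra;
case: (leP x h) => a3; case: (leP y h) => b3; try lra; try nra.
Qed.

(** [tent h] is the derivative of [tent_prim h] and is 1-Lipschitz, which gives the second-order
    remainder; both are piecewise polynomial, so each pair of pieces is checked. *)
Lemma tent_prim_taylor h x y : 0 < h -> x <= y ->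
  `|tent_prim h y - tent_prim h x - (y - x) * tent h x| <= (y - x) ^+ 2 / 2.
Proof.
move=> h0 xy; rewrite ler_norml /tent_prim.
have -> : tent h x = if x <= - h then 0 else if x <= 0 then h + x else
  if x <= h then h - x else 0.
  rewrite /tent; case: (leP x (- h)) => a1.
    by rewrite ler0_norm ?opprK; [apply/max_idPl|]; lra.
  case: (leP x 0) => a2; first by rewrite ler0_norm // opprK; apply/max_idPr; lra.
  rewrite gtr0_norm //; case: (leP x h) => a3; [apply/max_idPr|apply/max_idPl]; lra.
case: (leP x (- h)) => a1; case: (leP y (- h)) => b1 //;
case: (leP x 0) => a2; case: (leP y 0) => b2; 
case: (leP x h) => a3; case: (leP y h) => b3; apply/andP; split; try lra; nra.
Qed.

End torus.

(** * Periodic particle configurations *)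

Lemma ler_sum_subrange (R : realType) (F : nat -> R) (a b n : nat) :
  (forall i, 0 <= F i) -> (a <= b)%N -> (b <= n)%N ->
  \sum_(a <= i < b) F i <= \sum_(i < n) F i.
Proof.
move=> F0 ab bn; rewrite -(big_mkord predT F).
rewrite (@big_cat_nat _ _ _ b 0 n) // (@big_cat_nat _ _ _ a 0 b) //=.
by rewrite -[leLHS]addr0 lerD ?sumr_ge0 // lerDr sumr_ge0.
Qed.

Section periodic_configuration.
Context {R : realType}.
Variables (N : nat) (L c : R) (p : nat -> R).
Hypothesis N0 : (0 < N)%N.
Hypothesis L0 : 0 < L.
Hypothesis pN : forall k, p (k + N)%N = p k + L.
Hypothesis plt : forall k, p k < p k.+1.

Definition cdens k : R := c / (N%:R * (p k.+1 - p k)).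

Definition cfield (y : R) : R :=
  \sum_(k < N) (if `[< exists m : int, p k <= y + m%:~R * L < p k.+1 >]
                then cdens k else 0).

Let N0R : 0 < N%:R :> R. Proof. by rewrite ltr0n. Qed.

Lemma conf_lt i j : (i < j)%N -> p i < p j.
Proof. by move: i j; apply: (@homo_ltn _ p (fun x y => x < y)) => // y x z; exact: lt_trans. Qed.

Lemma conf_le i j : (i <= j)%N -> p i <= p j.
Proof. by rewrite leq_eqVlt => /predU1P[->//|/conf_lt/ltW]. Qed.

Lemma confM k m : p (k + m * N)%N = p k + m%:R * L.
Proof.
elim: m => [|m ih]; first by rewrite mul0n addn0 mul0r addr0.
by rewrite mulSn (addnC N) addnA pN ih -natr1; ring.
Qed.

Lemma cdensN k : cdens (k + N)%N = cdens k.
Proof. by rewrite /cdens -addSn !pN; congr (_ / (_ * _)); ring. Qed.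

Lemma cdensM k m : cdens (k + m * N)%N = cdens k.
Proof. by elim: m => [|m ih]; rewrite ?addn0 // mulSn addnCA addnC cdensN. Qed.

Lemma cdens_mod k : cdens (k %% N)%N = cdens k.
Proof. by rewrite [in RHS](divn_eq k N) addnC cdensM. Qed.

Lemma conf_mod k : p k = p (k %% N)%N + (k %/ N)%:R * L.
Proof. by rewrite {1}(divn_eq k N) addnC confM. Qed.

Lemma conf_cell n x : p 0%N <= x < p n -> exists2 j, (j < n)%N & p j <= x < p j.+1.
Proof.
elim: n => [|n ih] /andP[x1 x2]; first by have := le_lt_trans x1 x2; rewrite ltxx.
case: (ltP x (p n)) => xn; last by exists n => //; rewrite xn.
by have [j jn jx] := ih (introT andP (conj x1 xn)); exists j => //; exact: ltnW.
Qed.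

Lemma shift_into a x : exists m : int, a <= x + m%:~R * L < a + L.
Proof.
have [m mE] := trep_ex L (x - a - L / 2); exists m.
by have := trep_itv (x - a - L / 2) L0; rewrite mE => /andP[? ?]; apply/andP; split; lra.
Qed.

(** Both translates of [y] lie in one period starting at [p 0], so they coincide; consecutive cells
    are disjoint. *)
Lemma cell_uniq y (k1 k2 : nat) (m1 m2 : int) : (k1 < N)%N -> (k2 < N)%N ->
  p k1 <= y + m1%:~R * L < p k1.+1 -> p k2 <= y + m2%:~R * L < p k2.+1 -> k1 = k2.
Proof.
move=> k1N k2N /andP[a1 a2] /andP[b1 b2].
have e : p N = p 0%N + L by rewrite -pN add0n.
have h1 := conf_le (leq0n k1); have h2 := conf_le (leq0n k2).
have h3 : p k1.+1 <= p N by apply: conf_le.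
have h4 : p k2.+1 <= p N by apply: conf_le.
have mm : m1 = m2.
  apply/eqP; rewrite -subr_eq0; apply/negPn/negP => /(@int_abs_ge1 R).
  rewrite intrB => h.
  have : L <= `|(m1%:~R - m2%:~R) * L| by rewrite normrM (gtr0_norm L0) ler_peMl // ltW.
  by rewrite leNgt ltr_norml => /negP; apply; apply/andP; split; lra.
case: (ltngtP k1 k2) => // k12; exfalso.
  by have := conf_le k12; rewrite mm in a2; lra.
by have := conf_le k12; rewrite mm in a1; lra.
Qed.

Lemma cfield_cell j y (m : int) : p j <= y + m%:~R * L < p j.+1 -> cfield y = cdens j.
Proof.
move=> /andP[j1 j2]; have jN : (j %% N < N)%N by rewrite ltn_mod.
have e1 := conf_mod j.
have e2 : p j.+1 = p (j %% N)%N.+1 + (j %/ N)%:R * L.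
  by rewrite {1}(divn_eq j N) addnC -addSn confM.
have h : p (j %% N)%N <= y + (m - (j %/ N)%:Z)%:~R * L < p (j %% N)%N.+1.
  by rewrite intrB; apply/andP; split; rewrite mulrBl; lra.
rewrite /cfield (bigD1 (Ordinal jN)) //= ifT; last by apply/asboolP; exists (m - (j %/ N)%:Z).
rewrite cdens_mod big1 ?addr0 // => k /eqP kj.
case: ifPn => // /asboolP[m' h']; exfalso; apply: kj; apply: val_inj => /=.
exact: (cell_uniq (ltn_ord k) jN h' h).
Qed.

Lemma cfield_ex y : exists2 k, (k < N)%N & cfield y = cdens k.
Proof.
have [m hm] := shift_into (p 0%N) y.
rewrite -pN add0n in hm.
have [j jN hj] := conf_cell hm.
by exists j => //; exact: cfield_cell hj.
Qed.

Lemma conf_sum_len : \sum_(k < N) (p k.+1 - p k) = L.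
Proof.
rewrite -(big_mkord predT (fun k => p k.+1 - p k)) telescope_sumr // -{1}(add0n N) pN; ring.
Qed.

Lemma cdens_ge0 k : 0 <= c -> 0 <= cdens k.
Proof.
by move=> c0; rewrite /cdens divr_ge0 // mulr_ge0 // ?ltW // subr_gt0 plt.
Qed.

Lemma cdens_gt0 k : 0 < c -> 0 < cdens k.
Proof. by move=> c0; rewrite /cdens divr_gt0 // mulr_gt0 // subr_gt0 plt. Qed.

Lemma cdens_len k : cdens k * (p k.+1 - p k) = c / N%:R.
Proof. by rewrite /cdens; field; rewrite !gt_eqF // subr_gt0 plt. Qed.

(** The mean density is [c / L]: each of the [N] cells carries mass [c / N], and the lengths add up
    to [L]. *)
Lemma cdens_small : 0 <= c -> exists2 k, (k < N)%N & cdens k <= c / L.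
Proof.
move=> c0; apply: contrapT => hn.
have hlt (k : nat) : (k < N)%N -> c / L < cdens k.
  by move=> kN; rewrite ltNge; apply/negP => h; apply: hn; exists k.
have : \sum_(k < N) (c / L) * (p k.+1 - p k) < \sum_(k < N) cdens k * (p k.+1 - p k).
  apply: ltr_sum => [|k _]; last by rewrite ltr_pM2r ?hlt // subr_gt0 plt.
  by apply/hasP; exists (Ordinal N0); rewrite ?mem_index_enum.
rewrite -mulr_sumr conf_sum_len (eq_bigr (fun=> c / N%:R)); last by move=> k _; exact: cdens_len.
rewrite sumr_const card_ord -[X in _ < X](mulr_natr (c / N%:R) N).
by rewrite divfK ?gt_eqF // divfK ?gt_eqF // ltxx.
Qed.

Lemma conf_gap k i j : (forall l, p k.+1 - p k <= p l.+1 - p l) -> (i < j)%N ->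
  p k.+1 - p k <= p j - p i.
Proof. by move=> kmin ij; have := kmin i; have := conf_le ij; lra. Qed.

(** Two points of a half-open cell are closer than its length, which is the minimal gap, so they are
    the same lifted particle. *)
Lemma antipode_uniq k a i j (m1 m2 : int) :
  (forall l, p k.+1 - p k <= p l.+1 - p l) -> (i < N)%N -> (j < N)%N ->
  p k < p i + a + m1%:~R * L <= p k.+1 ->
  p k < p j + a + m2%:~R * L <= p k.+1 -> i = j.
Proof.
move=> kmin.
(* Lifts are indexed by naturals, so the difference of the two translations has to be nonnegative
   before it can be moved into the index as [i + n * N]. *)
wlog m12 : i j m1 m2 / m2 <= m1.
  move=> hw iN jN h1 h2; case: (leP m2 m1) => m12; first exact: (hw i j m1 m2).
  by apply/esym; apply: (hw j i m2 m1) => //; exact: ltW.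
move=> iN jN /andP[a1 a2] /andP[b1 b2].
have [n nE] : exists n : nat, m1 - m2 = n%:Z by exists `|m1 - m2|%N; lia.
have e : p (i + n * N)%N = p i + (m1 - m2)%:~R * L by rewrite confM nE.
rewrite intrB mulrBl in e; clear nE.
case: (ltngtP (i + n * N)%N j) => hij.
- by exfalso; have := @conf_gap k _ _ kmin hij; lra.
- by exfalso; have := @conf_gap k _ _ kmin hij; lra.
- case: n hij {e} => [|n]; first by rewrite mul0n addn0.
  by rewrite mulSn; lia.
Qed.

(** * Comparison of a density with its tent average *)

Section smoothing.
Variable phi : R -> R.
(** The predecessor is taken one period later, so that it exists for [k = 0]. *)
Definition cjump k : R := phi (cdens k) - phi (cdens (k + N).-1).

Lemma cjumpN k : cjump (k + N)%N = cjump k.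
Proof.
rewrite /cjump cdensN; congr (_ - phi _).
by rewrite -(cdensN (k + N).-1); congr cdens; lia.
Qed.

Lemma cjumpS k : cjump k.+1 = phi (cdens k.+1) - phi (cdens k).
Proof. by rewrite /cjump addSn /= cdensN. Qed.

Lemma phi_chain i j : (i <= j)%N ->
  `|phi (cdens j) - phi (cdens i)| <= \sum_(i <= k < j) `|cjump k.+1|.
Proof.
elim: j => [|j ih]; first by rewrite leqn0 => /eqP ->; rewrite subrr normr0 sumr_ge0.
rewrite leq_eqVlt => /predU1P[->|ij]; first by rewrite subrr normr0 sumr_ge0.
rewrite big_nat_recr //= cjumpS; apply: le_trans (lerD (ih ij) (lexx _)).
apply: le_trans (ler_normD _ _); rewrite le_eqVlt; apply/orP; left; apply/eqP.
by congr `|_|; ring.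
Qed.

Lemma phi_osc j k : (j < N)%N -> (k < N)%N ->
  phi (cdens k) <= phi (cdens j) + \sum_(i < N) `|cjump i|.
Proof.
have main a b : (a <= b)%N -> (b < N)%N ->
    `|phi (cdens b) - phi (cdens a)| <= \sum_(i < N) `|cjump i|.
  move=> ab bN; apply: le_trans (phi_chain ab) _.
  rewrite (_ : \sum_(a <= i < b) _ = \sum_(a.+1 <= i < b.+1) `|cjump i|); last by rewrite big_add1.
  by apply: ler_sum_subrange => //; rewrite ltnS.
move=> jN kN; case: (leP j k) => jk.
  by have := main _ _ jk kN; have := ler_norm (phi (cdens k) - phi (cdens j)); lra.
have := main _ _ (ltnW jk) jN; have := ler_norm (phi (cdens k) - phi (cdens j)).
by rewrite distrC; lra.
Qed.

Lemma sum3 (f : nat -> R) :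
  \sum_(i < 3 * N) f i = \sum_(i < N) (f i + f (i + N)%N + f (i + N + N)%N).
Proof.
rewrite -(big_mkord predT f) -(big_mkord predT (fun i => f i + f (i + N)%N + f (i + N + N)%N)).
rewrite !big_split /= (_ : 3 * N = N + N + N)%N; last by lia.
rewrite (@big_cat_nat _ _ _ N) ?leq0n //=; last by lia.
rewrite (@big_cat_nat _ _ _ (N + N) N) //=; try lia.
rewrite addrA; congr (_ + _ + _).
  by rewrite -{1}(add0n N) big_addn addnK.
by rewrite -{1}(add0n (N + N)%N) addnA big_addn big_addn !addnK.
Qed.

Lemma sum3_per (f : nat -> R) : (forall k, f (k + N)%N = f k) ->
  \sum_(i < 3 * N) f i = 3 * \sum_(i < N) f i.
Proof.
move=> fN; rewrite sum3 mulr_sumr; apply: eq_bigr => i _.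
by rewrite !fN; ring.
Qed.

Variable h : R.
Hypothesis h0 : 0 < h.
Hypothesis hL : h <= L / 2.

(* The factor [h ^ 2] normalizes the tent, whose integral it is. *)
Definition smoothed (y : R) : R :=
  c / N%:R * \sum_(k < N) tent h (trep L (p k - y)) / h ^+ 2.

Definition jump_near (y : R) : R :=
  \sum_(k < N) `|cjump k| * (`|trep L (p k - y)| < h)%R%:R.

Lemma jump_near_ge0 (y : R) : 0 <= jump_near y.
Proof. by apply: sumr_ge0 => k _; rewrite mulr_ge0. Qed.

(** [y] is lifted to the middle one of three periods. Of the three lifts of a particle, one realizes
    the torus representative; the others are at distance at least [L / 2 >= h], where the tent
    vanishes. *)
Lemma tent_unfold (y : R) (m : int) : p 0%N + L <= y + m%:~R * L < p 0%N + 2 * L ->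
  \sum_(k < N) tent h (trep L (p k - y)) = \sum_(k < 3 * N) tent h (p k - (y + m%:~R * L)).
Proof.
have hL' := hL; have L0' := L0; have h0' := h0.
move=> /andP[y1 y2]; rewrite (sum3 (fun k => tent h (p k - (y + m%:~R * L)))).
apply: eq_bigr => k _.
have hk : p k < p 0%N + L by rewrite -pN add0n; apply: conf_lt.
have h0k : p 0%N <= p k by apply: conf_le.
rewrite !pN.
set Y := y + m%:~R * L in y1 y2 *.
have E n : tent h (trep L (p k - y)) = tent h (trep L (p k - Y + n%:~R * L)).
  by rewrite trepD // -(trepD (p k - y) (- m) L0) intrN /Y; congr (tent _ (trep _ _)); ring.
have far (z : R) : L / 2 <= z \/ z <= - (L / 2) -> tent h z = 0.
  by move=> hz; apply: tent_far; rewrite ler_normr; apply/orP; case: hz => hz; [left|right]; lra.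
have [u1|u1] := leP (- (L / 2)) (p k - Y).
  rewrite (E 0) mul0r addr0 trep_id //; last by lra.
  rewrite (far (p k + L - Y)); last by left; lra.
  by rewrite (far (p k + L + L - Y)) ?addr0 //; left; lra.
have [u2|u2] := leP (- (3 * L / 2)) (p k - Y).
  rewrite (E 1) mul1r trep_id //; [|lra|lra].
  rewrite (far (p k - Y)); last by right; lra.
  rewrite (far (p k + L + L - Y)) ?addr0 ?add0r; last by left; lra.
  by congr tent; ring.
rewrite (E 2) trep_id //; [|rewrite (_ : 2%:~R = 2) //; lra|rewrite (_ : 2%:~R = 2) //; lra].
rewrite (far (p k - Y)); last by right; lra.
rewrite (far (p k + L - Y)) ?addr0 ?add0r; last by right; lra.
by congr tent; rewrite (_ : 2%:~R = 2) //; ring.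
Qed.

(** Torus distance is the least distance over all lifts, so each of the three lifts of a jump is
    dominated by its torus term; hence the factor 3. *)
Lemma jump_near_unfold (y : R) (m : int) :
  \sum_(k < 3 * N) `|cjump k| * (`|p k - (y + m%:~R * L)| < h)%R%:R <= 3 * jump_near y.
Proof.
rewrite /jump_near -(@sum3_per (fun k => `|cjump k| * (`|trep L (p k - y)| < h)%R%:R)).
  apply: ler_sum => k _; apply: ler_wpM2l => //.
  case: (ltP `|p k - (y + m%:~R * L)| h) => // hk.
  rewrite (le_lt_trans _ hk) //.
  rewrite (_ : p k - (y + m%:~R * L) = p k - y + (- m)%:~R * L) ?trep_abs_le //.
  by rewrite intrN; ring.
move=> k; rewrite cjumpN pN (_ : p k + L - y = p k - y + 1%:~R * L) ?trepD //.
by rewrite mul1r; ring.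
Qed.

(* The weights [w k], increments of the primitive of the tent over the cells, form a
   partition of unity; [cfield y] is compared with the average of the densities
   against them, and a density with nonzero weight is reached from [y] by crossing
   only jumps located within distance [h] of [y]. *)
Lemma smoothed_approx (Mo d Cd y : R) : 0 <= c -> 0 <= Cd ->
  (forall k, cdens k <= Mo) ->
  (forall a b : R, 0 <= a <= Mo -> 0 <= b <= Mo -> `|a - b| <= d + Cd * `|phi a - phi b|) ->
  `|cfield y - smoothed y| <=
     d + 3 * Cd * jump_near y + 3 * (c * L) / (2 * N%:R * h ^+ 2).
Proof.
move=> c0 Cd0 dMo phid.
have hL' := hL; have L0' := L0; have h0' := h0.
have [m hm] := shift_into (p 0%N + L) y.
have hm2 : p 0%N + L <= y + m%:~R * L < p 0%N + 2 * L by move: hm => /andP[? ?]; apply/andP; lra.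
have p3N : p (3 * N)%N = p 0%N + 3 * L by rewrite -[(3 * N)%N]add0n confM.
have hm3 : p 0%N <= y + m%:~R * L < p (3 * N)%N.
  by rewrite p3N; move: hm2 => /andP[? ?]; apply/andP; lra.
have [j jN hj] := conf_cell hm3.
rewrite (cfield_cell hj) /smoothed -mulr_suml (tent_unfold hm2).
set Y := y + m%:~R * L in hm hm2 hm3 hj *.
pose w k := (tent_prim h (p k.+1 - Y) - tent_prim h (p k - Y)) / h ^+ 2.
have h2 : 0 < h ^+ 2 by rewrite exprn_gt0.
have w0 k : 0 <= w k.
  apply: divr_ge0; last exact: ltW.
  rewrite subr_ge0; apply: tent_prim_nd => //.
  by have := plt k; lra.
have w1 : \sum_(k < 3 * N) w k = 1.
  rewrite -mulr_suml -(big_mkord predT (fun k => tent_prim h (p k.+1 - Y) - tent_prim h (p k - Y))).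
  rewrite (telescope_sumr (fun k => tent_prim h (p k - Y))) //.
  have /andP[Ya Yb] := hm2.
  have -> : tent_prim h (p (3 * N)%N - Y) = h ^+ 2 by apply: tent_prim_hi => //; rewrite p3N; lra.
  by rewrite tent_prim_lo ?subr0 ?divff ?gt_eqF //; lra.
pose S := 3 * jump_near y.
have S0 : 0 <= S by rewrite mulr_ge0 // jump_near_ge0.
have chain i k : (i <= k)%N -> (k < 3 * N)%N ->
    (forall l, (i < l <= k)%N -> `|p l - Y| < h) -> `|phi (cdens k) - phi (cdens i)| <= S.
  move=> ik kN hl; apply: le_trans (phi_chain ik) _.
  rewrite (_ : \sum_(i <= k0 < k) _ = \sum_(i.+1 <= l < k.+1) `|cjump l|); last by rewrite big_add1.
  rewrite (@eq_big_nat _ _ _ _ _ _ (fun l => `|cjump l| * (`|p l - Y| < h)%R%:R)); last first.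
    by move=> l hil; rewrite hl ?mulr1 //; lia.
  apply: le_trans (jump_near_unfold y m); rewrite -/Y.
  apply: (@ler_sum_subrange _ (fun l => `|cjump l| * (`|p l - Y| < h)%R%:R)) => //.
have key k : (k < 3 * N)%N -> w k * `|cdens j - cdens k| <= w k * (d + Cd * S).
  move=> kN; have [->|wk] := eqVneq (w k) 0; first by rewrite !mul0r.
  have {wk} : p k < Y + h /\ Y - h < p k.+1.
    split; rewrite ltNge; apply/negP => hk; move/eqP: wk; apply.
      rewrite /w !tent_prim_hi // ?subrr ?mul0r //; have := plt k; lra.
    rewrite /w !tent_prim_lo // ?subrr ?mul0r //; have := plt k; lra.
  move=> [k1 k2]; apply: ler_wpM2l => //.
  apply: le_trans (phid _ _ _ _) _; rewrite ?cdens_ge0 ?dMo //.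
  rewrite lerD2l; apply: ler_wpM2l => //.
  have /andP[j1 j2] := hj.
  case: (leqP j k) => jk.
    rewrite distrC; apply: chain => // l /andP[l1 l2].
    have := conf_le l1; have := conf_le l2.
    by move=> q1 q2; rewrite ltr_norml; apply/andP; split; lra.
  apply: chain => //; first exact: ltnW.
  move=> l /andP[l1 l2]; have := conf_le l1; have := conf_le l2.
  by move=> q1 q2; rewrite ltr_norml; apply/andP; split; lra.
have A1 : `|cdens j - \sum_(k < 3 * N) w k * cdens k| <= d + Cd * S.
  rewrite -{1}[cdens j]mul1r -w1 mulr_suml -sumrB.
  apply: le_trans (ler_norm_sum _ _ _) _.
  rewrite -[leRHS]mul1r -w1 mulr_suml; apply: ler_sum => k _.
  by rewrite -mulrBr normrM ger0_norm // key.
(* Replacing the weight of a cell of length [l] by [l * tent h / h ^ 2] costs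
   [cdens k * l ^ 2 / (2 h ^ 2)], which is [c / N * l / (2 h ^ 2)]; the lengths of three periods sum
   to [3 * L]. *)
have A2 : `|\sum_(k < 3 * N) w k * cdens k -
      c / N%:R * ((\sum_(k < 3 * N) tent h (p k - Y)) / h ^+ 2)| <=
      3 * (c * L) / (2 * N%:R * h ^+ 2).
  rewrite mulrA mulr_sumr mulr_suml -sumrB.
  apply: le_trans (ler_norm_sum _ _ _) _.
  have -> : 3 * (c * L) / (2 * N%:R * h ^+ 2) =
      \sum_(k < 3 * N) c / N%:R * (p k.+1 - p k) / (2 * h ^+ 2).
    rewrite -mulr_suml -mulr_sumr.
    rewrite -(big_mkord predT (fun k => p k.+1 - p k)) telescope_sumr // p3N.
    by field; rewrite !gt_eqF.
  apply: ler_sum => k _; rewrite -(cdens_len k) /w.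
  set l := p k.+1 - p k.
  have l0 : 0 < l by rewrite /l subr_gt0 plt.
  have pp : p k - Y <= p k.+1 - Y by have := plt k; lra.
  have := tent_prim_taylor h0 pp.
  rewrite (_ : p k.+1 - Y - (p k - Y) = l); last by rewrite /l; ring.
  set u := _ - _ - _ => hu.
  rewrite (_ : _ - _ = cdens k / h ^+ 2 * u); last by rewrite /u; field; rewrite gt_eqF.
  have q0 : 0 <= cdens k / h ^+ 2 by rewrite divr_ge0 ?cdens_ge0 // ltW.
  rewrite normrM ger0_norm //; apply: le_trans (ler_wpM2l q0 hu) _.
  by rewrite le_eqVlt; apply/orP; left; apply/eqP; field; rewrite gt_eqF.
rewrite (le_trans (ler_distD (\sum_(k < 3 * N) w k * cdens k) _ _)) //.
apply: le_trans (lerD A1 A2) _.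
by rewrite (_ : 3 * Cd * jump_near y = Cd * S) // /S; ring.
Qed.

End smoothing.
End periodic_configuration.

(** * Integrable majorants *)

Section interval_steps.
Context {R : realType}.
Local Notation mu := (@lebesgue_measure R).

Lemma measurable_step (w a b : R) : measurable_fun setT (fun y : R => w * \1_`[a, b] y).
Proof. by apply: measurable_funM => //; apply: measurable_indic. Qed.

Lemma integral_step (w a b : R) : 0 <= w -> a <= b ->
  (\int[mu]_y (w * \1_`[a, b] y)%:E = (w * (b - a))%:E)%E.
Proof.
move=> w0 ab; under eq_integral do rewrite EFinM.
rewrite ge0_integralZl_EFin //; last first.
  by apply/measurable_EFinP; apply: measurable_indic.
rewrite integral_indic // setIT /= lebesgue_measure_itv /= lte_fin.
by move: ab; rewrite le_eqVlt => /predU1P[->|->]; rewrite ?ltxx ?subrr ?mulr0 ?mule0.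
Qed.

Lemma integral_step_sum (I : Type) (r : seq I) (w a b : I -> R) :
  (forall i, 0 <= w i) -> (forall i, a i <= b i) ->
  (\int[mu]_y (\sum_(i <- r) w i * \1_`[a i, b i] y)%:E = (\sum_(i <- r) w i * (b i - a i))%:E)%E.
Proof.
move=> w0 ab; under eq_integral do rewrite -sumEFin.
rewrite ge0_integral_sum //.
- by rewrite -sumEFin; apply: eq_bigr => i _; exact: integral_step.
- by move=> i; apply/measurable_EFinP; exact: measurable_step.
- by move=> i y _; rewrite lee_fin mulr_ge0.
Qed.

Lemma measurable_step_sum (I : Type) (r : seq I) (w a b : I -> R) :
  measurable_fun setT (fun y : R => \sum_(i <- r) w i * \1_`[a i, b i] y).
Proof. by apply: measurable_sum => i; exact: measurable_step. Qed.

End interval_steps.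

Section majorants.
Context {R : realType}.
Local Notation mu := (@lebesgue_measure R).
Variables (N : nat) (L c : R) (p : nat -> R).
Hypothesis N0 : (0 < N)%N.
Hypothesis L0 : 0 < L.
Hypothesis c0 : 0 <= c.
Hypothesis pN : forall k, p (k + N)%N = p k + L.
Hypothesis plt : forall k, p k < p k.+1.

Let q k := trep L (p k).
Let e k := q k + (p k.+1 - p k).

Let tail_coef_ge0 k (r : R) : 0 < r -> 0 <= (`|q k| + (p k.+1 - p k)) / r.
Proof.
move=> r0; apply: divr_ge0; last exact: ltW.
by apply: addr_ge0 => //; rewrite subr_ge0; exact: ltW.
Qed.

(* A cell containing a point y with |y| >= r satisfies (|q| + length) / r >= 1; the second sum
   accounts for cells that wrap around the endpoint of the torus. *)
Definition tail_maj (r y : R) : R :=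
  \sum_(k < N) cdens N c p k * ((`|q k| + (p k.+1 - p k)) / r)
      * \1_`[q k, Num.max (q k) (Num.min (e k) (L / 2))] y +
  \sum_(k < N) cdens N c p k * ((`|q k| + (p k.+1 - p k)) / r)
      * \1_`[- (L / 2), Num.max (- (L / 2)) (e k - L)] y.

(** [Num.max] collapses an empty piece to a point instead of reversing it, so the two lengths still
    add up to that of the cell, as the integral of [tail_maj] requires. *)
Lemma cell_split (k : nat) (y : R) (m : int) : - (L / 2) <= y < L / 2 ->
  p k <= y + m%:~R * L < p k.+1 ->
  (q k <= y <= Num.max (q k) (Num.min (e k) (L / 2))) ||
  (- (L / 2) <= y <= Num.max (- (L / 2)) (e k - L)).
Proof.
have L0' := L0.
move=> /andP[y1 y2] /andP[m1 m2].
have [m0 m0E] := trep_ex L (p k).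
have /andP[q1 q2] := trep_itv (p k) L0; rewrite -/(q k) in m0E q1 q2.
have f1 : q k <= y + (m + m0)%:~R * L by rewrite m0E intrD; lra.
have f2 : y + (m + m0)%:~R * L < e k by rewrite /e m0E intrD; lra.
have [n0|n0|n0] := ltgtP (m + m0) 0.
- exfalso; have : (m + m0)%:~R * L <= (-1)%:~R * L by rewrite ler_wpM2r ?ler_int //; lia || exact: ltW.
  by rewrite mulN1r; lra.
- apply/orP; right; rewrite y1 /= le_max; apply/orP; right.
  have : 1%:~R * L <= (m + m0)%:~R * L by rewrite ler_wpM2r ?ler_int //; lia || exact: ltW.
  by rewrite mul1r; lra.
- apply/orP; left; rewrite n0 mul0r addr0 in f1 f2.
  by rewrite f1 /= le_max le_min (ltW f2) (ltW y2) orbT.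
Qed.

Lemma cfield_le_tail (r y : R) : 0 < r -> r <= `|y| -> - (L / 2) <= y < L / 2 ->
  cfield N L c p y <= tail_maj r y.
Proof.
move=> r0 ry yL; rewrite /tail_maj -big_split /=; apply: ler_sum => k _.
have d0 : 0 <= cdens N c p k by apply: cdens_ge0.
have l0 : 0 <= p k.+1 - p k by rewrite subr_ge0 ltW.
have t0 := tail_coef_ge0 k r0.
case: ifPn => [/asboolP[m hm]|_]; last by rewrite addr_ge0 // mulr_ge0 // mulr_ge0.
have t1 : 1 <= (`|q k| + (p k.+1 - p k)) / r.
  rewrite ler_pdivlMr // mul1r (le_trans ry) //.
  have /andP[y1 y2] := yL.
  rewrite -[in leLHS](trep_id L0 y1 y2) -(trepD y m L0).
  apply: le_trans (trep_abs_lip _ (p k) L0) _; rewrite lerD2l.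
  by move: hm => /andP[m1 m2]; rewrite ger0_norm; lra.
rewrite -mulrDr -[leLHS]mulr1 -mulrA; apply: ler_wpM2l => //.
rewrite -[leLHS]mulr1; apply: ler_pM => //.
rewrite !indicE !mem_setE !in_itv /=.
by have /orP[->|->] := cell_split yL hm; rewrite ?lerDl ?lerDr.
Qed.

Lemma measurable_tail_maj r : measurable_fun setT (tail_maj r).
Proof. by apply: measurable_funD; exact: measurable_step_sum. Qed.

Lemma tail_maj_ge0 (r y : R) : 0 < r -> 0 <= tail_maj r y.
Proof.
move=> r0; apply: addr_ge0; apply: sumr_ge0 => k _; rewrite mulr_ge0 //;
by apply: mulr_ge0; [exact: cdens_ge0|exact: tail_coef_ge0].
Qed.

Lemma integral_tail_maj (r : R) : 0 < r ->
  (\int[mu]_y (tail_maj r y)%:E =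
    ((c / N%:R * \sum_(k < N) `|trep L (p k)| + c * L / N%:R) / r)%:E)%E.
Proof.
move=> r0; have L0' := L0; rewrite /tail_maj; under eq_integral do rewrite EFinD.
have w0 k : 0 <= cdens N c p k * ((`|q k| + (p k.+1 - p k)) / r).
  by apply: mulr_ge0; [exact: cdens_ge0|exact: tail_coef_ge0].
rewrite ge0_integralD //; first last.
- by apply/measurable_EFinP; exact: measurable_step_sum.
- by move=> y _; rewrite lee_fin sumr_ge0 // => k _; rewrite mulr_ge0.
- by apply/measurable_EFinP; exact: measurable_step_sum.
- by move=> y _; rewrite lee_fin sumr_ge0 // => k _; rewrite mulr_ge0.
rewrite !integral_step_sum //; try by move=> k; rewrite le_max lexx.
rewrite -EFinD -big_split /=; congr EFin.
have -> : (c / N%:R * \sum_(k < N) `|trep L (p k)| + c * L / N%:R) / r =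
    \sum_(k < N) c / N%:R * ((`|trep L (p k)| + (p k.+1 - p k)) / r).
  by rewrite -mulr_sumr -mulr_suml big_split /= (conf_sum_len pN); field;
    rewrite !gt_eqF // ltr0n.
apply: eq_bigr => k _.
rewrite -mulrDr.
have l0 : 0 < p k.+1 - p k by rewrite subr_gt0.
have /andP[q1 q2] := trep_itv (p k) L0; rewrite -/(q k) in q1 q2.
have -> : Num.max (q k) (Num.min (e k) (L / 2)) - q k +
    (Num.max (- (L / 2)) (e k - L) - - (L / 2)) = p k.+1 - p k.
  have -> : Num.max (q k) (Num.min (e k) (L / 2)) = Num.min (e k) (L / 2).
    by apply/max_idPr; rewrite le_min (ltW q2) andbT /e; lra.
  case: (leP (e k) (L / 2)) => he.
    by rewrite (_ : Num.max _ _ = - (L / 2)); [rewrite /e; lra|apply/max_idPl; lra].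
  by rewrite (_ : Num.max _ _ = e k - L); [rewrite /e; lra|apply/max_idPr; lra].
rewrite mulrAC (cdens_len c N0 plt) -/(q k).
by field; rewrite !gt_eqF // ltr0n.
Qed.

Variables (phi : R -> R) (h : R).
Hypothesis h0 : 0 < h.

Definition jump_maj (y : R) : R :=
  \sum_(k < N) `|cjump N c p phi k| * \1_`[q k - h, q k + h] y.

(** Since [r + h < L / 2], a particle within torus distance [h] of [y] cannot be reached across the
    end of the period, so the torus distance is the ordinary one. *)
Lemma jump_near_maj (r y : R) : r + h < L / 2 -> `|y| <= r ->
  jump_near N L c p phi h y <= jump_maj y.
Proof.
have L0' := L0.
move=> rh; rewrite ler_norml => /andP[y1 y2]; apply: ler_sum => k _; apply: ler_wpM2l => //.
case: ltP => [hk|_]; last by rewrite ler0n.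
rewrite indicE mem_setE /= (_ : y \in _) //.
have [m mE] := trep_ex L (p k - y); have [m0 m0E] := trep_ex L (p k).
have /andP[q1 q2] := trep_itv (p k) L0; rewrite -/(q k) in m0E q1 q2.
rewrite ltr_norml in hk; move: hk => /andP[k1 k2].
have e1 : trep L (p k - y) = q k - y + (m - m0)%:~R * L by rewrite mE m0E intrB; ring.
have mm : m - m0 = 0.
  apply/eqP/negPn/negP => /(@int_abs_ge1 R) hm.
  have : L <= `|(m - m0)%:~R * L| by rewrite normrM (gtr0_norm L0) ler_peMl // ltW.
  by rewrite leNgt ltr_norml => /negP; apply; apply/andP; split; lra.
rewrite mm mul0r addr0 in e1; rewrite in_itv /=; apply/andP; split; lra.
Qed.

Lemma jump_maj_ge0 y : 0 <= jump_maj y.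
Proof. by apply: sumr_ge0 => k _; rewrite mulr_ge0. Qed.

Lemma measurable_jump_maj : measurable_fun setT jump_maj.
Proof. exact: measurable_step_sum. Qed.

Lemma integral_jump_maj :
  (\int[mu]_y (jump_maj y)%:E = (2 * h * \sum_(k < N) `|cjump N c p phi k|)%:E)%E.
Proof.
have h0' := h0; rewrite /jump_maj integral_step_sum //; last by move=> k; lra.
by congr EFin; rewrite mulr_sumr; apply: eq_bigr => k _; ring.
Qed.

End majorants.

Lemma sum_unique_le (R : realType) (n : nat) (P : pred nat) (a : R) : 0 <= a ->
  (forall i j, (i < n)%N -> (j < n)%N -> P i -> P j -> i = j) ->
  \sum_(i < n) (if P i then a else 0) <= a.
Proof.
move=> a0 Pu; have [/existsP[i Pi]|/existsPn h] := boolP [exists i : 'I_n, P i].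
  rewrite (bigD1 i) //= Pi big1 ?addr0 // => j /eqP ji.
  by case: ifPn => // Pj; case: ji; apply: val_inj; exact: (Pu j i).
by rewrite big1 // => i _; rewrite (negbTE (h i)).
Qed.

(** * The interaction drift *)

Section interaction.
Context {R : realType}.
Variables (N : nat) (L c : R) (p : nat -> R).
Hypothesis N0 : (0 < N)%N.
Hypothesis L0 : 0 < L.
Hypothesis c0 : 0 <= c.
Hypothesis pN : forall k, p (k + N)%N = p k + L.
Hypothesis plt : forall k, p k < p k.+1.
Variables (k1 : R -> R) (A B : R).
Hypothesis k1A : forall z : R, z != 0 -> `|k1 z| <= A.
Hypothesis k1B : forall z z' : R, 0 < z * z' -> `|k1 z - k1 z'| <= B * `|z - z'|.
Hypothesis B0 : 0 <= B.
Hypothesis A0 : 0 <= A.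

(** [k1] stands for [K']: bounded by [A], and [B]-Lipschitz on each open half-line. The
    self-interaction is excluded modulo [N] because [k] ranges over all lifts. *)
Definition drift k : R := c / N%:R * \sum_(j < N | (j : nat) != (k %% N)%N) k1 (trep L (p k - p j)).

(** A particle starts its own cell, so the only particle in a half-open cell is its left end. *)
Lemma cell_mod k j (m : int) : (j < N)%N -> p k <= p j + m%:~R * L < p k.+1 -> j = (k %% N)%N.
Proof.
move=> jN h.
have hj : p j <= p j + 0%:~R * L < p j.+1 by rewrite mul0r addr0 lexx plt.
have e1 := conf_mod pN k.
have e2 : p k.+1 = p (k %% N)%N.+1 + (k %/ N)%:R * L.
  by rewrite {1}(divn_eq k N) addnC -addSn (confM pN).
apply: (@cell_uniq _ N L p L0 pN plt (p j) j (k %% N)%N 0 (m - (k %/ N)%:Z)) => //.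
  by rewrite ltn_mod.
by move: h; rewrite e1 e2 intrB mulrBl => /andP[h1 h2]; apply/andP; split; lra.
Qed.

Lemma trep_diff_neq0 k (j : 'I_N) : (j : nat) != (k %% N)%N -> trep L (p k - p j) != 0.
Proof.
apply: contra_neq => h; have [m mE] := trep_ex L (p k - p j).
apply: (@cell_mod k j (- m)) => //; rewrite intrN mulNr.
have := plt k; have e : p k = p j - m%:~R * L by rewrite h in mE; lra.
by rewrite -e lexx => ->.
Qed.

Lemma drift_bound k : `|drift k| <= c * A.
Proof.
rewrite /drift normrM ger0_norm; last by rewrite divr_ge0.
have : `|\sum_(j < N | (j : nat) != (k %% N)%N) k1 (trep L (p k - p j))| <= N%:R * A.
  apply: le_trans (ler_norm_sum _ _ _) _.
  apply: le_trans (_ : \sum_(j < N | (j : nat) != (k %% N)%N) A <= _).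
    by apply: ler_sum => j jk; apply: k1A; exact: trep_diff_neq0.
  rewrite big_mkcond /=; apply: le_trans (_ : \sum_(j < N) A <= _).
    by apply: ler_sum => j _; case: ifP.
  by rewrite sumr_const card_ord mulr_natl.
move=> h; apply: le_trans (ler_wpM2l _ h) _; first by rewrite divr_ge0.
by rewrite mulrA divfK // pnatr_eq0 -lt0n.
Qed.

(* Only one particle can have its antipode in a half-open cell of minimal length, so the
   jump of the periodized kernel derivative at [L / 2] contributes at most once. *)
Lemma drift_gap k : (forall l, p k.+1 - p k <= p l.+1 - p l) ->
  `|drift k.+1 - drift k| <= c * B * (p k.+1 - p k) + 4 * A * (c / N%:R).
Proof.
move=> kmin; have A0' := A0; have B0' := B0; have L0' := L0.
pose cross (j : nat) := `[< exists m : int, p k < p j + L / 2 + m%:~R * L <= p k.+1 >].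
set l := p k.+1 - p k.
have l0 : 0 < l by rewrite subr_gt0 plt.
have key (j : 'I_N) :
    `|(if (j : nat) != (k.+1 %% N)%N then k1 (trep L (p k.+1 - p j)) else 0) -
      (if (j : nat) != (k %% N)%N then k1 (trep L (p k - p j)) else 0)| <=
    B * l + (if (j : nat) == (k %% N)%N then A else 0) +
    (if (j : nat) == (k.+1 %% N)%N then A else 0) + (if cross j then 2 * A else 0).
  have Bl : 0 <= B * l by rewrite mulr_ge0 // ltW.
  have C0 : 0 <= (if cross j then 2 * A else 0) :> R by case: ifP => // _; rewrite mulr_ge0.
  have [jk|jk] := eqVneq (j : nat) (k %% N)%N; have [jk'|jk'] := eqVneq (j : nat) (k.+1 %% N)%N => /=.
  - by move: C0; move: (if _ then _ else _) => X X0; rewrite subrr normr0; lra.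
  - by move: C0; move: (if _ then _ else _) => X X0; rewrite subr0; have := k1A (trep_diff_neq0 jk'); lra.
  - by move: C0; move: (if _ then _ else _) => X X0; rewrite sub0r normrN; have := k1A (trep_diff_neq0 jk); lra.
  have a1 := k1A (trep_diff_neq0 jk'); have a2 := k1A (trep_diff_neq0 jk).
  have n1 := trep_diff_neq0 jk'; have n2 := trep_diff_neq0 jk.
  rewrite !addr0; case: ifPn => [_|ncross].
    by apply: le_trans (ler_normB _ _) _; lra.
  rewrite addr0; have [m mE] := trep_ex L (p k - p j).
  have /andP[w1 w2] := trep_itv (p k - p j) L0.
  have wl : trep L (p k - p j) + l < L / 2.
    rewrite ltNge; apply: contra ncross => hc; apply/asboolP; exists (- m).
    by rewrite intrN mulNr /l in hc *; apply/andP; split; lra.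
  have e1 : trep L (p k.+1 - p j) = trep L (p k - p j) + l.
    by apply: (@trep_uniq _ _ _ _ m) => //; [lra|rewrite mE /l; ring].
  have e2 : trep L (p k.+1 - p j) - trep L (p k - p j) = l by rewrite e1; ring.
  apply: le_trans (k1B _) _; last by rewrite e2 (gtr0_norm l0).
  rewrite e1 in n1 *; set w := trep L (p k - p j) in w1 w2 wl mE n1 n2 *.
  have [w0|w0|w0] := ltgtP w 0; last by rewrite w0 eqxx in n2.
    have [wl0|wl0|wl0] := ltgtP (w + l) 0; last by rewrite wl0 eqxx in n1.
      by rewrite nmulr_rgt0.
    exfalso; move/eqP: jk; apply; apply: (@cell_mod k j (- m)) => //.
    by rewrite intrN mulNr /l in wl0 *; apply/andP; split; lra.
  by rewrite mulr_gt0 //; lra.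
rewrite /drift -mulrBr [X in _ * (X - _)]big_mkcond [X in _ * (_ - X)]big_mkcond /= -sumrB.
have cN : 0 <= c / N%:R by rewrite divr_ge0.
rewrite normrM (ger0_norm cN).
(* The particles [k] and [k.+1], each excluded from one of the two sums, contribute [A] each, and
   the antipodal one contributes [2 * A]; hence the constant 4. *)
apply: le_trans (_ : c / N%:R * (N%:R * (B * l) + A + A + 2 * A) <= _); last first.
  rewrite le_eqVlt; apply/orP; left; apply/eqP; field.
  by rewrite pnatr_eq0 -lt0n.
apply: ler_wpM2l => //; apply: le_trans (ler_norm_sum _ _ _) _.
apply: le_trans (ler_sum _ (fun j _ => key j)) _; rewrite !big_split /=.
apply: lerD; last first.
  apply: (@sum_unique_le _ _ cross) => [|i j iN jN /asboolP[m1 h1] /asboolP[m2 h2]].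
    by rewrite mulr_ge0.
  exact: (antipode_uniq N0 L0 pN plt kmin iN jN h1 h2).
apply: lerD; last by apply: (@sum_unique_le _ _ (pred1 (k.+1 %% N)%N)) => // i j _ _ /eqP -> /eqP ->.
apply: lerD; last by apply: (@sum_unique_le _ _ (pred1 (k %% N)%N)) => // i j _ _ /eqP -> /eqP ->.
by rewrite sumr_const card_ord mulr_natl.
Qed.

End interaction.

(** * A priori estimates for the particle system *)

Section calculus.
Context {R : realType}.
Implicit Types (f g : R -> R) (x a b : R).

Lemma is_derive_addf f g x a b : is_derive x 1 f a -> is_derive x 1 g b ->
  is_derive x 1 (fun t => f t + g t) (a + b).
Proof. by move=> fa gb; exact: is_deriveD. Qed.

Lemma is_derive_subf f g x a b : is_derive x 1 f a -> is_derive x 1 g b ->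
  is_derive x 1 (fun t => f t - g t) (a - b).
Proof. by move=> fa gb; exact: is_deriveB. Qed.

Lemma is_derive_scale f (k : R) x a : is_derive x 1 f a ->
  is_derive x 1 (fun t => k * f t) (k * a).
Proof. by move=> fa; exact: (is_deriveZ k). Qed.

Lemma is_derive_mulf f g x a b : is_derive x 1 f a -> is_derive x 1 g b ->
  is_derive x 1 (fun t => f t * g t) (f x * b + g x * a).
Proof. by move=> fa gb; exact: is_deriveM. Qed.

Lemma is_derive_sumf n (f : 'I_n -> R -> R) (df : 'I_n -> R) x :
  (forall i, is_derive x 1 (f i) (df i)) ->
  is_derive x 1 (fun t => \sum_(i < n) f i t) (\sum_(i < n) df i).
Proof.
move=> h; rewrite [X in is_derive _ _ X _](_ : _ = \sum_(i < n) f i); first exact: is_derive_sum.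
by apply/funext => t; rewrite fct_sumE.
Qed.

(** Only earlier times are compared, since the maximum over [[0, t]] in [rho_bound] may sit at
    [t]. *)
Lemma is_derive_left_max f x a d : a < x -> is_derive x 1 f d ->
  (forall t, a <= t <= x -> f t <= f x) -> 0 <= d.
Proof.
move=> ax [fd <-] fmax; rewrite ['D_1 f x]cvg_at_leftE //.
apply: limr_ge.
  rewrite -(cvg_at_leftE (fun h => h^-1 *: ((f \o shift x) _ - f x))) //.
  apply: cvg_trans fd; apply: cvg_app.
  move=> P [e egt0 Pe]; exists e => // y xe ygt0; apply: Pe => //.
  exact/ltr0_neq0.
near=> h; apply: mulr_le0.
  by rewrite invr_le0; apply: ltW; near: h; exists 1 => /=.
rewrite subr_le0 [_%:A]mulr1; apply: fmax; near: h.
exists (x - a) => [|h]; first by rewrite /= subr_gt0.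
rewrite /= distrC subr0 => /ltr_normlP[h1 h2] h0.
by apply/andP; split; [lra|rewrite gerDr ltW].
Unshelve. all: by end_near. Qed.

Lemma derive_bound_incr f (df : R -> R) a b (C : R) : a <= b ->
  {within `[a, b], continuous f} ->
  (forall x, a < x < b -> is_derive x 1 f (df x) /\ df x <= C) ->
  f b - f a <= C * (b - a).
Proof.
rewrite le_eqVlt => /predU1P[->|ab] cf hd; first by rewrite !subrr mulr0.
have hd' x : x \in `]a, b[%R -> is_derive x 1 f (df x) by rewrite in_itv /= => /hd[].
have [x xab ->] := MVT ab hd' cf.
by rewrite ler_pM2r ?subr_gt0 //; move: xab; rewrite in_itv /= => /hd[].
Qed.

Section continuity_on.
Variable A : set R.
Local Notation con f := {within A, continuous f}.

Lemma con_cst (k : R) : con (fun=> k : R).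
Proof. by apply/subspace_continuousP => x Ax; exact: cvg_cst. Qed.

Lemma con_add f g : con f -> con g -> con (fun t => f t + g t : R).
Proof.
move=> /subspace_continuousP cf /subspace_continuousP cg.
by apply/subspace_continuousP => x Ax; apply: cvgD; [exact: cf|exact: cg].
Qed.

Lemma con_sub f g : con f -> con g -> con (fun t => f t - g t : R).
Proof.
move=> /subspace_continuousP cf /subspace_continuousP cg.
by apply/subspace_continuousP => x Ax; apply: cvgB; [exact: cf|exact: cg].
Qed.

Lemma con_mul f g : con f -> con g -> con (fun t => f t * g t : R).
Proof.
move=> /subspace_continuousP cf /subspace_continuousP cg.
by apply/subspace_continuousP => x Ax; apply: cvgM; [exact: cf|exact: cg].
Qed.

Lemma con_comp f (g : R -> R) : con f -> (forall t, A t -> {for f t, continuous g}) ->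
  con (fun t => g (f t)).
Proof.
move=> /subspace_continuousP cf cg.
apply/subspace_continuousP => x Ax; apply: (@cvg_comp _ _ _ f g _ (nbhs (f x))); first exact: cf.
exact: cg.
Qed.

Lemma con_norm f : con f -> con (fun t => `|f t|).
Proof. by move=> cf; apply: con_comp => // t _; exact: norm_continuous. Qed.

Lemma con_sum n (f : 'I_n -> R -> R) : (forall i, con (f i)) ->
  con (fun t => \sum_(i < n) f i t : R).
Proof.
elim: n f => [|n ih] f cf.
  rewrite (_ : (fun _ => _) = (fun=> 0)); first exact: con_cst.
  by apply/funext => t; rewrite big_ord0.
rewrite (_ : (fun _ => _) = (fun t => \sum_(i < n) f (widen_ord (leqnSn n) i) t + f ord_max t)).
  by apply: con_add => //; apply: ih.
by apply/funext => t; rewrite big_ord_recr.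
Qed.

Lemma con_inv f : con f -> (forall t, A t -> f t != 0) -> con (fun t => (f t)^-1 : R).
Proof.
by move=> cf f0; apply: (@con_comp _ GRing.inv) => // t At; apply: inv_continuous; exact: f0.
Qed.

End continuity_on.

Lemma continuity_lower_endpoint f a b (C : R) : a < b -> {within `[a, b], continuous f} ->
  (forall t, a <= t < b -> C <= f t) -> C <= f b.
Proof.
move=> ab /(continuous_within_itvP _ ab)[_ _ fb] hC.
have <- : lim (f x @[x --> b^'-]) = f b by apply: cvg_lim fb.
apply: limr_ge; first by apply/cvg_ex; exists (f b).
near=> t; apply: hC; apply/andP; split; last by near: t; exact: nbhs_left_lt.
by near: t; exact: nbhs_left_ge.
Unshelve. all: by end_near. Qed.

Lemma sum_cyclic_shift (N : nat) (f : nat -> R) : (forall k, f (k + N)%N = f k) ->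
  \sum_(k < N) f k.+1 = \sum_(k < N) f k.
Proof.
move=> fN; apply/eqP; rewrite -subr_eq0 -sumrB.
rewrite -(big_mkord predT (fun k => f k.+1 - f k)) telescope_sumr //.
by rewrite -{1}(add0n N) fN subrr.
Qed.

(** With [u = N / c] the constant terms [(u * d)^-1] of the [N] particles sum to [c / d],
    independently of [N]. *)
Lemma young (u d z : R) : 0 < u -> 0 < d -> `|z| <= (u * d)^-1 + d * (u * z ^+ 2).
Proof.
move=> u0 d0; set v := u * d; have v0 : 0 < v by rewrite mulr_gt0.
rewrite (_ : d * (u * z ^+ 2) = v * `|z| ^+ 2); last by rewrite /v real_normK ?num_real; ring.
have h : 0 <= v^-1 * ((v * `|z| - 1) ^+ 2 + v * `|z|).
  by rewrite mulr_ge0 ?invr_ge0 ?(ltW v0) // addr_ge0 ?sqr_ge0 // mulr_ge0 // ltW.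
rewrite -subr_ge0 (_ : _ - _ = v^-1 * ((v * `|z| - 1) ^+ 2 + v * `|z|)) //.
by field; rewrite gt_eqF.
Qed.

End calculus.

(** * Entropy dissipation and the maximum principle for the density *)

Section dynamics.
Context {R : realType}.
Variables (W : R -> R) (c2 rbar : R).
Let phi := phiW W.
Hypothesis W0 : forall r : R, 0 <= r -> 0 <= W r.
Hypothesis Wd : forall r : R, 0 < r -> derivable W r 1.
Hypothesis phi_nd : forall x y : R, 0 <= x -> x <= y -> phi x <= phi y.
Hypothesis phi_c : forall r : R, 0 < r -> {for r, continuous phi}.
Hypothesis phi1_ge0 : 0 <= phi 1.
Hypothesis c2_gt0 : 0 < c2.
Hypothesis rbar_gt0 : 0 < rbar.
Hypothesis phi_lin : forall r : R, rbar <= r -> c2 * r <= phi r.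
Variables (N : nat) (L T c A B : R) (p b : nat -> R -> R).
Hypothesis N0 : (0 < N)%N.
Hypothesis L1 : 1 <= L.
Hypothesis T0 : 0 < T.
Hypothesis c0 : 0 < c.
Hypothesis c1 : c <= 1.
Hypothesis A0 : 0 <= A.
Hypothesis B0 : 0 <= B.
Hypothesis pN : forall t k, p (k + N)%N t = p k t + L.
Hypothesis plt : forall t : R, 0 <= t <= T -> forall k, p k t < p k.+1 t.
Hypothesis pcont : forall k, {within `[0, T], continuous (p k)}.

Definition rho (k : nat) (t : R) : R := cdens N c (p ^~ t) k.
Definition jump (k : nat) (t : R) : R := cjump N c (p ^~ t) phi k.
Definition vel (k : nat) (t : R) : R := - b k t - N%:R / c * jump k t.

Hypothesis pder : forall t : R, 0 < t < T -> forall k, is_derive t 1 (p k) (vel k t).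
Hypothesis bN : forall k t, b (k + N)%N t = b k t.
Hypothesis bA : forall t : R, 0 < t < T -> forall k, `|b k t| <= A.
Hypothesis bgap : forall t : R, 0 < t < T -> forall k,
  (forall l, p k.+1 t - p k t <= p l.+1 t - p l t) ->
  `|b k.+1 t - b k t| <= B * (p k.+1 t - p k t) + 4 * A * (c / N%:R).

Definition entropy (t : R) : R := \sum_(k < N) (p k.+1 t - p k t) * W (rho k t).
Definition dissip (t : R) : R := N%:R / c * \sum_(k < N) jump k t ^+ 2.

Let N0R : 0 < N%:R :> R. Proof. by rewrite ltr0n. Qed.
Let L0 : 0 < L. Proof. exact: lt_le_trans L1. Qed.
Let u0 : 0 < N%:R / c. Proof. by rewrite divr_gt0. Qed.

Lemma rho_gt0 k (t : R) : 0 <= t <= T -> 0 < rho k t.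
Proof. by move=> tT; apply: cdens_gt0 => //; exact: plt. Qed.

Lemma jumpN k t : jump (k + N)%N t = jump k t.
Proof. exact: (@cjumpN _ _ _ _ (p ^~ t) N0 L0 (pN t)). Qed.

Lemma velN k t : vel (k + N)%N t = vel k t.
Proof. by rewrite /vel bN jumpN. Qed.

Lemma len_gt0 k (t : R) : 0 <= t <= T -> 0 < p k.+1 t - p k t.
Proof. by move=> tT; rewrite subr_gt0; exact: plt. Qed.

Lemma rho_cont k : {within `[0, T], continuous (rho k)}.
Proof.
apply: con_mul; first exact: con_cst.
apply: con_inv; last first.
  by move=> t /=; rewrite in_itv /= => tT; rewrite mulf_neq0 ?gt_eqF // len_gt0.
by apply: con_mul; [exact: con_cst|apply: con_sub].
Qed.

Lemma jump_cont k : {within `[0, T], continuous (jump k)}.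
Proof.
have h j : {within `[0, T], continuous (fun t => phi (rho j t))}.
  apply: con_comp; first exact: rho_cont.
  by move=> t /=; rewrite in_itv /= => tT; apply: phi_c; exact: rho_gt0.
by apply: con_sub; exact: h.
Qed.

Lemma entropy_ge0 (t : R) : 0 <= t <= T -> 0 <= entropy t.
Proof.
move=> tT; apply: sumr_ge0 => k _; apply: mulr_ge0; first exact/ltW/len_gt0.
by apply: W0; exact/ltW/rho_gt0.
Qed.

Lemma entropy_cont : {within `[0, T], continuous entropy}.
Proof.
apply: con_sum => k; apply: con_mul; first exact: con_sub.
apply: con_comp; first exact: rho_cont.
move=> t /=; rewrite in_itv /= => tT; apply: differentiable_continuous.
by apply/derivable1_diffP; apply: Wd; exact: rho_gt0.
Qed.

Lemma rho_derive k (t : R) : 0 < t < T ->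
  is_derive t 1 (rho k) (- rho k t * (vel k.+1 t - vel k t) / (p k.+1 t - p k t)).
Proof.
move=> tT; have tT' : 0 <= t <= T by move: tT => /andP[? ?]; apply/andP; split; exact: ltW.
have l0 := len_gt0 k tT'.
have dl := is_derive_subf (pder tT k.+1) (pder tT k).
have := @is_derive_scale _ _ (c / N%:R) _ _ (@is_deriveV _ (fun s => p k.+1 s - p k s) t _ 1 (lt0r_neq0 l0) dl).
rewrite (_ : (fun _ => _) = rho k); last first.
  by apply/funext => s; rewrite /rho /cdens invfM mulrA.
move=> h; apply: is_derive_eq; rewrite /rho /cdens /= -mulr_algl.
rewrite scaler1; field.
by rewrite !gt_eqF.
Qed.

(** Density times length is constant, so each term has derivative [- phi (rho k t)] times the growth
    rate of the cell; summation by parts over the cycle moves the difference onto the pressures. *)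
Lemma entropy_derive (t : R) : 0 < t < T ->
  is_derive t 1 entropy (\sum_(k < N) vel k t * jump k t).
Proof.
move=> tT; have tT' : 0 <= t <= T by move: tT => /andP[? ?]; apply/andP; split; exact: ltW.
have -> : \sum_(k < N) vel k t * jump k t =
    \sum_(k < N) - (phi (rho k t) * (vel k.+1 t - vel k t)).
  pose f k := phi (rho (k + N).-1 t) * vel k t.
  have fN k : f (k + N)%N = f k.
    rewrite /f velN; congr (phi _ * _).
    have -> : ((k + N + N).-1 = (k + N).-1 + N)%N by move: N0; clear; lia.
    exact: (@cdensN _ _ _ c (p ^~ t) (pN t)).
  have fS k : f k.+1 = phi (rho k t) * vel k.+1 t.
    by rewrite /f addSn /= /rho (@cdensN _ _ _ c (p ^~ t) (pN t)).
  apply/eqP; rewrite -subr_eq0 -sumrB; apply/eqP.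
  rewrite -[RHS](_ : \sum_(k < N) (f k.+1 - f k) = 0); last first.
    by rewrite sumrB (sum_cyclic_shift fN) subrr.
  by apply: eq_bigr => k _; rewrite fS /f /jump /cjump /rho; ring.
apply: is_derive_sumf => k.
have dl := is_derive_subf (pder tT k.+1) (pder tT k).
have Wr := derivableP (Wd (rho_gt0 k tT')).
have dW := is_derive1_comp Wr (rho_derive k tT).
have := is_derive_mulf dl dW; move=> h; apply: is_derive_eq.
have l0 := len_gt0 k tT'.
by rewrite /= /phi /phiW derive1E; field; rewrite gt_eqF.
Qed.

Lemma sum_jump_le (d t : R) : 0 < d -> \sum_(k < N) `|jump k t| <= c / d + d * dissip t.
Proof.
move=> d0; rewrite /dissip mulr_sumr mulr_sumr.
have -> : c / d = \sum_(k < N) (N%:R / c * d)^-1.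
  by rewrite sumr_const card_ord -[RHS]mulr_natr; field; rewrite !gt_eqF.
by rewrite -big_split /=; apply: ler_sum => k _; exact: young.
Qed.

Lemma dissip_ge0 t : 0 <= dissip t.
Proof. by rewrite /dissip mulr_ge0 ?(ltW u0) // sumr_ge0 // => k _; exact: sqr_ge0. Qed.

(** Completing the square absorbs the drift: with [u = N / c], [- b J - u J ^ 2 <= b ^ 2 / (2 u) - u
    J ^ 2 / 2], and the [N] terms [A ^ 2 / (2 u)] sum to [c * A ^ 2 / 2]. *)
Lemma entropy_derive_le (t : R) : 0 < t < T ->
  \sum_(k < N) vel k t * jump k t <= - (dissip t / 2) + A ^+ 2 / 2.
Proof.
move=> tT; have c1' := c1; have A0' := A0.
have u0' := u0.
have h : \sum_(k < N) vel k t * jump k t <=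
   \sum_(k < N) ((N%:R / c)^-1 * (A ^+ 2 / 2) - N%:R / c * jump k t ^+ 2 / 2).
  apply: ler_sum => k _; rewrite /vel.
  have := bA tT k; move: (b k t) (jump k t) => z J hz.
  move: u0'; set u := N%:R / c => u0'.
  have z2 : z ^+ 2 <= A ^+ 2.
    by rewrite -(real_normK (num_real z)) lerXn2r // nnegrE.
  have h : 0 <= u^-1 * ((z + u * J) ^+ 2 + (A ^+ 2 - z ^+ 2)).
    by rewrite mulr_ge0 ?invr_ge0 ?(ltW u0') // addr_ge0 ?sqr_ge0 // subr_ge0.
  rewrite -subr_ge0 (_ : _ - _ = u^-1 * ((z + u * J) ^+ 2 + (A ^+ 2 - z ^+ 2)) / 2).
    by rewrite divr_ge0.
  by field; rewrite gt_eqF.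
apply: (le_trans h); rewrite sumrB sumr_const card_ord /dissip -mulr_suml -mulr_sumr.
rewrite -[X in X - _]mulr_natl (_ : N%:R * _ = c * (A ^+ 2 / 2)); last first.
  by field; rewrite !gt_eqF.
have : c * (A ^+ 2 / 2) <= A ^+ 2 / 2 by rewrite ler_piMl // divr_ge0 // sqr_ge0.
lra.
Qed.

Lemma entropy_growth (s t : R) : 0 <= s -> s <= t -> t <= T ->
  entropy t <= entropy s + A ^+ 2 / 2 * (t - s).
Proof.
move=> s0 st tT; rewrite -lerBlDl.
apply: (@derive_bound_incr _ entropy (fun t => \sum_(k < N) vel k t * jump k t)) => //.
  by apply: continuous_subspaceW entropy_cont => z /=; rewrite !in_itv /= => /andP[? ?]; apply/andP; lra.
move=> x /andP[x1 x2]; have xT : 0 < x < T by apply/andP; lra.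
split; first exact: entropy_derive.
have := entropy_derive_le xT; have := dissip_ge0 x; lra.
Qed.

(* Each jump contributes to the displacement through z <= 1/d + d z^2, whose quadratic part is
   absorbed by the entropy. *)
Lemma displacement (d s t : R) : 0 < d -> 0 <= s -> s <= t -> t <= T ->
  c / N%:R * \sum_(k < N) `|p k t - p k s| <=
    (A + d^-1 + d * A ^+ 2) * (t - s) + 2 * d * entropy s.
Proof.
move=> d0 s0 st tT; have c1' := c1; have A0' := A0; have c0' := c0.
(* Freezing the signs of the final displacements makes the sum of absolute values a differentiable
   function of time. *)
pose sg (k : nat) : R := Num.sg (p k t - p k s).
pose f (z : R) := c / N%:R * (\sum_(k < N) sg k * p k z) + 2 * d * entropy z.
pose df (z : R) := c / N%:R * (\sum_(k < N) sg k * vel k z) +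
  2 * d * \sum_(k < N) vel k z * jump k z.
have sub : [set` `[s, t]] `<=` [set` `[0, T]].
  by move=> z; rewrite /= !in_itv /= => /andP[? ?]; apply/andP; lra.
have := @derive_bound_incr _ f df s t (A + d^-1 + d * A ^+ 2) st.
have cf : {within `[s, t], continuous f}.
  apply: con_add; apply: con_mul; try exact: con_cst.
    apply: con_sum => k; apply: con_mul; first exact: con_cst.
    exact: continuous_subspaceW sub _.
  exact: continuous_subspaceW sub entropy_cont.
move=> /(_ cf) hf.
have {}hf : f t - f s <= (A + d^-1 + d * A ^+ 2) * (t - s).
  apply: hf => x /andP[x1 x2]; have xT : 0 < x < T by apply/andP; lra.
  split.
    apply: is_derive_addf; apply: is_derive_scale; last exact: entropy_derive.
    by apply: is_derive_sumf => k; apply: is_derive_scale; exact: pder.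
  have h1 : c / N%:R * \sum_(k < N) sg k * vel k x <= c * A + \sum_(k < N) `|jump k x|.
    rewrite mulr_sumr (_ : c * A = \sum_(k < N) c / N%:R * A); last first.
      by rewrite sumr_const card_ord -[RHS]mulr_natr; field; rewrite gt_eqF.
    rewrite -big_split /=; apply: ler_sum => k _.
    apply: le_trans (ler_norm _) _.
    have cN : 0 <= c / N%:R by rewrite divr_ge0 // ltW.
    rewrite normrM (ger0_norm cN) normrM.
    have sg1 : `|sg k| <= 1 by rewrite /sg normr_sg lern1; case: (_ != _).
    apply: le_trans (_ : c / N%:R * `|vel k x| <= _).
      by apply: ler_wpM2l => //; rewrite ler_piMl.
    have -> : `|jump k x| = c / N%:R * `|N%:R / c * jump k x|.
      by rewrite normrM (gtr0_norm u0); field; rewrite !gt_eqF.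
    rewrite -mulrDr; apply: ler_wpM2l => //.
    apply: le_trans (ler_normB _ _) _; rewrite normrN lerD2r; exact: bA.
  have h2 := sum_jump_le x d0; have h3 := entropy_derive_le xT.
  have h4 : c * A <= A by rewrite ler_piMl.
  have h5 : c / d <= d^-1 by rewrite ler_piMl // invr_ge0 ltW.
  have h6 : 2 * d * \sum_(k < N) vel k x * jump k x <= 2 * d * (- (dissip x / 2) + A ^+ 2 / 2).
    by apply: ler_wpM2l => //; lra.
  rewrite /df; move: h1 h2 h6.
  move: (c / N%:R * _) (\sum_(k < N) `|jump k x|) (2 * d * \sum_(k < N) _) => S1 S2 S3.
  by move=> h1 h2 h6; lra.
have fts : f t - f s = c / N%:R * (\sum_(k < N) `|p k t - p k s|) + 2 * d * (entropy t - entropy s).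
  rewrite /f [in RHS](eq_bigr (fun k : 'I_N => sg k * p k t - sg k * p k s)); last first.
    by move=> k _; rewrite -mulrBr /sg -normrEsg.
  by rewrite sumrB; ring.
have e0 : 0 <= 2 * d * entropy t.
  by rewrite mulr_ge0 ?entropy_ge0 ?mulr_ge0 ?(ltW d0) //; apply/andP; lra.
by rewrite fts in hf; lra.
Qed.

(** The entropy loses half of the dissipation, so [C3 / 2] must equal [4 * A / c2]. [C4] collects
    the bounded terms; its final 1 makes the derivative in [ln_rho_derive_neg] strictly negative. *)
Let C3 : R := 8 * A / c2.
Let C4 : R := B + 4 * A * (rbar + (phi 1 + 1) / c2) + C3 * A ^+ 2 / 2 + 1.

(** The pressure is at most [phi 1] in the cell given by [cdens_small], and it climbs from there by
    at most the sum of the jumps, which [sum_jump_le] with [d = 1] bounds by [1 + dissip t]. *)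
Lemma rho_le_dissip (t : R) k : 0 <= t <= T -> (k < N)%N ->
  rho k t <= rbar + (phi 1 + 1 + dissip t) / c2.
Proof.
move=> tT kN; have c1' := c1; have V0 := dissip_ge0 t; have p1 := phi1_ge0.
have L1' := L1; have c0' := c0; have L0' := L0.
case: (leP rbar (rho k t)) => hr; last first.
  have : 0 <= (phi 1 + 1 + dissip t) / c2 by rewrite divr_ge0 ?(ltW c2_gt0) //; lra.
  by have := hr; lra.
have [j jN hj] := @cdens_small _ N L c (p ^~ t) N0 L0 (pN t) (plt tT) (ltW c0).
have h1 := phi_lin hr.
have h2 := @phi_osc _ N L c (p ^~ t) (pN t) phi j k jN kN.
have h3 : phi (cdens N c (p^~ t) j) <= phi 1.
  apply: phi_nd; first exact/ltW/rho_gt0.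
  by apply: le_trans hj _; rewrite ler_pdivrMr // mul1r; lra.
have := @sum_jump_le 1 t ltr01; rewrite divr1 mul1r => h4.
have h5 : rho k t <= (phi 1 + 1 + dissip t) / c2.
  rewrite ler_pdivlMr // mulrC; apply: (le_trans h1); apply: (le_trans h2).
  apply: le_trans (lerD h3 h4) _; lra.
by have := rbar_gt0; lra.
Qed.

Lemma rho_min_len (t : R) k : 0 <= t <= T -> (forall j, rho j t <= rho k t) ->
  forall l, p k.+1 t - p k t <= p l.+1 t - p l t.
Proof.
move=> tT kmax l; have h1 := rho_gt0 l tT; have h2 := kmax l.
have e1 := @cdens_len _ N c (p ^~ t) N0 (plt tT) l.
have e2 := @cdens_len _ N c (p ^~ t) N0 (plt tT) k.
have l1 := len_gt0 k tT; have l2 := len_gt0 l tT.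
rewrite -(ler_pM2l h1); apply: le_trans (_ : rho k t * (p k.+1 t - p k t) <= _).
  by rewrite ler_pM2r.
by rewrite /rho e1 e2.
Qed.

(* The Lyapunov correction [C3 * entropy] absorbs the quadratic growth rate
   [4 * A * rho] produced by a kink of the kernel at the origin. *)
Lemma ln_rho_derive_neg (t : R) k : 0 < t < T -> (k < N)%N -> (forall j, rho j t <= rho k t) ->
  exists2 d, d < 0 &
    is_derive t 1 (fun s => ln (rho k s) + C3 * entropy s - C4 * s) d.
Proof.
move=> tT kN kmax; have tT' : 0 <= t <= T by move: tT => /andP[? ?]; apply/andP; split; exact: ltW.
have r0 := rho_gt0 k tT'; have l0 := len_gt0 k tT'.
have A0' := A0; have B0' := B0; have c2' := c2_gt0.
have dl := is_derive1_comp (is_derive1_ln r0) (rho_derive k tT).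
have dH := is_derive_scale C3 (entropy_derive tT).
have dt := is_derive_scale C4 (is_derive_id t (1 : R)).
have D := is_derive_subf (is_derive_addf dl dH) dt.
exists ((rho k t)^-1 * (- rho k t * (vel k.+1 t - vel k t) / (p k.+1 t - p k t)) +
  C3 * (\sum_(k < N) vel k t * jump k t) - C4 * 1) => //.
(* At a maximal density the pressure terms can only lengthen the cell, so [hv] drops them. *)
have J1 : jump k.+1 t <= 0.
  rewrite /jump (@cjumpS _ _ _ _ (p ^~ t) (pN t)) subr_le0.
  by apply: phi_nd; [exact/ltW/rho_gt0|exact: kmax].
have J0 : 0 <= jump k t.
  by rewrite /jump /cjump subr_ge0; apply: phi_nd; [exact/ltW/rho_gt0|exact: kmax].
have kmin := rho_min_len tT' kmax.
have hb := bgap tT kmin.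
have hv : - (vel k.+1 t - vel k t) <= B * (p k.+1 t - p k t) + 4 * A * (c / N%:R).
  have h : 0 <= N%:R / c * (jump k t - jump k.+1 t) by rewrite mulr_ge0 ?(ltW u0) //; lra.
  rewrite /vel; have := ler_norm (b k.+1 t - b k t); lra.
have e1 : (rho k t)^-1 * (- rho k t * (vel k.+1 t - vel k t) / (p k.+1 t - p k t)) =
   - (vel k.+1 t - vel k t) / (p k.+1 t - p k t) by field; rewrite !gt_eqF.
have h1 : - (vel k.+1 t - vel k t) / (p k.+1 t - p k t) <= B + 4 * A * rho k t.
  have e : rho k t * (p k.+1 t - p k t) = c / N%:R by exact: (cdens_len c N0 (plt tT')).
  by rewrite ler_pdivrMr // mulrDl (le_trans hv) // lerD2l -[leRHS]mulrA e.
have h2 : 4 * A * rho k t <= 4 * A * (rbar + (phi 1 + 1 + dissip t) / c2).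
  by apply: ler_wpM2l; [rewrite mulr_ge0|exact: rho_le_dissip].
have C30 : 0 <= C3 by rewrite /C3 divr_ge0 ?mulr_ge0 // ltW.
have h3 := ler_wpM2l C30 (entropy_derive_le tT).
have e2 : C3 * (- (dissip t / 2) + A ^+ 2 / 2) = C3 * A ^+ 2 / 2 - 4 * A * (dissip t / c2).
  by rewrite /C3; field; rewrite gt_eqF.
have e3 : 4 * A * (rbar + (phi 1 + 1 + dissip t) / c2) =
  4 * A * (rbar + (phi 1 + 1) / c2) + 4 * A * (dissip t / c2) by field; rewrite gt_eqF.
rewrite e1 mulr1 /C4; rewrite e2 in h3; rewrite e3 in h2.
by move: h1 h2 h3; move: (4 * A * (dissip t / c2)) (4 * A * rho k t) (C3 * A ^+ 2 / 2)
  (4 * A * (rbar + (phi 1 + 1) / c2)) (C3 * _) (_ / _) => a1 a2 a3 a4 a5 a6; lra.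
Qed.

(** A maximum principle over all particles and all times in [[0, t]]. The case [t < T] comes first
    because the equation is given on the open interval only; time [T] follows by continuity. *)
Lemma rho_bound (M H0 : R) : 0 < M -> (forall k, rho k 0 <= M) -> entropy 0 <= H0 ->
  forall t, 0 <= t <= T -> forall k, rho k t <= M * expR (C3 * H0 + C4 * T).
Proof.
move=> M0 hM hH.
have A0' := A0; have c2' := c2_gt0; have T0' := T0; have B0' := B0.
have C30 : 0 <= C3 by rewrite /C3 divr_ge0 ?mulr_ge0 // ltW.
have C40 : 0 <= C4.
  have q1 : 0 <= (phi 1 + 1) / c2 by rewrite divr_ge0 ?(ltW c2') // addr_ge0.
  have q2 : 0 <= 4 * A * (rbar + (phi 1 + 1) / c2).
    by rewrite mulr_ge0 ?mulr_ge0 // addr_ge0 // ltW.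
  have q3 : 0 <= C3 * A ^+ 2 / 2 by rewrite divr_ge0 // mulr_ge0 // sqr_ge0.
  by rewrite /C4; lra.
pose g k s := ln (rho k s) + C3 * entropy s - C4 * s.
have gc k : {within `[0, T], continuous (g k)}.
  apply: con_sub; first apply: con_add.
  - apply: con_comp; first exact: rho_cont.
    by move=> t /=; rewrite in_itv /= => tT; apply: continuous_ln; exact: rho_gt0.
  - by apply: con_mul; [exact: con_cst|exact: entropy_cont].
  - apply: con_mul; first exact: con_cst.
    by apply/subspace_continuousP => x _; exact: cvg_within.
have half t k : 0 <= t -> t < T -> rho k t <= M * expR (C3 * H0 + C4 * T).
  move=> t0 tT.
  have sub : [set` `[0, t]] `<=` [set` `[0, T]].
    by move=> z; rewrite /= !in_itv /= => /andP[? ?]; apply/andP; lra.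
  have /choice[sm hsm] : forall i : 'I_N, exists s : R,
      s \in `[0, t] /\ forall z, z \in `[0, t] -> g i z <= g i s.
    move=> i; have [s sm hs] := EVT_max t0 (continuous_subspaceW sub (gc i)).
    by exists s.
  pose k0 := [arg max_(i > Ordinal N0) g i (sm i)]%O.
  have hk0 (i : 'I_N) : g i (sm i) <= g k0 (sm k0).
    by rewrite /k0; case: arg_maxP => // j _ hj; exact: hj.
  have [s0t gmax] := hsm k0; set s0 := sm k0 in hk0 s0t gmax.
  have gall i z : z \in `[0, t] -> g (i %% N)%N z <= g k0 s0.
    move=> zt; have iN : (i %% N < N)%N by rewrite ltn_mod.
    have := (hsm (Ordinal iN)).2 _ zt => /= h; apply: (le_trans h).
    exact: (hk0 (Ordinal iN)).
  have rho_mod i z : rho (i %% N)%N z = rho i z by exact: (@cdens_mod _ _ _ _ (p ^~ z) (pN z)).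
  have s0E : s0 = 0.
    move: s0t; rewrite in_itv /= => /andP[s00 s0t].
    apply/eqP; rewrite eq_le s00 andbT leNgt; apply/negP => s0p.
    have s0T : 0 < s0 < T by rewrite s0p; lra.
    have s0T' : 0 <= s0 <= T by apply/andP; lra.
    (* The entropy and time terms of [g] do not depend on the particle, so the index that maximizes
       [g] also maximizes the density. *)
    have kmax j : rho j s0 <= rho k0 s0.
      have := gall j s0; rewrite in_itv /= s00 s0t => /(_ isT); rewrite /g rho_mod => h.
      rewrite -ler_ln ?posrE ?rho_gt0 //; lra.
    have [d d0 hd] := ln_rho_derive_neg s0T (ltn_ord k0) kmax.
    have := @is_derive_left_max _ (g k0) s0 0 d s0p hd; rewrite leNgt d0 => h.
    by apply: notF; apply: h => z /andP[z0 zs]; apply: gmax; rewrite in_itv /=; apply/andP; lra.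
  have tin : t \in `[0, t] by rewrite in_itv /= t0 lexx.
  have := gall k t tin; rewrite s0E /g rho_mod mulr0 subr0 => h.
  have tT' : 0 <= t <= T by apply/andP; lra.
  have zT : 0 <= (0:R) <= T by apply/andP; lra.
  have h1 : ln (rho k0 0) <= ln M by rewrite ler_ln ?posrE ?rho_gt0.
  have h2 : C3 * entropy 0 <= C3 * H0 by apply: ler_wpM2l.
  have h3 : C4 * t <= C4 * T by apply: ler_wpM2l => //; lra.
  have h4 : 0 <= C3 * entropy t by rewrite mulr_ge0 // entropy_ge0.
  rewrite -(@lnK _ M) ?posrE // -expRD -(@lnK _ (rho k t)) ?posrE ?rho_gt0 // ler_expR.
  lra.
move=> t /andP[t0]; rewrite le_eqVlt => /predU1P[->|tT] k; last exact: half.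
set MM := M * _ in half *.
rewrite -[leLHS]opprK -[leRHS]opprK lerN2.
apply: (@continuity_lower_endpoint _ (fun s => - rho k s) 0 T) => //.
  rewrite (_ : (fun _ => _) = fun s => 0 - rho k s); last by apply/funext => s; rewrite sub0r.
  by apply: con_sub; [exact: con_cst|exact: rho_cont].
by move=> s /andP[s0 sT]; rewrite lerN2; exact: half.
Qed.

(** The sum of the jumps is at most [1 + dissip], while twice the entropy loses [dissip] up to
    [A ^ 2]; hence the primitive of the sum plus twice the entropy grows at rate at most
    [1 + A ^ 2]. *)
Lemma integral_jump :
  (\int[lebesgue_measure]_(t in `[0%R, T]) (\sum_(k < N) `|jump k t|)%:E <=
    (2 * entropy 0 + (1 + A ^+ 2) * T)%:E)%E.
Proof.
set J := fun t => \sum_(k < N) `|jump k t|.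
have T0' := T0; have c1' := c1.
have Jc : {within `[0, T], continuous J}.
  by apply: con_sum => k; apply: con_norm; exact: jump_cont.
have Ji : (lebesgue_measure).-integrable `[0, T] (EFin \o J).
  by apply: continuous_compact_integrable => //; exact: segment_compact.
pose F := fun x => (\int[lebesgue_measure]_(t in [set` `[0, x]]) (J t))%R.
have Fc : {within `[0, T], continuous F}.
  exact: (parameterized_integral_continuous (ltW T0) Ji).
have Fd x : 0 < x < T -> is_derive x 1 F (J x).
  move=> /andP[x0 xT].
  have [|dF eF] := @continuous_FTC1_closed R J 0 x T xT Ji x0.
    have [+ _ _] := (continuous_within_itvP J T0).1 Jc.
    by apply; rewrite in_itv /= x0.
  by rewrite -eF derive1E; exact: derivableP.
have := @derive_bound_incr _ (fun x => F x + 2 * entropy x)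
  (fun x => J x + 2 * \sum_(k < N) vel k x * jump k x) 0 T (1 + A ^+ 2) (ltW T0).
have cc : {within `[0, T], continuous (fun x => F x + 2 * entropy x)}.
  by apply: con_add => //; apply: con_mul; [exact: con_cst|exact: entropy_cont].
move=> /(_ cc) h.
have {}h : F T + 2 * entropy T - (F 0 + 2 * entropy 0) <= (1 + A ^+ 2) * (T - 0).
  apply: h => x xT; split.
    apply: is_derive_addf; first exact: Fd.
    by apply: is_derive_scale; exact: entropy_derive.
  have h1 := entropy_derive_le xT; have := @sum_jump_le 1 x ltr01; rewrite divr1 mul1r -/(J x); lra.
have F0 : F 0 = 0 by rewrite /F set_itv1 Rintegral_set1.
have ET : 0 <= entropy T by apply: entropy_ge0; apply/andP; lra.
have -> : (\int[lebesgue_measure]_(t in `[0%R, T]) (J t)%:E)%E = (F T)%:E.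
  by rewrite /F /Rintegral fineK //; exact: integrable_fin_num.
by rewrite lee_fin; rewrite F0 subr0 in h; lra.
Qed.

End dynamics.

(** * Initial configurations *)

Section equal_mass_points.
Context {R : realType}.
Local Notation mu := (@lebesgue_measure R).
Variables (f : R -> R) (L M : R).
Hypothesis L0 : 0 < L.
Hypothesis M0 : 0 < M.
Hypothesis fm : measurable_fun setT f.
Hypothesis f0 : forall x, 0 <= f x.
Hypothesis fM : {ae mu, forall x, f x <= M}.

Lemma weighted_integrable (w : R -> R) (K a b : R) : measurable_fun setT w ->
  (forall x, a <= x <= b -> 0 <= w x <= K) ->
  mu.-integrable `[a, b] (EFin \o (fun x => w x * f x)).
Proof.
move=> wm wK; have mwf : measurable_fun `[a, b] (EFin \o (fun x => w x * f x)).
  apply/measurable_EFinP; apply: measurable_funTS; exact: measurable_funM.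
apply/integrableP; split => //.
apply: (@le_lt_trans _ _ (\int[mu]_(x in `[a, b]) (K * M)%:E)%E); last first.
  rewrite integral_cst //= lebesgue_measure_itv /= lte_fin.
  by case: ifP => _; rewrite ?mule0 // -EFinB -EFinM ltry.
have [ab|ab] := leP a b; last first.
  by rewrite set_itv_ge ?bnd_simp -?ltNge // !integral_set0.
have K0 : 0 <= K.
  by have /andP[h1 h2] : 0 <= w a <= K; [apply: wK; rewrite lexx ab|exact: le_trans h1 h2].
apply: ae_ge0_le_integral => //.
- by apply: measurableT_comp.
- by move=> x _; rewrite lee_fin mulr_ge0 // ltW.
case: fM => Z [mZ Z0 hZ]; exists Z; split => // x /= nx; apply: hZ => /= fx; apply: nx.
rewrite in_itv /= => xab; have /andP[w0 wk] := wK _ xab.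
by rewrite lee_fin ger0_norm ?mulr_ge0 // ler_pM.
Qed.

(** The weight 1 gives the distribution function of [f] and the weight [|x|] its first moment;
    comparing the two cell by cell yields the moment estimate. *)
Definition wmass (w : R -> R) (x : R) : R := \int[mu]_(y in `[- (L / 2), x]) (w y * f y).

Definition bounded_weight (w : R -> R) : Prop :=
  measurable_fun setT w /\ forall b, exists K, forall x, - (L / 2) <= x <= b -> 0 <= w x <= K.

Lemma wmass_incr (w : R -> R) (a b : R) : bounded_weight w ->
  - (L / 2) <= a -> a <= b ->
  wmass w b - wmass w a = \int[mu]_(y in `]a, b]) (w y * f y).
Proof.
move=> [wm wb] La ab; have [K wK] := wb b.
rewrite /wmass Rintegral_itvB //.
exact: weighted_integrable wK.
Qed.

Lemma wmass_le (w w' : R -> R) (a b : R) : bounded_weight w -> bounded_weight w' ->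
  - (L / 2) <= a -> a <= b -> (forall y, a < y <= b -> w y <= w' y) ->
  wmass w b - wmass w a <= wmass w' b - wmass w' a.
Proof.
move=> bw bw' La ab ww'; rewrite !wmass_incr //.
have sub : `]a, b]%classic `<=` `[- (L / 2), b]%classic.
  by move=> x /=; rewrite !in_itv /= => /andP[? ->]; rewrite andbT; lra.
apply: le_Rintegral => //.
- have [K wK] := bw.2 b; apply: (@integrableS _ _ _ mu `[- (L / 2), b]%classic); [exact: measurable_itv|exact: measurable_itv|exact: sub|].
  exact: weighted_integrable bw.1 wK.
- have [K wK] := bw'.2 b; apply: (@integrableS _ _ _ mu `[- (L / 2), b]%classic); [exact: measurable_itv|exact: measurable_itv|exact: sub|].
  exact: weighted_integrable bw'.1 wK.
by move=> y /=; rewrite in_itv /= => yab; rewrite ler_wpM2r // ww'.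
Qed.

Lemma bounded_weight_cst (k : R) : 0 <= k -> bounded_weight (cst k).
Proof. by move=> k0; split => // b; exists k => x _; rewrite /= k0 lexx. Qed.

Lemma bounded_weight_norm : bounded_weight (fun x : R => `|x|).
Proof.
split; first exact: normr_measurable.
move=> b; exists (`|b| + L / 2) => x /andP[x1 x2]; rewrite normr_ge0 /= ler_norml.
by have := ler_norm b; have := normr_ge0 b; have := L0; move=> *; apply/andP; split; lra.
Qed.

Lemma wmass_cst (k a b : R) : 0 <= k -> - (L / 2) <= a -> a <= b ->
  wmass (cst k) b - wmass (cst k) a = k * (wmass (cst 1) b - wmass (cst 1) a).
Proof.
move=> k0 La ab; rewrite !wmass_incr //; try exact: bounded_weight_cst.
rewrite -RintegralZl //; first by apply: eq_Rintegral => x _ /=; rewrite mul1r.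
have sub : `]a, b]%classic `<=` `[- (L / 2), b]%classic.
  by move=> x /=; rewrite !in_itv /= => /andP[? ->]; rewrite andbT; lra.
apply: (@integrableS _ _ _ mu `[- (L / 2), b]%classic); [exact: measurable_itv|exact: measurable_itv|exact: sub|].
by apply: (@weighted_integrable _ 1) => // x _ /=; rewrite ler01 lexx.
Qed.

Lemma wmass_lip (a b : R) : - (L / 2) <= a -> a <= b ->
  0 <= wmass (cst 1) b - wmass (cst 1) a <= M * (b - a).
Proof.
move=> La ab; rewrite wmass_incr //; last exact: bounded_weight_cst.
apply/andP; split; first by apply: Rintegral_ge0 => x _; rewrite mulr_ge0.
have sub : `]a, b]%classic `<=` `[- (L / 2), b]%classic.
  by move=> x /=; rewrite !in_itv /= => /andP[? ->]; rewrite andbT; lra.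
have fi : mu.-integrable `]a, b] (EFin \o (fun x => (cst 1 x) * f x)).
  apply: (@integrableS _ _ _ mu `[- (L / 2), b]%classic); [exact: measurable_itv|exact: measurable_itv|exact: sub|].
  by apply: (@weighted_integrable _ 1) => // x _ /=; rewrite ler01 lexx.
rewrite -lee_fin /Rintegral fineK; last exact: integrable_fin_num.
apply: (@le_trans _ _ (\int[mu]_(x in `]a, b]) M%:E)%E); last first.
  rewrite integral_cst //= lebesgue_measure_itv /= lte_fin.
  by case: ifP => h; rewrite ?mule0 -?EFinB -?EFinM lee_fin // mulr_ge0 ?(ltW M0) //; lra.
apply: ae_ge0_le_integral => //.
- by move=> x _; rewrite lee_fin mulr_ge0.
- by apply/measurable_EFinP; apply: measurable_funTS; exact: measurable_funM.
- by move=> x _; rewrite lee_fin ltW.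
case: fM => Z [mZ Z0 hZ]; exists Z; split => // x /= nx; apply: hZ => /= fx; apply: nx => _.
by rewrite mul1r lee_fin.
Qed.

Let F := wmass (cst 1).

Lemma wmass_nd (a b : R) : - (L / 2) <= a -> a <= b -> F a <= F b.
Proof. by move=> La ab; rewrite -subr_ge0; have /andP[] := wmass_lip La ab. Qed.

Lemma wmass_left (w : R -> R) : wmass w (- (L / 2)) = 0.
Proof. by rewrite /wmass set_itv1 Rintegral_set1. Qed.

Lemma sint_wmass (a x : R) : - (L / 2) <= a -> a <= x -> sint f a x = F x - F a.
Proof.
move=> La ax; rewrite /sint ax /F wmass_incr //; last exact: bounded_weight_cst.
have fi : mu.-integrable `[a, x] (EFin \o f).
  rewrite (_ : f = (fun x => cst 1 x * f x)); last by apply/funext => y /=; rewrite mul1r.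
  by apply: (@weighted_integrable _ 1) => // y _ /=; rewrite ler01 lexx.
rewrite -(Rintegral_itv_obnd_cbnd (b := BRight x)); last first.
  apply: integrableS fi => //.
  by move=> z /=; rewrite !in_itv /= => /andP[/ltW -> ->].
by apply: eq_Rintegral => y _ /=; rewrite mul1r.
Qed.

(** The distribution function [F] is Lipschitz with constant [M], so it has no atoms and the
    supremum is reached with mass exactly [e] beyond [a]. *)
Lemma sup_step (a e c : R) : - (L / 2) <= a -> a <= L / 2 -> 0 < e -> F (L / 2) = c ->
  F a + e <= c ->
  let s := sup [set x | sint f a x < e] in
  [/\ a <= s, s <= L / 2 & F s = F a + e].
Proof.
move=> La aL e0 Fc hae; set S := [set x | _]; move=> s.
have Sa : S a by rewrite /S /= sint_wmass // subrr.
have Sub : ubound S (L / 2).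
  move=> x /= Sx; rewrite leNgt; apply/negP => Lx.
  move: Sx; rewrite /S /= sint_wmass //; last exact: le_trans (ltW Lx).
  have hL : - (L / 2) <= L / 2 by apply: le_trans aL.
  by have := wmass_nd hL (ltW Lx); rewrite -/F Fc; lra.
have hs : has_sup S by split; [exists a|exists (L / 2)].
have as_ : a <= s by apply: ub_le_sup => //; exists (L / 2).
have sL : s <= L / 2 by apply: ge_sup => //; exists a.
split => //; apply/eqP; rewrite eq_le; apply/andP; split.
  apply/ler_addgt0Pr => d d0.
  have [x Sx xs] := @sup_adherent _ S (d / M) (divr_gt0 d0 M0) hs.
  rewrite -/s in xs.
  have xs' : x <= s by apply: ub_le_sup => //; exists (L / 2).
  have [ax|ax] := leP a x.
    rewrite /S /= sint_wmass // in Sx.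
    have /andP[_] := wmass_lip (le_trans La ax) xs'; rewrite -/F => h.
    have : M * (s - x) <= d by rewrite mulrC -ler_pdivlMr //; lra.
    lra.
  (* The set also contains points left of [a]; if the chosen one is such a point, [s] is within
     [d / M] of [a] itself. *)
  have /andP[_] := wmass_lip La as_; rewrite -/F => h.
  have : M * (s - a) <= d by rewrite mulrC -ler_pdivlMr //; lra.
  lra.
rewrite leNgt; apply/negP => hlt.
(* Half the length over which a density bounded by [M] could fill the missing mass: after this step
   the point would still belong to the set. *)
pose d := (F a + e - F s) / M / 2.
have d0 : 0 < d by rewrite /d !divr_gt0 // subr_gt0.
have : s + d <= s.
  apply: ub_le_sup; first by exists (L / 2).
  rewrite /S /= sint_wmass //; last by lra.
  have Ls : - (L / 2) <= s by lra.
  have sd : s <= s + d by lra.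
  have /andP[_] := wmass_lip Ls sd; rewrite -/F => h.
  have : M * (s + d - s) = (F a + e - F s) / 2 by rewrite /d; field; rewrite gt_eqF.
  by lra.
lra.
Qed.

Lemma init_pos_mass (N k : nat) (c : R) : (0 < N)%N -> 0 < c -> F (L / 2) = c -> (k <= N)%N ->
  let X := init_pos f L c N in
  [/\ - (L / 2) <= X k, X k <= L / 2 & F (X k) = k%:R * (c / N%:R)].
Proof.
move=> N0 c0 Fc + X; have N0R : 0 < N%:R :> R by rewrite ltr0n.
have L0' := L0.
elim: k => [|k ih] kN.
  by rewrite /X /= /F wmass_left mul0r; split => //; lra.
have [h1 h2 h3] := ih (ltnW kN).
have e0 : 0 < c / N%:R by rewrite divr_gt0.
have hc : F (X k) + c / N%:R <= c.
  rewrite h3 -[X in _ + X]mul1r -mulrDl natr1.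
  rewrite -[leRHS](@divfK _ N%:R) ?gt_eqF // mulrC; apply: ler_wpM2l; first exact: ltW.
  by rewrite ler_nat.
have [s1 s2 s3] := sup_step h1 h2 e0 Fc hc.
rewrite /X /= -/X; split => //; first exact: le_trans s1.
by rewrite s3 h3 -natr1; ring.
Qed.

Lemma init_pos_len (N k : nat) (c : R) : (0 < N)%N -> 0 < c -> F (L / 2) = c -> (k < N)%N ->
  init_pos f L c N k <= init_pos f L c N k.+1 ->
  c / N%:R <= M * (init_pos f L c N k.+1 - init_pos f L c N k).
Proof.
move=> N0 c0 Fc kN XX.
have [h1 h2 h3] := init_pos_mass N0 c0 Fc (ltnW kN).
have [h4 h5 h6] := init_pos_mass N0 c0 Fc kN.
have e : k.+1%:R * (c / N%:R) = k%:R * (c / N%:R) + c / N%:R by rewrite -natr1 mulrDl mul1r.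
have /andP[_] := wmass_lip h1 XX; rewrite -/F h3 h6 e; lra.
Qed.

Lemma init_pos_incr (N k : nat) (c : R) : (0 < N)%N -> 0 < c -> F (L / 2) = c -> (k < N)%N ->
  init_pos f L c N k <= init_pos f L c N k.+1.
Proof.
move=> N0 c0 Fc kN; set X := init_pos f L c N.
have [h1 h2 h3] := init_pos_mass N0 c0 Fc (ltnW kN).
have [h4 h5 h6] := init_pos_mass N0 c0 Fc kN.
rewrite leNgt; apply/negP => /ltW h; have := wmass_nd h4 h.
rewrite h3 h6 -natr1 -/F; have : 0 < c / N%:R by rewrite divr_gt0 ?ltr0n.
lra.
Qed.

(* The mass of a cell is bounded below by its neighbour farther from the origin, so the
   discrete moment is at most twice the continuous one, up to the leftmost cell. *)
Lemma init_pos_moment (N : nat) (c : R) : (0 < N)%N -> 0 < c -> F (L / 2) = c ->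
  c / N%:R * \sum_(k < N) `|init_pos f L c N k| <=
    2 * wmass (fun x => `|x|) (L / 2) + c / N%:R * (L / 2).
Proof.
move=> N0 c0 Fc; set X := init_pos f L c N; set G := wmass (fun x => `|x|).
have e0 : 0 < c / N%:R by rewrite divr_gt0 ?ltr0n.
have Xin (k : nat) : (k <= N)%N -> - (L / 2) <= X k /\ X k <= L / 2.
  by move=> kN; have [] := init_pos_mass N0 c0 Fc kN.
have Xmass (k : nat) : (k < N)%N -> F (X k.+1) - F (X k) = c / N%:R.
  move=> kN; have [_ _ ->] := init_pos_mass N0 c0 Fc kN.
  by have [_ _ ->] := init_pos_mass N0 c0 Fc (ltnW kN); rewrite -natr1; ring.
have Gw (w : R) (k : nat) : (k < N)%N -> 0 <= w -> (forall y, X k < y <= X k.+1 -> w <= `|y|) ->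
    c / N%:R * w <= G (X k.+1) - G (X k).
  move=> kN w0 hw; have [Xk _] := Xin k (ltnW kN).
  have XX := init_pos_incr N0 c0 Fc kN.
  rewrite -(Xmass k kN) mulrC -wmass_cst //.
  apply: wmass_le => //; [exact: bounded_weight_cst|exact: bounded_weight_norm].
have G0 (k : nat) : (k < N)%N -> 0 <= G (X k.+1) - G (X k).
  by move=> kN; have := @Gw 0 k kN (lexx _); rewrite mulr0; apply => y _.
pose Gm (k : nat) := if k is k'.+1 then G (X k) - G (X k') else c / N%:R * (L / 2).
have key (k : 'I_N) : c / N%:R * `|X k| <= (G (X k.+1) - G (X k)) + Gm k.
  have [X1 X2] := Xin k (ltnW (ltn_ord k)).
  have Gm0 : 0 <= Gm k.
    case: k X1 X2 => [[|k] kN] _ _ /=; last by apply: G0; exact: ltnW.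
    by rewrite mulr_ge0 ?divr_ge0 ?(ltW L0) ?(ltW c0).
  case: (leP 0 (X k)) => Xk.
    rewrite -[leLHS]addr0; apply: lerD => //; apply: Gw => // y /andP[y1 _].
    by rewrite ger0_norm // (le_trans (ltW y1)) // ler_norm.
  rewrite -[leLHS]add0r; apply: lerD; first exact: G0.
  rewrite ltr0_norm //; case: k X1 X2 Xk Gm0 => [[|k] kN] /= X1 X2 Xk Gm0.
    by rewrite /Gm; apply: ler_wpM2l; [exact: ltW|lra].
  apply: Gw; [exact: ltnW|lra|move=> y /andP[_ y2]].
  by rewrite ler0_norm; lra.
rewrite mulr_sumr; apply: le_trans (ler_sum _ (fun k _ => key k)) _.
rewrite big_split /=.
have GL : G (X N) <= G (L / 2).
  rewrite -subr_ge0; have [x1 x2] := Xin N (leqnn _).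
  rewrite /G wmass_incr //; last exact: bounded_weight_norm.
  by apply: Rintegral_ge0 => x _; rewrite mulr_ge0.
have GX0 : G (X 0%N) = 0 by rewrite /X /= /G wmass_left.
have s1 : \sum_(k < N) (G (X k.+1) - G (X k)) = G (X N).
  rewrite -(big_mkord predT (fun k => G (X k.+1) - G (X k))).
  by rewrite (telescope_sumr (fun k => G (X k))) // GX0 subr0.
have s2 : \sum_(k < N) Gm k <= G (X N) + c / N%:R * (L / 2).
  have s3 n : \sum_(k < n.+1) Gm k = c / N%:R * (L / 2) + G (X n).
    elim: n => [|n ih]; first by rewrite big_ord_recl big_ord0 GX0.
    by rewrite big_ord_recr /= ih; ring.
  have Np : N.-1.+1 = N by rewrite prednK.
  rewrite -[in leLHS]Np s3 addrC lerD2r -subr_ge0.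
  by have := G0 N.-1; rewrite Np; apply.
by rewrite s1; lra.
Qed.

End equal_mass_points.

(** * Translations and periodic extension *)

Section translation.
Context {R : realType}.
Local Notation mu := (@lebesgue_measure R).

Lemma measurable_shift (s : R) : measurable_fun setT (fun x : R => x + s).
Proof. exact: measurable_funD. Qed.

Lemma lebesgue_measure_shift (s : R) (A : set R) : measurable A ->
  pushforward mu ((fun x => x + s) : _ -> measurableTypeR R) A = mu A.
Proof.
move=> mA; apply/esym/lebesgue_measure_unique => //=; first exact: measurable_shift.
move=> ms _ [[a b]] _ <-.
rewrite /pushforward (_ : _ @^-1` _ = `]a - s, b - s]%classic).
  by rewrite !lebesgue_measure_itv /= !lte_fin ltrD2r -!EFinB; case: ifP => // _; congr EFin; ring.
by apply/seteqP; split => x /=; rewrite !in_itv /= => /andP[? ?]; apply/andP; split; lra.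
Qed.

Lemma negligible_shift (s : R) (A : set R) : mu.-negligible A ->
  mu.-negligible ((fun x => x + s) @^-1` A).
Proof.
move=> [Z [mZ Z0 AZ]]; exists ((fun x => x + s) @^-1` Z); split.
- by rewrite -[X in measurable X]setTI; exact: measurable_shift.
- by have := lebesgue_measure_shift s mZ; rewrite /pushforward Z0.
- by move=> x /= /AZ.
Qed.

Lemma countable_int : countable [set: int].
Proof. exact: countableP. Qed.

Lemma negligible_bigcup_int (F : int -> set R) : (forall m, mu.-negligible (F m)) ->
  mu.-negligible (\bigcup_m F m).
Proof.
move=> hF; pose G n := if unpickle n is Some m then F m else set0.
apply: (@negligibleS _ _ _ mu (\bigcup_n G n)).
  by move=> x [m _ Fx]; exists (pickle m) => //; rewrite /G pickleK.
apply: negligible_bigcup => n; rewrite /G; case: unpickle => // .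
exact: negligible_set0.
Qed.

Variable L : R.
Hypothesis L0 : 0 < L.

Lemma measurable_perext (f : R -> R) : measurable_fun setT f -> measurable_fun setT (perext L f).
Proof.
have L0' := L0.
move=> mf _ Y mY; rewrite setTI.
rewrite (_ : _ @^-1` _ = \bigcup_(m : int)
   (`[m%:~R * L - L / 2, m%:~R * L + L / 2[%classic `&` (fun x => f (x + - (m%:~R * L))) @^-1` Y)).
  apply: countable_bigcupT_measurable; first exact: countable_int.
  move=> m; apply: measurableI => //.
  rewrite -[X in measurable X]setTI.
  apply: (measurableT_comp mf (measurable_shift _)) => //.
apply/seteqP; split => x /=.
  rewrite /perext => xY; have [m mE] := trep_ex L x.
  have /andP[h1 h2] := trep_itv x L0.
  exists (- m) => //=; rewrite intrN mulNr opprK -mE; split => //.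
  by rewrite in_itv /=; apply/andP; split; lra.
move=> [m _ /= [+ xY]]; rewrite in_itv /= => /andP[h1 h2].
rewrite /perext (@trep_uniq _ L x (x - m%:~R * L) (- m)) //; try lra.
Qed.

(** The exceptional set of the extension is covered by the translates, by multiples of [L], of that
    of [f]: countably many null sets. *)
Lemma perext_ae_le (f : R -> R) (M : R) : {ae mu, forall x, f x <= M} ->
  {ae mu, forall x, perext L f x <= M}.
Proof.
move=> fM; pose Z := [set x | ~ (f x <= M)].
have Zn : mu.-negligible Z by [].
apply: (@negligibleS _ _ _ mu (\bigcup_(m : int) ((fun x => x + m%:~R * L) @^-1` Z))).
  move=> x /= nx; have [m mE] := trep_ex L x; exists m => //=.
  by rewrite /Z /= -mE.
by apply: negligible_bigcup_int => m; exact: negligible_shift.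
Qed.

Lemma perext_id (f : R -> R) (x : R) : - (L / 2) <= x -> x < L / 2 -> perext L f x = f x.
Proof. by move=> h1 h2; rewrite /perext trep_id. Qed.

End translation.

(** * Mass and moment of the periodized datum *)

Section initial_configuration.
Context {R : realType}.
Local Notation mu := (@lebesgue_measure R).
Variables (f : R -> R) (L M : R).
Hypothesis L0 : 0 < L.
Hypothesis M0 : 0 < M.
Hypothesis fm : measurable_fun setT f.
Hypothesis f0 : forall x, 0 <= f x.
Hypothesis fM : {ae mu, forall x, f x <= M}.

(** The extension agrees with [f] on the half-open period; the endpoint [L / 2] does not affect the
    integral. *)
Lemma wmass_perext (w : R -> R) : bounded_weight L w ->
  wmass (perext L f) L w (L / 2) = \int[mu]_(x in `[- (L / 2), L / 2]) (w x * f x).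
Proof.
move=> [wm wb]; have [K wK] := wb (L / 2).
have pm := measurable_perext L0 fm; have pM := perext_ae_le L fM.
have p0 x : 0 <= perext L f x by exact: f0.
have sub : `[- (L / 2), L / 2[%classic `<=` `[- (L / 2), L / 2]%classic.
  by move=> x /=; rewrite !in_itv /= => /andP[-> /ltW ->].
rewrite /wmass -!Rintegral_itv_bndo_bndc.
- apply: eq_Rintegral => x; rewrite inE /= in_itv /= => /andP[x1 x2].
  by rewrite perext_id.
- apply: (@integrableS _ _ _ mu `[- (L / 2), L / 2]%classic) => //.
  exact: (weighted_integrable M0 fm f0 fM wm wK).
- apply: (@integrableS _ _ _ mu `[- (L / 2), L / 2]%classic) => //.
  exact: (weighted_integrable M0 pm p0 pM wm wK).
Qed.

Lemma massL_wmass : wmass (perext L f) L (cst 1) (L / 2) = massL f L.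
Proof.
rewrite wmass_perext; last exact: bounded_weight_cst.
by rewrite /massL; apply: eq_Rintegral => x _; rewrite mul1r.
Qed.

Hypothesis f1 : (\int[mu]_x (f x)%:E = 1)%E.
Variable m1 : R.
Hypothesis fmom : (\int[mu]_x (`|x| * f x)%:E <= m1%:E)%E.

Lemma massL_le1 : massL f L <= 1.
Proof.
have fi : mu.-integrable `[- (L / 2), L / 2] (EFin \o f).
  rewrite (_ : f = (fun x => cst 1 x * f x)); last by apply/funext => y /=; rewrite mul1r.
  by apply: (@weighted_integrable _ f M M0 fm f0 fM (cst 1) 1) => // y _ /=; rewrite ler01 lexx.
rewrite /massL -lee_fin /Rintegral fineK; last exact: integrable_fin_num.
rewrite -f1; apply: ge0_subset_integral => //.
- exact/measurable_EFinP.
- by move=> x _; rewrite lee_fin.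
Qed.

Lemma moment_wmass : wmass (perext L f) L (fun x => `|x|) (L / 2) <= m1.
Proof.
rewrite wmass_perext; last exact: bounded_weight_norm.
have [_ /(_ (L / 2))[K wK]] := bounded_weight_norm L0.
have fi : mu.-integrable `[- (L / 2), L / 2] (EFin \o (fun x => `|x| * f x)).
  exact: (weighted_integrable M0 fm f0 fM _ wK).
rewrite -lee_fin /Rintegral fineK; last exact: integrable_fin_num.
apply: le_trans fmom; apply: ge0_subset_integral => //.
- by apply/measurable_EFinP; exact: measurable_funM.
- by move=> x _; rewrite lee_fin mulr_ge0.
Qed.

(* Markov's inequality. *)
Lemma massL_gt0 : 2 * m1 < L -> 0 < massL f L.
Proof.
move=> mL; have L0' := L0.
have fi : mu.-integrable `[- (L / 2), L / 2] (EFin \o f).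
  rewrite (_ : f = (fun x => cst 1 x * f x)); last by apply/funext => y /=; rewrite mul1r.
  by apply: (@weighted_integrable _ f M M0 fm f0 fM (cst 1) 1) => // y _ /=; rewrite ler01 lexx.
have h : (1 <= (massL f L)%:E + (2 / L)%:E * m1%:E)%E.
  rewrite /massL /Rintegral fineK; last exact: integrable_fin_num.
  rewrite -f1 integral_mkcond.
  have q0 x : (0 <= (2 / L)%:E * (`|x| * f x)%:E)%E.
    by rewrite -EFinM lee_fin mulr_ge0 ?divr_ge0 ?(ltW L0') // mulr_ge0.
  set D := [set` _]; have mD : measurable D by exact: measurable_itv.
  pose g := (EFin \o f) \_ D.
  apply: (@le_trans _ _ (\int[mu]_x (g x + (2 / L)%:E * (`|x| * f x)%:E))%E).
    apply: ge0_le_integral => //.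
    - by move=> x _; rewrite lee_fin.
    - exact/measurable_EFinP.
    - apply: emeasurable_funD.
        apply/(measurable_restrictT _ _).1 => //.
        by apply: measurable_funTS; exact/measurable_EFinP.
      apply: emeasurable_funM => //.
      by apply/measurable_EFinP; exact: measurable_funM.
    - move=> x _; rewrite /g patchE; case: ifPn => hx.
        by rewrite leeDl.
      rewrite (_ : point = 0%E) // add0e -EFinM lee_fin mulrA ler_peMl //.
      rewrite mulrAC ler_pdivlMr // mul1r.
      move: hx; rewrite notin_setE /D /= in_itv /= => /negP; rewrite negb_and -!ltNge => /orP[hx|hx].
        by rewrite ler0_norm; lra.
      by have := ler_norm x; lra.
  rewrite ge0_integralD //.
  - apply: leeD => //; rewrite ge0_integralZl_EFin //.
    + by apply: lee_wpmul2l => //; rewrite lee_fin divr_ge0 // ltW.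
    + by move=> x _; rewrite lee_fin mulr_ge0.
    + by apply/measurable_EFinP; exact: measurable_funM.
    + by rewrite divr_ge0 // ltW.
  - by move=> x _; rewrite /g patchE; case: ifP => // _; rewrite lee_fin.
  - apply/(measurable_restrictT _ _).1 => //.
    by apply: measurable_funTS; exact/measurable_EFinP.
  - apply: emeasurable_funM => //.
    by apply/measurable_EFinP; exact: measurable_funM.
move: h; rewrite -EFinM -EFinD lee_fin => h.
have : 2 / L * m1 < 1 by rewrite mulrAC ltr_pdivrMr // mul1r.
lra.
Qed.

End initial_configuration.

(** * Uniformly controlled systems *)

(** Compactness uses particle systems through these bounds only, with [Mx] and [C] independent of
    [N], [L] and the datum. [ctl_disp] is a modulus of continuity in time: for a given tolerance [d]
    is chosen first, then [t - s]. The term [L / N] in [ctl_moment] is due to the leftmost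
    particle. *)
Record controlled {R : realType} (T Mx C : R) (phi : R -> R) (N : nat) (L c : R)
    (p : nat -> R -> R) : Prop := Controlled {
  ctl_N : (0 < N)%N;
  ctl_L : 1 <= L;
  ctl_c0 : 0 < c;
  ctl_c1 : c <= 1;
  ctl_per : forall t k, p (k + N)%N t = p k t + L;
  ctl_lt : forall t : R, 0 <= t <= T -> forall k, p k t < p k.+1 t;
  ctl_cont : forall k, {within `[0, T], continuous (p k)};
  ctl_dens : forall t : R, 0 <= t <= T -> forall k, cdens N c (p ^~ t) k <= Mx;
  ctl_disp : forall d s t : R, 0 < d -> 0 <= s -> s <= t -> t <= T ->
    c / N%:R * \sum_(k < N) `|p k t - p k s| <= (C + d^-1 + d * C) * (t - s) + d * C;
  ctl_jumpc : {within `[0, T], continuous (fun t => \sum_(k < N) `|cjump N c (p ^~ t) phi k|)};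
  ctl_jump : (\int[lebesgue_measure]_(t in `[0%R, T])
    (\sum_(k < N) `|cjump N c (p ^~ t) phi k|)%:E <= C%:E)%E;
  ctl_moment : c / N%:R * \sum_(k < N) `|p k 0| <= C + L / N%:R
}.

(** * Pressure and entropy density *)

Section pressure.
Context {R : realType}.
Variables (W : R -> R) (c0 c1 c2 rhat rbar : R).
Hypothesis WA : W_assumptions W c0 c1 c2 rhat rbar.
Local Notation phi := (phiW W).

Lemma W_ge0 (r : R) : 0 <= r -> 0 <= W r.
Proof. by have [h _] := WA; exact: h. Qed.

Lemma W_derivable (r : R) : 0 < r -> derivable W r 1.
Proof. by have [_ [h _]] := WA; exact: h. Qed.

Lemma phi_incr (x y : R) : 0 <= x -> x < y -> phi x < phi y.
Proof. by have [_ [_ [_ [_ [_ [_ [_ [h _]]]]]]]] := WA; exact: h. Qed.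

Lemma phi_nondecr (x y : R) : 0 <= x -> x <= y -> phi x <= phi y.
Proof. by move=> x0; rewrite le_eqVlt => /predU1P[->//|xy]; exact/ltW/phi_incr. Qed.

Lemma phi_0 : phi 0 = 0.
Proof. by have [_ [_ [_ [_ [_ [_ [h _]]]]]]] := WA. Qed.

Lemma phi_ge0 (r : R) : 0 <= r -> 0 <= phi r.
Proof. by move=> r0; rewrite -phi_0; exact: phi_nondecr. Qed.

Lemma phi_continuous (r : R) : 0 < r -> {for r, continuous phi}.
Proof.
have [_ [_ [_ [h _]]]] := WA; move=> r0; apply: differentiable_continuous.
by apply/derivable1_diffP; exact: h.
Qed.

Lemma phi_within (M : R) : {within `[0, M], continuous phi}.
Proof.
have [_ [_ [h _]]] := WA; apply: continuous_subspaceW h.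
by move=> x /=; rewrite !in_itv /= => /andP[-> _].
Qed.

Lemma phi_linear : 0 < c2 /\ 0 < rbar /\ forall r, rbar <= r -> c2 * r <= phi r.
Proof.
have [_ [_ [_ [_ [_ [_ [_ [_ [_ [_ [_ [_ [h1 [_ [_ [h2 [_ h3]]]]]]]]]]]]]]]]] := WA.
by split => //; split => //; exact: lt_trans h2.
Qed.

(** By strict monotonicity and compactness, the least increment [e] of [phi] over a length [d] is
    positive. Points farther apart than [d] have pressures at least [e] apart, while their distance
    is at most [M]; so [M / e] serves as constant. *)
Lemma phi_modulus (M d : R) : 0 <= M -> 0 < d -> exists2 C, 0 <= C &
  forall a b : R, 0 <= a <= M -> 0 <= b <= M -> `|a - b| <= d + C * `|phi a - phi b|.
Proof.
move=> M0 d0.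
have gc : {within `[0, M], continuous (fun a => phi (a + d) - phi a)}.
  apply: con_sub; last exact: phi_within.
  apply: (@con_comp _ _ (fun a => a + d)); last first.
    by move=> a /=; rewrite in_itv /= => /andP[a0 _]; apply: phi_continuous; lra.
  apply: con_add; last exact: con_cst.
  by apply/subspace_continuousP => x _; exact: cvg_within.
have [a0 a0M hmin] := EVT_min M0 gc.
set e := phi (a0 + d) - phi a0 in hmin.
have e0 : 0 < e.
  by rewrite subr_gt0; apply: phi_incr; move: a0M; rewrite in_itv /= => /andP[? _]; lra.
exists (M / e) => [|a b]; first by rewrite divr_ge0 // ltW.
wlog ab : a b / a <= b.
  move=> hw ha hb; case: (leP a b) => ab; first exact: hw.
  by rewrite distrC [X in _ * X]distrC; apply: hw => //; exact: ltW.
move=> /andP[a1 a2] /andP[b1 b2].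
rewrite distrC (ger0_norm (_ : 0 <= b - a)) ?subr_ge0 //.
have pab : phi a <= phi b by apply: phi_nondecr.
rewrite distrC (ger0_norm (_ : 0 <= phi b - phi a)) ?subr_ge0 //.
case: (leP (b - a) d) => hd.
  by apply: (le_trans hd); rewrite lerDl mulr_ge0 ?divr_ge0 ?(ltW e0) // subr_ge0.
have h1 : e <= phi b - phi a.
  have := hmin a; rewrite in_itv /= a1 a2 => /(_ isT) h.
  have h2 : phi (a + d) <= phi b by apply: phi_nondecr; lra.
  by lra.
have h3 : M <= M / e * (phi b - phi a).
  by rewrite -mulrA ler_peMr // mulrC ler_pdivlMr // mul1r.
lra.
Qed.

(** [W s / s] is nondecreasing because its derivative is [phi s / s ^ 2]. Hence the initial entropy
    is at most the mass times [W M / M], whatever [N] and [L]. *)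
Lemma W_ratio (r M : R) : 0 < r -> r <= M -> W r <= r * (W M / M).
Proof.
move=> r0 rM; have M0 : 0 < M by lra.
pose f s := - (W s * s^-1); pose df s := - (phi s / s ^+ 2).
have fd (s : R) : 0 < s -> is_derive s 1 f (df s).
  move=> s0; have Ws := derivableP (W_derivable s0).
  have V := is_deriveV (lt0r_neq0 s0) (is_derive_id s (1 : R)).
  have := is_deriveN (is_derive_mulf Ws V) => h.
  apply: is_derive_eq; rewrite /df /phiW derive1E scaler1; field.
  by rewrite gt_eqF.
have := @derive_bound_incr _ f df r M 0 rM.
have cf : {within `[r, M], continuous f}.
  apply: derivable_within_continuous => s; rewrite in_itv /= => /andP[s1 _].
  by have [] := fd s (lt_le_trans r0 s1).
move=> /(_ cf) h.
have {}h : f M - f r <= 0 * (M - r).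
  apply: h => s /andP[s1 _]; have s0 : 0 < s by lra.
  split; first exact: fd.
  by rewrite /df oppr_le0 divr_ge0 ?phi_ge0 ?sqr_ge0 // ltW.
have : W r / r <= W M / M by rewrite /f mul0r in h; lra.
by rewrite ler_pdivrMr // mulrC.
Qed.

End pressure.

(** * The kernel derivative away from the origin *)

Section kernel_derivative.
Context {R : realType}.
Variable K : R -> R.
Hypothesis KA : kernel_assumptions K.

(** [0 < z * z'] keeps the segment between the two points off the origin, so the mean value theorem
    applies to [K'] there. *)
Lemma kernel_bounds : exists A B : R, [/\ 0 <= A, 0 <= B,
  forall z : R, z != 0 -> `|derive1 K z| <= A &
  forall z z' : R, 0 < z * z' -> `|derive1 K z - derive1 K z'| <= B * `|z - z'|].
Proof.
have [_ [_ [Kd [_ [[A KA1] [[B KB] _]]]]]] := KA.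
have one : (1 : R) != 0 by exact: oner_neq0.
have B0 : 0 <= B by apply: le_trans (KB 1 one).
exists A, B; split => //.
- by apply: le_trans (KA1 1 one).
- move=> z z'; wlog zz : z z' / z <= z'.
    move=> hw h; case: (leP z z') => zz; first exact: hw.
    by rewrite distrC [X in _ * X]distrC; apply: hw; [exact: ltW|rewrite mulrC].
  move=> h0.
  have nz s : z <= s -> s <= z' -> s != 0.
    move=> s1 s2; apply/eqP => s0; move: h0; rewrite ltNge; apply/negP/negPn.
    by apply: mulr_le0_ge0; lra.
  have D s : s \in `]z, z'[ -> is_derive s 1 (derive1 K) (derive1 (derive1 K) s).
    rewrite in_itv /= => /andP[s1 s2]; have [_ d2 _] := Kd s (nz s (ltW s1) (ltW s2)).
    by rewrite [X in is_derive _ _ _ X]derive1E; exact: derivableP.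
  have cK : {within `[z, z'], continuous (derive1 K)}.
    apply: derivable_within_continuous => s; rewrite in_itv /= => /andP[s1 s2].
    by have [_ d2 _] := Kd s (nz s s1 s2).
  have [s sz e] := MVT_segment zz D cK.
  move: sz; rewrite in_itv /= => /andP[s1 s2].
  by rewrite distrC e normrM [X in _ <= _ * X]distrC ler_wpM2r // KB // nz.
Qed.

End kernel_derivative.

(** * Particle solutions are uniformly controlled *)

Section solution.
Context {R : realType}.
Variables (K W : R -> R) (c0 c1 c2 rhat rbar : R).
Hypothesis KA : kernel_assumptions K.
Hypothesis WA : W_assumptions W c0 c1 c2 rhat rbar.
Local Notation phi := (phiW W).
Local Notation mu := (@lebesgue_measure R).

Lemma driftN (N : nat) (L c : R) (p : nat -> R) (k1 : R -> R) k : 0 < L ->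
  (forall k, p (k + N)%N = p k + L) -> drift N L c p k1 (k + N)%N = drift N L c p k1 k.
Proof.
move=> L0 pN; rewrite /drift modnDr; congr (_ * _); apply: eq_bigr => j _.
rewrite pN (_ : p k + L - p j = p k - p j + 1%:~R * L) ?trepD //.
by rewrite mul1r; ring.
Qed.

Section one_solution.
Variables (N : nat) (L T c : R) (x0 : nat -> R) (x : nat -> R -> R).
Hypothesis L0 : 0 < L.
Hypothesis T0 : 0 < T.
Hypothesis sol : particle_solution K W L T c N x0 x.
Let p k t := ppos L N x k t.

Lemma pposN t k : p (k + N)%N t = p k t + L.
Proof.
have [N0 _] := sol.
by rewrite /p /ppos modnDr divnDr ?dvdnn // divnn N0 addn1 -natr1; ring.
Qed.

Lemma ppos_small k t : (k < N)%N -> p k t = x k t.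
Proof. by move=> kN; rewrite /p /ppos modn_small // divn_small // mulr0 addr0. Qed.

Lemma ppos_lt (t : R) : 0 <= t <= T -> forall k, p k t < p k.+1 t.
Proof.
have [N0 [_ [_ [hlt _]]]] := sol; move=> /andP[t0 tT] k.
rewrite (conf_mod (pposN t) k).
have -> : p k.+1 t = p (k %% N)%N.+1 t + (k %/ N)%:R * L.
  by rewrite {1}(divn_eq k N) addnC -addSn (confM (pposN t)).
by rewrite ltrD2r; apply: hlt => //; rewrite ltn_mod.
Qed.

Lemma ppos_cont k : {within `[0, T], continuous (p k)}.
Proof.
have [N0 [_ [hc _]]] := sol.
by apply: con_add; [apply: hc; rewrite ltn_mod|exact: con_cst].
Qed.

Lemma ppos_derive (t : R) : 0 < t < T -> forall k,
  is_derive t 1 (p k) (vel W N c p (fun k t => drift N L c (p ^~ t) (derive1 K) k) k t).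
Proof.
have [N0 [_ [_ [_ hd]]]] := sol; move=> /andP[t0 tT] k.
have kN : (k %% N < N)%N by rewrite ltn_mod.
have [dx ex] := hd t t0 tT _ kN.
have := is_derive_addf (derivableP dx) (is_derive_cst (L * (k %/ N)%:R) t (1 : R)).
rewrite addr0 -derive1E ex => h.
suff -> : vel W N c p (fun k t => drift N L c (p ^~ t) (derive1 K) k) k t =
    pvel K W L N c x (k %% N)%N t by exact: h.
have pN := pposN t.
rewrite /vel /jump.
have -> : drift N L c (p ^~ t) (derive1 K) k = drift N L c (p ^~ t) (derive1 K) (k %% N)%N.
  rewrite {1}(divn_eq k N) addnC; elim: (k %/ N)%N => [|m ih]; first by rewrite addn0.
  by rewrite mulSn addnCA addnC (driftN c _ _ L0 pN).
have -> : cjump N c (p ^~ t) phi k = cjump N c (p ^~ t) phi (k %% N)%N.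
  rewrite {1}(divn_eq k N) addnC; elim: (k %/ N)%N => [|m ih]; first by rewrite addn0.
  by rewrite mulSn addnCA addnC (@cjumpN _ _ _ _ (p ^~ t) N0 L0 pN).
rewrite /pvel /drift modn_mod mulNr; congr (- (_ * _) - _ * _).
  by apply: eq_bigr => j _; rewrite !ppos_small.
by rewrite /cjump -(cdens_mod c pN (k %% N + N).-1).
Qed.

End one_solution.

Lemma particle_controlled (T M m1 : R) : 0 < T -> 0 < M -> exists Mx C : R,
  [/\ 0 < Mx, 0 <= C & forall (N : nat) (L : R) (f : R -> R) (x : nat -> R -> R),
    1 <= L -> 2 * m1 < L ->
    measurable_fun setT f -> (forall y, 0 <= f y) -> {ae mu, forall y, f y <= M} ->
    (\int[mu]_y (f y)%:E = 1)%E -> (\int[mu]_y (`|y| * f y)%:E <= m1%:E)%E ->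
    particle_solution K W L T (massL f L) N
      (init_pos (perext L f) L (massL f L) N) x ->
    controlled T Mx C phi N L (massL f L) (fun k t => ppos L N x k t)].
Proof.
move=> T0 M0; have [A [B [A0 B0 KA1 KB]]] := kernel_bounds KA.
have [c20 [rb0 plin]] := phi_linear WA.
have p1 : 0 <= phi 1 by apply: (phi_ge0 WA).
pose H0 := W M / M.
have H00 : 0 <= H0 by rewrite divr_ge0 ?(W_ge0 WA) ?ltW.
pose C3 := 8 * A / c2.
pose C4 := B + 4 * A * (rbar + (phi 1 + 1) / c2) + C3 * A ^+ 2 / 2 + 1.
pose Mx := M * expR (C3 * H0 + C4 * T).
(* [A] and [A ^ 2] serve the displacement rate, the next term bounds twice the entropy up to time
   [T], then come the integral of the jumps and the initial moment; the absolute value of [m1] makes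
   [C] nonnegative without a sign assumption. *)
pose C := A + A ^+ 2 + 2 * (H0 + A ^+ 2 / 2 * T) + (1 + A ^+ 2) * T + 2 * `|m1|.
have a2 : 0 <= A ^+ 2 by exact: sqr_ge0.
have a2T : 0 <= A ^+ 2 * T by rewrite mulr_ge0 // ltW.
have C0 : 0 <= C by have := normr_ge0 m1; rewrite /C; lra.
exists Mx, C; split => //; first by rewrite mulr_gt0 // expR_gt0.
move=> N L f x L1 Lm fm f0 fM f1 fmom; set c := massL f L => sol.
have L0 : 0 < L by exact: lt_le_trans L1.
have cp : 0 < c by exact: (massL_gt0 L0 M0 fm f0 fM f1 fmom).
have cl : c <= 1 by exact: (massL_le1 L M0 fm f0 fM f1).
have [N0 [x0 _]] := sol.
have N0R : 0 < N%:R :> R by rewrite ltr0n.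
pose p k t := ppos L N x k t.
pose b k t := drift N L c (p ^~ t) (derive1 K) k.
have pN : forall t k, p (k + N)%N t = p k t + L by exact: (pposN sol).
have plt : forall t : R, 0 <= t <= T -> forall k, p k t < p k.+1 t by exact: (ppos_lt sol).
have pc : forall k, {within `[0, T], continuous (p k)} by exact: (ppos_cont sol).
have pd : forall t : R, 0 < t < T -> forall k, is_derive t 1 (p k) (vel W N c p b k t).
  exact: (ppos_derive L0 sol).
have bN k t : b (k + N)%N t = b k t by exact: driftN.
have in_ (t : R) : 0 < t < T -> 0 <= t <= T.
  by move=> /andP[? ?]; apply/andP; split; exact: ltW.
have bA (t : R) : 0 < t < T -> forall k, `|b k t| <= A.
  move=> tT k; have h := drift_bound (p := p ^~ t) N0 L0 (ltW cp) (pN t) (plt t (in_ t tT)) KA1 A0 k.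
  apply: (le_trans h).
  by rewrite ler_piMl.
have bg (t : R) : 0 < t < T -> forall k, (forall l, p k.+1 t - p k t <= p l.+1 t - p l t) ->
    `|b k.+1 t - b k t| <= B * (p k.+1 t - p k t) + 4 * A * (c / N%:R).
  move=> tT k kmin.
  have h := drift_gap (p := p ^~ t) N0 L0 (ltW cp) (pN t) (plt t (in_ t tT)) KA1 KB B0 A0 kmin.
  apply: (le_trans h).
  rewrite lerD2r ler_wpM2r ?subr_ge0 ?(ltW (plt t (in_ t tT) k)) //.
  by rewrite ler_piMl.
have zT : 0 <= (0 : R) <= T by rewrite lexx ltW.
have pm := measurable_perext L0 fm; have pM := perext_ae_le L fM.
have pf0 y : 0 <= perext L f y by exact: f0.
have mE := massL_wmass L0 M0 fm f0 fM.
have p0x (k : nat) : (k < N)%N -> p k 0 = init_pos (perext L f) L c N k.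
  by move=> kN; rewrite /p ppos_small // x0.
have rho0M k : cdens N c (p ^~ 0) k <= M.
  rewrite -(@cdens_mod _ _ _ c (p ^~ 0) (pN 0)).
  have kN : (k %% N < N)%N by rewrite ltn_mod.
  move: (k %% N)%N kN => {}k kN.
  have h1 := init_pos_incr L0 M0 pm pf0 pM N0 cp mE kN.
  have h2 := init_pos_len L0 M0 pm pf0 pM N0 cp mE kN h1.
  (* Equality except in the last cell, which ends at [L / 2] although the [N]-th mass point may lie
     earlier if the datum vanishes near [L / 2]; this only lowers the density. *)
  have h3 : init_pos (perext L f) L c N k.+1 <= p k.+1 0.
    case: (ltnP k.+1 N) => kN'; first by rewrite p0x.
    have kE : k.+1 = N by apply/eqP; rewrite eqn_leq kN kN'.
    have [_ h4 _] := init_pos_mass L0 M0 pm pf0 pM N0 cp mE kN.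
    have e0 : p 0%N 0 = - (L / 2) by rewrite p0x.
    have -> : p k.+1 0 = p 0%N 0 + L by rewrite kE -pN add0n.
    by rewrite e0; apply: (le_trans h4); lra.
  rewrite /cdens invfM mulrA ler_pdivrMr ?subr_gt0 ?plt //.
  by apply: (le_trans h2); rewrite ler_pM2l // (p0x k kN) lerD2r.
have ent0 : entropy W N c p 0 <= H0.
  have h k : (p k.+1 0 - p k 0) * W (rho N c p k 0) <= c / N%:R * H0.
    have l0 : 0 < p k.+1 0 - p k 0 by rewrite subr_gt0 plt.
    have r0 := cdens_gt0 (p := p ^~ 0) N0 (plt 0 zT) k cp.
    have := W_ratio WA r0 (rho0M k) => h.
    apply: le_trans (ler_wpM2l (ltW l0) h) _.
    have e := cdens_len (p := p ^~ 0) c N0 (plt 0 zT) k.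
    rewrite -/H0 in h *; rewrite mulrCA [leLHS]mulrA e //.
  rewrite /entropy; apply: le_trans (ler_sum _ (fun (k : 'I_N) _ => h k)) _.
  rewrite sumr_const card_ord -[leLHS]mulr_natr.
  have -> : c / N%:R * H0 * N%:R = c * H0 by field; rewrite gt_eqF.
  by rewrite ler_piMl.
split => //.
- move=> t tT k.
  exact: (rho_bound (W_ge0 WA) (W_derivable WA) (phi_nondecr WA)
    p1 c20 rb0 plin N0 L1 T0 cp cl A0 B0 pN plt pc pd bN bA bg M0 rho0M ent0 tT).
- move=> d s t d0 s0 st tT.
  have h1 := displacement (W_ge0 WA) (W_derivable WA)
    N0 L1 cp cl A0 pN plt pc pd bN bA d0 s0 st tT.
  have h2 := entropy_growth (W_derivable WA)
    N0 L1 cp cl A0 pN plt pc pd bN bA (lexx 0) s0 (le_trans st tT).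
  apply: (le_trans h1); apply: lerD.
    apply: ler_wpM2r; first by rewrite subr_ge0.
    have m0 := normr_ge0 m1.
    have q1 : A <= C by rewrite /C; lra.
    have q2 : A ^+ 2 <= C by rewrite /C; lra.
    have := ler_wpM2l (ltW d0) q2; lra.
  rewrite mulrAC [leLHS]mulrC; apply: ler_wpM2l; first exact: ltW.
  have q3 : A ^+ 2 / 2 * (s - 0) <= A ^+ 2 / 2 * T.
    by apply: ler_wpM2l; [rewrite divr_ge0|lra].
  by have m0 := normr_ge0 m1; rewrite /C; lra.
- apply: con_sum => k; apply: con_norm.
  exact: (jump_cont (phi_continuous WA) N0 cp plt pc).
- apply: le_trans (integral_jump (W_ge0 WA) (W_derivable WA) (phi_continuous WA)
    N0 L1 T0 cp cl A0 pN plt pc pd bN bA) _.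
  by rewrite lee_fin; have m0 := normr_ge0 m1; rewrite /C; lra.
- have := init_pos_moment L0 M0 pm pf0 pM N0 cp mE.
  rewrite (eq_bigr (fun k : 'I_N => `|p k 0|)); last by move=> k _; rewrite p0x.
  move=> h; apply: (le_trans h); apply: lerD.
    have := moment_wmass L0 M0 fm f0 fM fmom; have := ler_norm m1; rewrite /C; lra.
  have : c * (L / 2) <= L by apply: le_trans (_ : L / 2 <= _); [rewrite ler_piMl //|]; lra.
  by rewrite mulrAC ler_pM2r // invr_gt0.
Qed.

End solution.

(** * Compactness *)

Section extraction.

Lemma infinite_pigeonhole (F : finType) (q : nat -> F) (A : nat -> Prop) :
  (forall n, exists2 m, (n <= m)%N & A m) ->
  exists c, forall n, exists2 m, (n <= m)%N & A m /\ q m = c.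
Proof.
move=> Ainf; apply: contrapT => hn.
have /choice[b hb] : forall c, exists n, forall m, (n <= m)%N -> A m -> q m <> c.
  move=> c; apply: contrapT => hc; apply: hn; exists c => n.
  apply: contrapT => hm; apply: hc; exists n => m nm Am qm; apply: hm.
  by exists m.
have [m mb Am] := Ainf (\max_(c : F) b c)%N.
by apply: (hb (q m) m _ Am) => //; apply: leq_trans mb; exact: leq_bigmax.
Qed.

Context {R : realType}.

(** A finite colouring of a tail of the sequence, with colour classes of diameter at most [e]; no
    centres are named, and [d] need not be a distance. *)
Definition totally_bounded_seq (d : nat -> nat -> \bar R) : Prop :=
  forall e : R, 0 < e -> exists (F : finType) (q : nat -> F) (n0 : nat),
    forall n m, (n0 <= n)%N -> (n0 <= m)%N -> q n = q m -> (d n m <= e%:E)%E.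

(** Infinite index sets [A k] of diameter at most [e k] are nested; with [psi k] in [A k], both
    [psi k] and [psi k.+1] lie in [A k]. *)
Lemma cauchy_extraction (d : nat -> nat -> \bar R) (e : nat -> R) :
  (forall k, 0 < e k) -> totally_bounded_seq d ->
  exists psi : nat -> nat, (forall n, (psi n < psi n.+1)%N) /\
    forall k, (d (psi k) (psi k.+1) <= (e k)%:E)%E.
Proof.
move=> e0 tb.
pose inf_set (A : nat -> Prop) := forall n, exists2 m, (n <= m)%N & A m.
pose small (k : nat) (A : nat -> Prop) := forall n m, A n -> A m -> (d n m <= (e k)%:E)%E.
(* Infinitude travels with the set in a sigma type, so that choice turns refinement into a total
   function that can be iterated. *)
have step (k : nat) (A : {A : nat -> Prop | inf_set A}) :
    exists B : {B : nat -> Prop | inf_set B},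
      (forall n, sval B n -> sval A n) /\ small k (sval B).
  have [F [q [n0 hq]]] := tb _ (e0 k).
  have [c hc] := infinite_pigeonhole q (svalP A).
  have Binf : inf_set (fun n => [/\ (n0 <= n)%N, sval A n & q n = c]).
    move=> n; have [m hm [Am qm]] := hc (maxn n n0).
    by exists m; [exact: leq_trans (leq_maxl _ _) hm|split => //; exact: leq_trans (leq_maxr _ _) hm].
  exists (exist _ _ Binf); split => [n /= []//|n m /= [h1 _ h2] [h3 _ h4]].
  by apply: hq => //; rewrite h2.
have /choice[stp hstp] : forall x : nat * {A : nat -> Prop | inf_set A}, exists B : {B | inf_set B},
    (forall n, sval B n -> sval x.2 n) /\ small x.1 (sval B).
  by move=> [k A]; exact: step.
have Tinf : inf_set (fun=> True) by move=> n; exists n.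
pose A := fix A k := stp (k, if k is k'.+1 then A k' else exist _ _ Tinf).
have Asub k n : sval (A k.+1) n -> sval (A k) n.
  by move=> h; have [h1 _] := hstp (k.+1, A k); exact: h1.
have Asmall k : small k (sval (A k)).
  by case: k => [|k]; [have [] := hstp (0%N, exist _ _ Tinf)|have [] := hstp (k.+1, A k)].
have /choice[nxt hnxt] : forall x : nat * nat, exists m, (x.2 < m)%N /\ sval (A x.1) m.
  by move=> [k n]; have [m nm Am] := svalP (A k) n.+1; exists m.
pose psi := fix psi k := nxt (k, if k is k'.+1 then psi k' else 0%N).
have psiA k : sval (A k) (psi k).
  by case: k => [|k]; [have [] := hnxt (0%N, 0%N)|have [] := hnxt (k.+1, psi k)].
exists psi; split => [n|k]; first by have [] := hnxt (n.+1, psi n).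
by apply: Asmall => //; apply: Asub.
Qed.

Lemma strict_mono_ge (psi : nat -> nat) : (forall n, (psi n < psi n.+1)%N) ->
  forall n, (n <= psi n)%N.
Proof. by move=> h; elim=> // n ih; exact: leq_ltn_trans (h n). Qed.

End extraction.

(** * Completeness for bounded space-time fields *)

Section l1_completeness.
Context {R : realType}.
Local Notation mu := (@lebesgue_measure R).
Variable T : R.

Definition jointly_measurable (f : R -> R -> R) : Prop :=
  measurable_fun [set: R * R] (fun z : R * R => f z.1 z.2).

Lemma absdiff_measurable (f g : R -> R -> R) : jointly_measurable f -> jointly_measurable g ->
  measurable_fun [set: R * R] (fun z : R * R => (`|f z.1 z.2 - g z.1 z.2|)%:E).
Proof.
move=> mf mg; apply/measurable_EFinP; apply: measurableT_comp => //.
exact: measurable_funB.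
Qed.

Lemma section_measurable (h : R * R -> \bar R) (t : R) : measurable_fun [set: R * R] h ->
  measurable_fun setT (fun y => h (t, y)).
Proof. by move=> mh; apply: measurableT_comp mh _; exact: pair1_measurable. Qed.

Lemma inner_measurable (h : R * R -> \bar R) : measurable_fun [set: R * R] h ->
  (forall z, (0 <= h z)%E) -> measurable_fun setT (fun t => \int[mu]_y h (t, y))%E.
Proof. by move=> mh h0; exact: (@measurable_fun_fubini_tonelli_F _ _ _ _ R mu h). Qed.

Lemma l1dist_ge0 (f g : R -> R -> R) : (0 <= l1dist T f g)%E.
Proof. by apply: integral_ge0 => t _; apply: integral_ge0 => y _; rewrite lee_fin. Qed.

Lemma l1dist_sym (f g : R -> R -> R) : l1dist T f g = l1dist T g f.
Proof.
by rewrite /l1dist; apply: eq_integral => t _; apply: eq_integral => y _; rewrite distrC.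
Qed.

Lemma l1dist_triangle (f g h : R -> R -> R) :
  jointly_measurable f -> jointly_measurable g -> jointly_measurable h ->
  (l1dist T f h <= l1dist T f g + l1dist T g h)%E.
Proof.
move=> mf mg mh.
have m1 := absdiff_measurable mf mg; have m2 := absdiff_measurable mg mh.
have m3 := absdiff_measurable mf mh.
rewrite /l1dist -ge0_integralD //; first last.
- by apply: measurable_funTS; exact: (inner_measurable m2).
- by move=> t _; apply: integral_ge0 => y _; rewrite lee_fin.
- by apply: measurable_funTS; exact: (inner_measurable m1).
- by move=> t _; apply: integral_ge0 => y _; rewrite lee_fin.
apply: ge0_le_integral => //.
- by move=> t _; apply: integral_ge0 => y _; rewrite lee_fin.
- by apply: measurable_funTS; exact: (inner_measurable m3).
- apply: measurable_funTS; apply: emeasurable_funD; [exact: (inner_measurable m1)|exact: (inner_measurable m2)].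
move=> t _; rewrite -ge0_integralD //.
- apply: ge0_le_integral => //.
  + by apply: (section_measurable _ m3).
  + apply: emeasurable_funD; [exact: (section_measurable _ m1)|exact: (section_measurable _ m2)].
  + by move=> y _; rewrite -EFinD lee_fin; exact: ler_distD.
- by apply: (section_measurable _ m1).
- by apply: (section_measurable _ m2).
Qed.

(* Completeness: the upper limit of a fast Cauchy sequence is within the tail of the
   telescoping series at every point, so no almost everywhere argument is needed. *)
Lemma limn_sup_dist (u : nat -> R) (M : R) (k : nat) : (forall n, 0 <= u n <= M) ->
  ((`|u k - limn_sup u|)%:E <= \sum_(i <oo) (`|u (k + i)%N - u (k + i).+1|)%:E)%E.
Proof.
move=> uM; set S := (\sum_(i <oo) _)%E.
have S0 : (0 <= S)%E by apply: nneseries_ge0.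
have part n : ((\sum_(i < n) `|u (k + i)%N - u (k + i).+1|)%:E <= S)%E.
  rewrite -sumEFin -(big_mkord predT (fun i => (`|u (k + i)%N - u (k + i).+1|)%:E)).
  exact: nneseries_lim_ge.
move: S0 part; case: S => [s _| _ _| //]; last by rewrite leey.
move=> part; rewrite lee_fin.
have dist n : (k <= n)%N -> `|u k - u n| <= s.
  move=> kn; rewrite -(subnKC kn); set j := (n - k)%N.
  have := part j; rewrite lee_fin; apply: le_trans.
  elim: j => [|j ih]; first by rewrite addn0 subrr normr0 big_ord0.
  rewrite big_ord_recr /= addnS; apply: le_trans (ler_distD (u (k + j)%N) _ _) _.
  by rewrite lerD2r.
have ubu : has_ubound (range u) by exists M => _ [n _ <-]; have /andP[] := uM n.
have lbu : has_lbound (range u) by exists 0 => _ [n _ <-]; have /andP[] := uM n.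
have cv : cvgn (sups u) by apply/cvg_ex; eexists; exact: cvg_sups_inf.
rewrite /limn_sup distrC ler_distlC lerBlDr -[u k <= _]lerBlDr; apply/andP; split.
  apply: limr_le => //; exists k => // n /= kn.
  apply: ge_sup; first by exists (u n); exists n => /=.
  move=> _ [m /= nm <-]; have := dist m (leq_trans kn nm); rewrite ler_norml => /andP[? ?]; lra.
apply: limr_ge => //; exists k => // n /= kn.
apply: (@le_trans _ _ (u n)); first by have := dist n kn; rewrite ler_norml => /andP[? ?]; lra.
by apply: ub_le_sup; [exact: has_ubound_sdrop|exists n => /=].
Qed.

Lemma limn_sup_itv (u : nat -> R) (M : R) : (forall n, 0 <= u n <= M) -> 0 <= limn_sup u <= M.
Proof.
move=> uM.
have ubu : has_ubound (range u) by exists M => _ [n _ <-]; have /andP[] := uM n.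
have lbu : has_lbound (range u) by exists 0 => _ [n _ <-]; have /andP[] := uM n.
have cv : cvgn (sups u) by apply/cvg_ex; eexists; exact: cvg_sups_inf.
apply/andP; split.
  apply: limr_ge => //; exists 0%N => // n _.
  apply: (@le_trans _ _ (u n)); first by have /andP[] := uM n.
  by apply: ub_le_sup; [exact: has_ubound_sdrop|exists n => /=].
apply: limr_le => //; exists 0%N => // n _.
apply: ge_sup; first by exists (u n); exists n => /=.
by move=> _ [m _ <-]; have /andP[] := uM m.
Qed.

(** The pointwise upper limit exists everywhere, is measurable and keeps the bounds. Integrating
    [limn_sup_dist] bounds the distance from [w k] by the geometric tail, which is [1 / 2 ^ k]. *)
Lemma l1_complete (w : nat -> R -> R -> R) (M : R) :
  (forall n, jointly_measurable (w n)) -> (forall n t y, 0 <= w n t y <= M) ->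
  (forall n, (l1dist T (w n) (w n.+1) <= (1 / (2 ^ n.+1)%:R)%:E)%E) ->
  exists rho : R -> R -> R, [/\ jointly_measurable rho, forall t y, 0 <= rho t y <= M &
    l1dist T (w n) rho @[n --> \oo] --> 0%E].
Proof.
move=> mw wM hw.
pose rho t y := limn_sup (fun n => w n t y).
have mrho : jointly_measurable rho.
  apply: (@measurable_fun_limn_sup _ _ _ setT (fun n (z : R * R) => w n z.1 z.2)) => //.
    by move=> z _; exists M => _ [n _ <-]; have /andP[] := wM n z.1 z.2.
  by move=> z _; exists 0 => _ [n _ <-]; have /andP[] := wM n z.1 z.2.
exists rho; split => // [t y|]; first exact: limn_sup_itv.
have bound k : (l1dist T (w k) rho <= (1 / (2 ^ k)%:R)%:E)%E.
  pose h i (z : R * R) := (`|w (k + i)%N z.1 z.2 - w (k + i).+1 z.1 z.2|)%:E.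
  have mh i : measurable_fun [set: R * R] (h i) by exact: absdiff_measurable.
  have h0 i z : (0 <= h i z)%E by rewrite lee_fin.
  apply: (@le_trans _ _ (\sum_(i <oo) l1dist T (w (k + i)%N) (w (k + i).+1))%E).
    rewrite /l1dist -integral_nneseries //; first last.
    - by move=> i t _; apply: integral_ge0 => y _; exact: (h0 i (t, y)).
    - by move=> i; apply: measurable_funTS; exact: (inner_measurable (mh i)).
    apply: ge0_le_integral => //.
    - by move=> t _; apply: integral_ge0 => y _; rewrite lee_fin.
    - by apply: measurable_funTS; exact: (inner_measurable (absdiff_measurable (mw k) mrho)).
    - apply: measurable_funTS; apply: ge0_emeasurable_sum.
        by move=> i t _ _; apply: integral_ge0 => y _; exact: (h0 i (t, y)).
      by move=> i _; exact: (inner_measurable (mh i)).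
    move=> t _; rewrite -integral_nneseries //; last first.
      by move=> i; exact: (section_measurable _ (mh i)).
    apply: ge0_le_integral => //.
    - by apply: (section_measurable _ (absdiff_measurable (mw k) mrho)).
    - apply: ge0_emeasurable_sum => // i _; exact: (section_measurable _ (mh i)).
    - move=> y _; exact: (@limn_sup_dist (fun n => w n t y) M).
  apply: le_trans (_ : \sum_(i <oo) ((1 / (2 ^ k)%:R) / (2 ^ i.+1)%:R)%:E <= _)%E.
    apply: lee_nneseries => [i _ _|i _]; first exact: l1dist_ge0.
    apply: le_trans (hw _) _; rewrite lee_fin -addnS expnD natrM invfM; lra.
  by apply: epsilon_trick0; rewrite divr_ge0.
apply: (@squeeze_cvge _ _ _ _ (cst 0%E) _ (fun n => (1 / (2 ^ n)%:R)%:E)).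
- by near=> n; rewrite bound andbT l1dist_ge0.
- exact: cvg_cst.
- apply: cvg_EFin; first by near=> n.
  rewrite (_ : _ \o _ = GRing.exp (2^-1 : R)).
    by apply: cvg_expr; rewrite ger0_norm ?invr_ge0 //; lra.
  by apply/funext => n /=; rewrite natrX exprVn mul1r.
Unshelve. all: by end_near. Qed.

End l1_completeness.

(** Set to zero outside [[0, T]] too, because ordering and continuity of the positions are given on
    [[0, T]] only; bounds and measurability then hold on the whole plane. *)
Definition vfield {R : realType} (T : R) (N : nat) (L c : R) (p : nat -> R -> R) (t y : R) : R :=
  if (0 <= t <= T) && (- (L / 2) <= y < L / 2) then cfield N L c (p ^~ t) y else 0.

Lemma ge0_integral_addf {R : realType} (f g : R -> R) :
  (forall y, 0 <= f y) -> (forall y, 0 <= g y) ->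
  measurable_fun setT f -> measurable_fun setT g ->
  (\int[@lebesgue_measure R]_y (f y + g y)%:E =
   \int[@lebesgue_measure R]_y (f y)%:E + \int[@lebesgue_measure R]_y (g y)%:E)%E.
Proof.
move=> f0 g0 mf mg; under eq_integral do rewrite EFinD.
rewrite ge0_integralD //.
- by move=> y _; rewrite lee_fin.
- exact/measurable_EFinP.
- by move=> y _; rewrite lee_fin.
- exact/measurable_EFinP.
Qed.

(** * Space-time fields of controlled systems and their distance *)

Section field.
Context {R : realType}.
Local Notation mu := (@lebesgue_measure R).
Variables (T Mx C : R) (phi : R -> R).
Hypothesis T0 : 0 < T.
Hypothesis Mx0 : 0 < Mx.
Hypothesis C0 : 0 <= C.

Section one_system.
Variables (N : nat) (L c : R) (p : nat -> R -> R).
Hypothesis ctl : controlled T Mx C phi N L c p.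
Local Notation v := (vfield T N L c p).

Lemma vfield_itv t y : 0 <= v t y <= Mx.
Proof.
rewrite /vfield; case: ifP => [/andP[tT _]|_]; last by rewrite lexx ltW.
have [N0 L1 c0 c1 pN plt _ dM _ _ _ _] := ctl.
have L0 : 0 < L := lt_le_trans ltr01 L1.
have [k _ ->] := @cfield_ex _ N L c (p ^~ t) N0 L0 (pN t) (plt t tT) y.
apply/andP; split; last exact: dM.
by apply: (cdens_ge0 N (p := p ^~ t) (plt t tT)); exact: ltW.
Qed.

(** Composition with the projection onto [[0, T]] turns continuity on that interval into
    measurability on the whole line. *)
Let clamp (t : R) : R := Num.max 0 (Num.min t T).

Let clamp_itv t : 0 <= clamp t <= T.
Proof. by rewrite /clamp le_max lexx /= ge_max (ltW T0) /= ge_min lexx orbT. Qed.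

Let clamp_id t : 0 <= t <= T -> clamp t = t.
Proof.
by move=> /andP[t0 tT]; rewrite /clamp; have -> : Num.min t T = t; [apply/min_idPl|apply/max_idPr].
Qed.

Let clamp_meas : measurable_fun setT clamp.
Proof. by apply: measurable_funTS; apply: measurable_maxr => //; apply: measurable_minr. Qed.

Let within_meas (g : R -> R) : {within `[0, T], continuous g} ->
  measurable_fun setT (fun z : R * R => g (clamp z.1)).
Proof.
move=> gc; have mg : measurable_fun `[0, T] g by apply: subspace_continuous_measurable_fun.
have h : measurable_fun setT (g \o clamp).
  apply: (@measurable_comp _ _ _ _ _ _ `[0, T]%classic) => //.
  by move=> _ [t _ <-] /=; rewrite in_itv /= clamp_itv.
exact: (measurableT_comp h (@measurable_fst _ _ _ _)).
Qed.

(** A cell sweeps out the region between two graphs continuous in time, together with its countably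
    many translates by multiples of [L]. *)
Lemma vfield_measurable : jointly_measurable v.
Proof.
have [N0 L1 c0 c1 pN plt pc _ _ _ _ _] := ctl.
pose Acell k := [set z : R * R | exists m : int,
  p k (clamp z.1) <= z.2 + m%:~R * L < p k.+1 (clamp z.1)].
have mA k : measurable (Acell k).
  rewrite (_ : Acell k = \bigcup_(m : int)
    ([set z : R * R | p k (clamp z.1) <= z.2 + m%:~R * L] `&`
     [set z : R * R | z.2 + m%:~R * L < p k.+1 (clamp z.1)])).
    apply: countable_bigcupT_measurable => [|m]; first exact: countableP.
    have my : measurable_fun setT (fun z : R * R => z.2 + m%:~R * L).
      by apply: measurable_funD => //; exact: measurable_snd.
    have m1 := within_meas (pc k); have m2 := within_meas (pc k.+1).
    apply: measurableI.
      by have := measurable_fun_ler m1 my measurableT (Y := [set true]) I; rewrite setTI.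
    by have := measurable_fun_ltr my m2 measurableT (Y := [set true]) I; rewrite setTI.
  apply/seteqP; split => z /=.
    by move=> [m /andP[h1 h2]]; exists m.
  by move=> [m _ /= [h1 h2]]; exists m; rewrite h1 h2.
have rc k : {within `[0, T], continuous (fun t => cdens N c (p ^~ t) k)}.
  apply: con_mul; first exact: con_cst.
  apply: con_inv; last first.
    move=> t /=; rewrite in_itv /= => tT.
    by rewrite mulf_neq0 ?pnatr_eq0 -?lt0n // gt_eqF // subr_gt0 plt.
  by apply: con_mul; [exact: con_cst|apply: con_sub].
pose D := [set z : R * R | (0 <= z.1 <= T) && (- (L / 2) <= z.2 < L / 2)].
have mD : measurable D.
  rewrite (_ : D = `[0, T]%classic `*` `[- (L / 2), L / 2[%classic).
    exact: measurableX.
  apply/seteqP; split => z; rewrite /D /= !in_itv /=; first by move=> /andP[].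
  by move=> [-> ->].
rewrite /jointly_measurable.
rewrite (_ : (fun z => _) = (fun z : R * R => \1_D z *
   \sum_(k < N) \1_(Acell k) z * cdens N c (p ^~ (clamp z.1)) k)).
  apply: measurable_funM; first exact: measurable_indic.
  apply: measurable_sum => k; apply: measurable_funM; first exact: measurable_indic.
  exact: (within_meas (rc k)).
apply/funext => z; rewrite /vfield indicE.
case: ifPn => hz; last by rewrite memNset ?mul0r //; exact/negP.
rewrite mem_set // mul1r; have /andP[zT _] := hz.
rewrite (clamp_id zT) /cfield; apply: eq_bigr => k _; rewrite indicE.
case: ifPn => hk.
  by rewrite mem_set ?mul1r // /Acell /= (clamp_id zT); apply/asboolP.
rewrite memNset ?mul0r // /Acell /= (clamp_id zT) => hm; move/negP: hk; apply.
by apply/asboolP.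
Qed.

Lemma vfield_section t : measurable_fun setT (v t).
Proof. exact: (measurableT_comp vfield_measurable (pair1_measurable t)). Qed.

(** The initial moment [C] plus the displacement bound from time 0 to [T] with [d = 1]. *)
Definition tail_const : R := 2 * C + (2 * C + 1) * T.

Lemma position_moment (t : R) : 0 <= t <= T ->
  c / N%:R * \sum_(k < N) `|trep L (p k t)| <= tail_const + L / N%:R.
Proof.
have [N0 L1 c0 c1 pN plt pc _ disp _ _ mom] := ctl => /andP[t0 tT].
have L0 : 0 < L := lt_le_trans ltr01 L1.
have h1 := disp 1 0 t ltr01 (lexx 0) t0 tT.
have : c / N%:R * \sum_(k < N) `|trep L (p k t)| <=
    c / N%:R * (\sum_(k < N) `|p k t - p k 0| + \sum_(k < N) `|p k 0|).
  apply: ler_wpM2l; first by rewrite divr_ge0 // ltW.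
  rewrite -big_split /=; apply: ler_sum => k _.
  apply: le_trans (_ : `|p k t| <= _).
    by have := trep_abs_le (p k t) 0 L0; rewrite mul0r addr0.
  by rewrite -{1}(subrK (p k 0) (p k t)); exact: ler_normD.
rewrite mulrDr => h2; apply: (le_trans h2).
rewrite invr1 subr0 in h1.
have h3 : (C + 1 + 1 * C) * t <= (2 * C + 1) * T.
  rewrite (_ : C + 1 + 1 * C = 2 * C + 1); last by ring.
  by apply: ler_wpM2l => //; have := C0; lra.
rewrite /tail_const; lra.
Qed.

Lemma smoothed_itv (h t y : R) : 0 < h -> 0 <= smoothed N L c (p ^~ t) h y <= h^-1.
Proof.
have [N0 L1 c0 c1 _ _ _ _ _ _ _ _] := ctl => h0.
have cN : 0 <= c / N%:R by rewrite divr_ge0 // ltW.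
have h2 : 0 < h ^+ 2 by rewrite exprn_gt0.
rewrite /smoothed; apply/andP; split.
  by apply: mulr_ge0 => //; apply: sumr_ge0 => k _; rewrite divr_ge0 ?tent_ge0 // ltW.
apply: le_trans (_ : c / N%:R * \sum_(k < N) h^-1 <= _).
  apply: ler_wpM2l => //; apply: ler_sum => k _.
  rewrite ler_pdivrMr // (_ : h^-1 * h ^+ 2 = h) ?tent_le //.
  by field; rewrite gt_eqF.
rewrite sumr_const card_ord -[_ *+ N]mulr_natr.
rewrite (_ : _ * _ = c * h^-1); last by field; rewrite !gt_eqF // ltr0n.
by rewrite ler_piMl // invr_ge0 ltW.
Qed.

(** The tent of the torus distance is 1-Lipschitz, so the average inherits the displacement
    estimate. The loss of [h ^ 2] is harmless, as [h] is fixed before the grid. *)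
Lemma smoothed_equicont (h d s t y z : R) : 0 < h -> 0 < d -> 0 <= s -> s <= t -> t <= T ->
  `|smoothed N L c (p ^~ t) h y - smoothed N L c (p ^~ s) h z| <=
    ((C + d^-1 + d * C) * (t - s) + d * C + `|y - z|) / h ^+ 2.
Proof.
have [N0 L1 c0 c1 _ _ _ _ disp _ _ _] := ctl => h0 d0 s0 st tT.
have L0 : 0 < L := lt_le_trans ltr01 L1.
have cN : 0 <= c / N%:R by rewrite divr_ge0 // ltW.
have h2 : 0 < h ^+ 2 by rewrite exprn_gt0.
rewrite ler_pdivlMr // -(ger0_norm (ltW h2)) -normrM /smoothed.
rewrite [X in `|X|](_ : _ = c / N%:R *
    \sum_(k < N) (tent h (trep L (p k t - y)) - tent h (trep L (p k s - z)))).
  rewrite normrM (ger0_norm cN).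
  apply: le_trans (_ : c / N%:R * \sum_(k < N) (`|p k t - p k s| + `|y - z|) <= _).
    apply: ler_wpM2l => //; apply: le_trans (ler_norm_sum _ _ _) _; apply: ler_sum => k _.
    have lip (a b : R) : tent h (trep L a) <= tent h (trep L b) + `|a - b|.
      have h1 := trep_abs_lip b a L0; rewrite (distrC b a) in h1.
      rewrite /tent ge_max addr_ge0 //=; last by rewrite le_max lexx.
      have : h - `|trep L b| <= Num.max 0 (h - `|trep L b|) by rewrite le_max lexx orbT.
      lra.
    apply: le_trans (_ : `|(p k t - y) - (p k s - z)| <= _).
      by rewrite ler_norml; have l1 := lip (p k t - y) (p k s - z);
         have l2 := lip (p k s - z) (p k t - y); rewrite distrC in l2; apply/andP; split; lra.
    rewrite (_ : _ - _ = (p k t - p k s) - (y - z)); last by ring.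
    exact: ler_normB.
  rewrite big_split /= mulrDr; apply: lerD; first exact: disp.
  rewrite sumr_const card_ord -[_ *+ N]mulr_natr.
  rewrite (_ : _ * _ = c * `|y - z|); last by field; rewrite gt_eqF // ltr0n.
  by rewrite ler_piMl.
rewrite -!mulr_suml sumrB; field; rewrite !gt_eqF //; rewrite ?ltr0n //.
Qed.

End one_system.

Section two_systems.
Variables (N1 N2 : nat) (L1 L2 d1 d2 : R) (p1 p2 : nat -> R -> R).
Hypothesis ctl1 : controlled T Mx C phi N1 L1 d1 p1.
Hypothesis ctl2 : controlled T Mx C phi N2 L2 d2 p2.
Variables (r h d Cd eta : R).
Hypothesis r0 : 0 < r.
Hypothesis h0 : 0 < h.
Hypothesis rh1 : r + h < L1 / 2.
Hypothesis rh2 : r + h < L2 / 2.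
Hypothesis d_ge0 : 0 <= d.
Hypothesis Cd0 : 0 <= Cd.
Hypothesis eta0 : 0 <= eta.
Hypothesis phid : forall a b : R, 0 <= a <= Mx -> 0 <= b <= Mx ->
  `|a - b| <= d + Cd * `|phi a - phi b|.
Hypothesis heta : forall t y : R, 0 <= t <= T -> `|y| <= r ->
  `|smoothed N1 L1 d1 (p1 ^~ t) h y - smoothed N2 L2 d2 (p2 ^~ t) h y| <= eta.

Let err : R := 3 / (2 * h ^+ 2) * (L1 / N1%:R + L2 / N2%:R).
(** The errors uniform on the window [[- r, r]]: one [d] per system, the two mesh errors and the
    tolerance of the net. *)
Let K0 : R := 2 * d + err + eta.
Let J1 t : R := \sum_(k < N1) `|cjump N1 d1 (p1 ^~ t) phi k|.
Let J2 t : R := \sum_(k < N2) `|cjump N2 d2 (p2 ^~ t) phi k|.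

Lemma near_field (N : nat) (L c : R) (p : nat -> R -> R) (t y : R) :
  controlled T Mx C phi N L c p -> r + h < L / 2 -> 0 <= t <= T -> `|y| <= r ->
  `|vfield T N L c p t y - smoothed N L c (p ^~ t) h y| <=
    d + 3 * Cd * jump_maj N L c (p ^~ t) phi h y + 3 / (2 * h ^+ 2) * (L / N%:R).
Proof.
move=> [N0 Lge1 c0 c1 pN plt _ dM _ _ _ _] rh tT yr.
have L0 : 0 < L := lt_le_trans ltr01 Lge1.
have r0' := r0; have h0' := h0.
have yL : - (L / 2) <= y < L / 2.
  by move: yr; rewrite ler_norml => /andP[? ?]; apply/andP; split; lra.
have hL : h <= L / 2 by lra.
have := @smoothed_approx _ N L c (p ^~ t) N0 L0 (pN t) (plt t tT) phi h h0 hL Mx d Cd y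
  (ltW c0) Cd0 (dM t tT) phid.
rewrite /vfield tT yL /= => hs; apply: (le_trans hs).
have hj := jump_near_maj N c (p ^~ t) L0 phi rh yr.
have q : 0 <= 3 * Cd by rewrite mulr_ge0.
apply: lerD; first by rewrite lerD2l; exact: ler_wpM2l.
have h2 : 0 < h ^+ 2 by rewrite exprn_gt0.
have N0R : 0 < N%:R :> R by rewrite ltr0n.
rewrite (_ : 3 * (c * L) / (2 * N%:R * h ^+ 2) = c * (3 / (2 * h ^+ 2) * (L / N%:R))); last first.
  by field; rewrite !gt_eqF.
have q' : 0 <= 3 / (2 * h ^+ 2) * (L / N%:R).
  apply: mulr_ge0; apply: divr_ge0; rewrite ?(ltW L0) ?(ltW N0R) //.
  by apply: mulr_ge0 => //; exact: ltW.
by rewrite ler_piMl.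
Qed.

Lemma far_field (N : nat) (L c : R) (p : nat -> R -> R) (t y : R) :
  controlled T Mx C phi N L c p -> 0 <= t <= T -> r <= `|y| ->
  vfield T N L c p t y <= tail_maj N L c (p ^~ t) r y.
Proof.
move=> [N0 Lge1 c0 c1 pN plt _ dM _ _ _ _] tT yr.
have L0 : 0 < L := lt_le_trans ltr01 Lge1.
rewrite /vfield tT /=; case: ifPn => yL.
  exact: (cfield_le_tail N (p := p ^~ t) L0 (ltW c0) (plt t tT) r0 yr yL).
exact: (tail_maj_ge0 N L (p := p ^~ t) (ltW c0) (plt t tT)).
Qed.

(** The tails dominate for [|y| > r] and the remaining terms for [|y| <= r]; all being nonnegative,
    their sum dominates everywhere. *)
Let dom t y : R := (tail_maj N1 L1 d1 (p1 ^~ t) r y + tail_maj N2 L2 d2 (p2 ^~ t) r y) +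
  (K0 * \1_`[- r, r] y +
   3 * Cd * (jump_maj N1 L1 d1 (p1 ^~ t) phi h y + jump_maj N2 L2 d2 (p2 ^~ t) phi h y)).

Let err0 : 0 <= err.
Proof.
have [N10 L11 _ _ _ _ _ _ _ _ _ _] := ctl1; have [N20 L21 _ _ _ _ _ _ _ _ _ _] := ctl2.
have h2 : 0 < h ^+ 2 by rewrite exprn_gt0.
have q1 : 0 <= L1 / N1%:R by rewrite divr_ge0 // (le_trans ler01).
have q2 : 0 <= L2 / N2%:R by rewrite divr_ge0 // (le_trans ler01).
apply: mulr_ge0; last exact: addr_ge0.
by apply: divr_ge0 => //; apply: mulr_ge0 => //; exact: ltW.
Qed.

Let K00 : 0 <= K0.
Proof. by apply: addr_ge0 => //; apply: addr_ge0; [exact: mulr_ge0|exact: err0]. Qed.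

Lemma pair_dom t y : 0 <= t <= T ->
  `|vfield T N1 L1 d1 p1 t y - vfield T N2 L2 d2 p2 t y| <= dom t y.
Proof.
move=> tT; have K00' := K00.
have [N10 L11 c10 _ _ plt1 _ _ _ _ _ _] := ctl1.
have [N20 L21 c20 _ _ plt2 _ _ _ _ _ _] := ctl2.
have t1 := tail_maj_ge0 N1 L1 (p := p1 ^~ t) (ltW c10) (plt1 t tT) y r0.
have t2 := tail_maj_ge0 N2 L2 (p := p2 ^~ t) (ltW c20) (plt2 t tT) y r0.
have j1 := jump_maj_ge0 N1 L1 d1 (p1 ^~ t) phi h y.
have j2 := jump_maj_ge0 N2 L2 d2 (p2 ^~ t) phi h y.
have q : 0 <= 3 * Cd by rewrite mulr_ge0.
have qj := mulr_ge0 q (addr_ge0 j1 j2).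
case: (leP `|y| r) => yr.
  have ind : \1_`[- r, r]%classic y = 1 :> R.
    by rewrite indicE mem_set //= in_itv /= -ler_norml.
  have a1 := near_field ctl1 rh1 tT yr; have a2 := near_field ctl2 rh2 tT yr.
  have a3 := heta tT yr.
  rewrite /dom /K0 /err ind.
  have tri : forall a b s1 s2 : R, `|a - b| <= `|a - s1| + `|s1 - s2| + `|b - s2|.
    move=> a b s1 s2; rewrite (_ : a - b = (a - s1) + (s1 - s2) - (b - s2)); last by ring.
    by apply: le_trans (ler_normB _ _) _; rewrite lerD2r; exact: ler_normD.
  have a4 := tri (vfield T N1 L1 d1 p1 t y) (vfield T N2 L2 d2 p2 t y)
    (smoothed N1 L1 d1 (p1 ^~ t) h y) (smoothed N2 L2 d2 (p2 ^~ t) h y).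
  rewrite mulr1 !mulrDr; lra.
have b1 := far_field ctl1 tT (ltW yr); have b2 := far_field ctl2 tT (ltW yr).
have /andP[v1 _] := vfield_itv ctl1 t y; have /andP[v2 _] := vfield_itv ctl2 t y.
have i0 : 0 <= K0 * \1_`[- r, r]%classic y by rewrite mulr_ge0.
rewrite ler_norml /dom; apply/andP; split; lra.
Qed.

(** Each jump is felt on an interval of length [2 * h] only. This factor [h] is what compensates a
    large [Cd]. *)
Lemma pair_time t : 0 <= t <= T ->
  (\int[mu]_y (`|vfield T N1 L1 d1 p1 t y - vfield T N2 L2 d2 p2 t y|)%:E <=
   ((2 * tail_const + 2 * (L1 / N1%:R + L2 / N2%:R)) / r + 2 * r * K0 +
     6 * Cd * h * (J1 t + J2 t))%:E)%E.
Proof.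
move=> tT; have r0' := r0; have K00' := K00.
have [N10 L11 c10 c11 pN1 plt1 _ _ _ _ _ _] := ctl1.
have [N20 L21 c20 c21 pN2 plt2 _ _ _ _ _ _] := ctl2.
have L10 : 0 < L1 := lt_le_trans ltr01 L11; have L20 : 0 < L2 := lt_le_trans ltr01 L21.
have t1 y := tail_maj_ge0 N1 L1 (p := p1 ^~ t) (ltW c10) (plt1 t tT) y r0.
have t2 y := tail_maj_ge0 N2 L2 (p := p2 ^~ t) (ltW c20) (plt2 t tT) y r0.
have j1 y := jump_maj_ge0 N1 L1 d1 (p1 ^~ t) phi h y.
have j2 y := jump_maj_ge0 N2 L2 d2 (p2 ^~ t) phi h y.
have q : 0 <= 3 * Cd by rewrite mulr_ge0.
have mt1 := measurable_tail_maj N1 L1 d1 (p1 ^~ t) r.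
have mt2 := measurable_tail_maj N2 L2 d2 (p2 ^~ t) r.
have mj1 := measurable_jump_maj N1 L1 d1 (p1 ^~ t) phi h.
have mj2 := measurable_jump_maj N2 L2 d2 (p2 ^~ t) phi h.
have i0 y : 0 <= K0 * \1_`[- r, r]%classic y by rewrite mulr_ge0.
apply: (@le_trans _ _ (\int[mu]_y (dom t y)%:E)%E).
  apply: ge0_le_integral => //.
  - apply/measurable_EFinP; apply: measurableT_comp => //.
    by apply: measurable_funB; [exact: vfield_section ctl1 t|exact: vfield_section ctl2 t].
  - apply/measurable_EFinP; apply: measurable_funD; first exact: measurable_funD.
    apply: measurable_funD; first exact: measurable_step.
    by apply: measurable_funM => //; exact: measurable_funD.
  - by move=> y _; rewrite lee_fin; exact: pair_dom.
rewrite /dom ge0_integral_addf //; first last.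
- by apply: measurable_funD; [exact: measurable_step|
    apply: measurable_funM => //; exact: measurable_funD].
- exact: measurable_funD.
- by move=> y; apply: addr_ge0 => //; apply: mulr_ge0 => //; exact: addr_ge0.
- by move=> y; exact: addr_ge0.
rewrite (ge0_integral_addf t1 t2 mt1 mt2).
rewrite (@ge0_integral_addf _ (fun y => K0 * \1_`[- r, r]%classic y)) //; first last.
- by apply: measurable_funM => //; exact: measurable_funD.
- exact: measurable_step.
- by move=> y; apply: mulr_ge0 => //; exact: addr_ge0.
rewrite (_ : (\int[mu]_y (3 * Cd * (jump_maj N1 L1 d1 (p1 ^~ t) phi h y +
    jump_maj N2 L2 d2 (p2 ^~ t) phi h y))%:E = (3 * Cd)%:E *
    (\int[mu]_y (jump_maj N1 L1 d1 (p1 ^~ t) phi h y)%:E +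
     \int[mu]_y (jump_maj N2 L2 d2 (p2 ^~ t) phi h y)%:E))%E); last first.
  under eq_integral do rewrite EFinM.
  rewrite ge0_integralZl_EFin ?(ge0_integral_addf j1 j2 mj1 mj2) //.
  - by move=> y _; rewrite lee_fin addr_ge0.
  - by apply/measurable_EFinP; exact: measurable_funD.
rewrite integral_step //; last by lra.
rewrite (integral_tail_maj (p := p1 ^~ t) N10 L10 (ltW c10) (pN1 t) (plt1 t tT) r0).
rewrite (integral_tail_maj (p := p2 ^~ t) N20 L20 (ltW c20) (pN2 t) (plt2 t tT) r0).
rewrite (integral_jump_maj N1 L1 d1 (p1 ^~ t) phi h0) (integral_jump_maj N2 L2 d2 (p2 ^~ t) phi h0).
rewrite -[X in (_ + (_ + _ * X) <= _)%E]EFinD -EFinM -!EFinD lee_fin.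
have m1 := position_moment ctl1 tT; have m2 := position_moment ctl2 tT.
have e1 : d1 * L1 / N1%:R <= L1 / N1%:R.
  by rewrite -mulrA ler_piMl // divr_ge0 // ltW.
have e2 : d2 * L2 / N2%:R <= L2 / N2%:R.
  by rewrite -mulrA ler_piMl // divr_ge0 // ltW.
rewrite -/(J1 t) -/(J2 t) -[leRHS]addrA.
apply: lerD.
  rewrite -mulrDl ler_pM2r ?invr_gt0 //; lra.
apply: lerD; first by rewrite opprK le_eqVlt; apply/orP; left; apply/eqP; ring.
by rewrite le_eqVlt; apply/orP; left; apply/eqP; ring.
Qed.

Lemma pair_dist : (l1dist T (vfield T N1 L1 d1 p1) (vfield T N2 L2 d2 p2) <=
  (T * ((2 * tail_const + 2 * (L1 / N1%:R + L2 / N2%:R)) / r + 2 * r * K0) +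
    12 * Cd * h * C)%:E)%E.
Proof.
have [N10 L11 _ _ _ _ _ _ _ jc1 ji1 _] := ctl1.
have [N20 L21 _ _ _ _ _ _ _ jc2 ji2 _] := ctl2.
have r0' := r0; have K00' := K00; have C0' := C0; have T0' := T0.
set a := (2 * tail_const + _) / r + _.
have a0 : 0 <= a.
  have q1 : 0 <= L1 / N1%:R by rewrite divr_ge0 // (le_trans ler01).
  have q2 : 0 <= L2 / N2%:R by rewrite divr_ge0 // (le_trans ler01).
  have q3 : 0 <= tail_const.
    by rewrite /tail_const addr_ge0 ?mulr_ge0 ?addr_ge0 ?mulr_ge0 // ltW.
  by rewrite /a addr_ge0 ?divr_ge0 ?mulr_ge0 ?(ltW r0) //; lra.
have b0 : 0 <= 6 * Cd * h by rewrite !mulr_ge0 // ltW.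
have J10 t : 0 <= J1 t by apply: sumr_ge0.
have J20 t : 0 <= J2 t by apply: sumr_ge0.
have mJ1 : measurable_fun `[0, T] J1 by apply: subspace_continuous_measurable_fun.
have mJ2 : measurable_fun `[0, T] J2 by apply: subspace_continuous_measurable_fun.
apply: (@le_trans _ _ (\int[mu]_(t in `[0%R, T]) (a%:E + (6 * Cd * h)%:E * ((J1 t)%:E + (J2 t)%:E)))%E).
  apply: ge0_le_integral => //.
  - by move=> t _; apply: integral_ge0 => y _; rewrite lee_fin.
  - apply: measurable_funTS.
    exact: (inner_measurable (absdiff_measurable (vfield_measurable ctl1) (vfield_measurable ctl2))).
  - apply: emeasurable_funD => //; apply: emeasurable_funM => //.
    by apply: emeasurable_funD; exact/measurable_EFinP.
  move=> t /=; rewrite in_itv /= => tT; apply: le_trans (pair_time tT) _.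
  by rewrite -(EFinD (J1 t)) -EFinM -EFinD lee_fin.
rewrite ge0_integralD //; first last.
- by apply: emeasurable_funM => //; apply: emeasurable_funD; exact/measurable_EFinP.
- by move=> t _; apply: mule_ge0; [rewrite lee_fin|apply: adde_ge0; rewrite lee_fin].
rewrite integral_cst //= lebesgue_measure_itv /= lte_fin T0 oppr0 adde0.
rewrite ge0_integralZl_EFin //; first last.
- by apply: emeasurable_funD; exact/measurable_EFinP.
- by move=> t _; apply: adde_ge0; rewrite lee_fin.
rewrite ge0_integralD //; first last.
- exact/measurable_EFinP.
- by move=> y _; rewrite lee_fin.
- exact/measurable_EFinP.
- by move=> y _; rewrite lee_fin.
rewrite [leRHS]EFinD; apply: leeD; first by rewrite -EFinM lee_fin mulrC.
apply: le_trans (_ : (6 * Cd * h)%:E * (C%:E + C%:E) <= _)%E.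
  by apply: lee_wpmul2l; [rewrite lee_fin|exact: leeD].
by rewrite -EFinD -EFinM lee_fin le_eqVlt; apply/orP; left; apply/eqP; ring.
Qed.

End two_systems.
End field.

Lemma grid_point {R : realType} (X d x : R) : 0 < d -> 0 <= x <= X ->
  exists2 i : 'I_(Num.truncn (X / d)).+1, i%:R * d <= x & x - i%:R * d <= d.
Proof.
move=> d0 /andP[x0 xX]; have xd0 : 0 <= x / d by rewrite divr_ge0 // ltW.
have hi : (Num.truncn (x / d) < (Num.truncn (X / d)).+1)%N.
  rewrite truncn_lt_nat //; apply: le_lt_trans (_ : X / d < _); first by rewrite ler_pM2r ?invr_gt0.
  have Xd : 0 <= X / d by apply: divr_ge0; [exact: le_trans x0 xX|exact: ltW].
  by have /andP[] := truncn_itv Xd.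
exists (Ordinal hi) => /=; have /andP[h1 h2] := truncn_itv xd0.
  by rewrite -ler_pdivlMr.
rewrite ltr_pdivrMr // -[_.+1]addn1 natrD mulrDl mul1r in h2; lra.
Qed.

Lemma truncn_eq_dist {R : realType} (e a b : R) : 0 < e -> 0 <= a -> 0 <= b ->
  Num.truncn (a / e) = Num.truncn (b / e) -> `|a - b| <= e.
Proof.
move=> e0 a0 b0 h; have q (x : R) : 0 <= x -> 0 <= x / e by move=> ?; rewrite divr_ge0 // ltW.
have /andP[h1 h2] := truncn_itv (q a a0); have /andP[h3 h4] := truncn_itv (q b b0).
move: h1 h2; rewrite h => h1 h2.
rewrite ler_pdivlMr // in h1; rewrite ler_pdivlMr // in h3.
rewrite ltr_pdivrMr // -[_.+1]addn1 natrD mulrDl mul1r in h2.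
rewrite ltr_pdivrMr // -[_.+1]addn1 natrD mulrDl mul1r in h4.
by rewrite ler_norml; apply/andP; split; lra.
Qed.

(** In [3 * e] one part is the rounding and two are the oscillations of the fields between a point
    and its grid node. Nodes are taken below the point, since the modulus assumes [s <= t]. *)
Lemma finite_net {R : realType} (g : nat -> R -> R -> R) (B T r e d : R) :
  0 < e -> 0 < d -> 0 <= T ->
  (forall n t y, 0 <= g n t y <= B) ->
  (forall n (s t y z : R), 0 <= s -> s <= t -> t <= T -> t - s <= d -> `|y - z| <= d ->
    `|g n t y - g n s z| <= e) ->
  exists (F : finType) (q : nat -> F), forall n m, q n = q m ->
    forall t y : R, 0 <= t <= T -> `|y| <= r -> `|g n t y - g m t y| <= 3 * e.
Proof.
move=> e0 d0 T0 gB geq.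
pose kt := (Num.truncn (T / d)).+1; pose ky := (Num.truncn (2 * r / d)).+1.
pose Q := (Num.truncn (B / e)).+1.
pose val n (ij : 'I_kt * 'I_ky) := g n (ij.1%:R * d) (- r + ij.2%:R * d).
have tr_lt n ij : (Num.truncn (val n ij / e) < Q)%N.
  have /andP[v0 vB] := gB n (ij.1%:R * d) (- r + ij.2%:R * d).
  rewrite truncn_lt_nat ?divr_ge0 ?(ltW e0) //; apply: le_lt_trans (_ : B / e < _).
    by rewrite ler_pM2r ?invr_gt0.
  by have /andP[_] := truncn_itv (divr_ge0 (le_trans v0 vB) (ltW e0)).
exists {ffun 'I_kt * 'I_ky -> 'I_Q}, (fun n => [ffun ij => Ordinal (tr_lt n ij)]).
move=> n m /ffunP qnm t y tT yr.
have [i i1 i2] := grid_point d0 tT.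
have yr' : 0 <= y + r <= 2 * r.
  by move: yr; rewrite ler_norml => /andP[? ?]; apply/andP; split; lra.
have [j j1 j2] := grid_point d0 yr'.
have := qnm (i, j); rewrite !ffunE => -[hq].
have v0 k : 0 <= val k (i, j) by have /andP[] := gB k (i%:R * d) (- r + j%:R * d).
have h1 := truncn_eq_dist e0 (v0 n) (v0 m) hq.
have /andP[_ tT2] := tT.
have id0 : 0 <= i%:R * d by rewrite mulr_ge0 // ltW.
have yd : `|y - (- r + j%:R * d)| <= d.
  by rewrite ler_norml; apply/andP; split; lra.
have h2 k := geq k (i%:R * d) t y (- r + j%:R * d) id0 i1 tT2 i2 yd.
have h3 := h2 n; have h4 := h2 m.
rewrite (_ : g n t y - g m t y = (g n t y - val n (i, j)) + (val n (i, j) - val m (i, j))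
   - (g m t y - val m (i, j))); last by ring.
apply: le_trans (ler_normB _ _) _.
have := ler_normD (g n t y - val n (i, j)) (val n (i, j) - val m (i, j)).
rewrite /val /= in h1 *; lra.
Qed.

(** * Total boundedness of particle densities *)

Section compactness.
Context {R : realType}.
Variables (T Mx C : R) (phi : R -> R).
Hypothesis T0 : 0 < T.
Hypothesis Mx0 : 0 < Mx.
Hypothesis C0 : 0 <= C.
Hypothesis phi_mod : forall d : R, 0 < d -> exists2 Cd : R, 0 <= Cd &
  forall a b : R, 0 <= a <= Mx -> 0 <= b <= Mx -> `|a - b| <= d + Cd * `|phi a - phi b|.
Variables (N : nat -> nat) (L c : nat -> R) (p : nat -> nat -> R -> R).
Hypothesis ctl : forall n, controlled T Mx C phi (N n) (L n) (c n) (p n).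
Hypothesis L_large : forall b : R, exists n0, forall n, (n0 <= n)%N -> b <= L n.
Hypothesis mesh_small : forall e : R, 0 < e ->
  exists n0, forall n, (n0 <= n)%N -> L n / (N n)%:R <= e.

Let v n := vfield T (N n) (L n) (c n) (p n).

Lemma smoothed_net (h r e : R) : 0 < h -> 0 < e ->
  exists (F : finType) (q : nat -> F), forall n m, q n = q m ->
    forall t y : R, 0 <= t <= T -> `|y| <= r ->
    `|smoothed (N n) (L n) (c n) (p n ^~ t) h y - smoothed (N m) (L m) (c m) (p m ^~ t) h y| <= e.
Proof.
move=> h0 e0; have C0' := C0; have T0' := T0.
have h2 : 0 < h ^+ 2 by rewrite exprn_gt0.
have C1 : 0 < C + 1 by lra.
(* The tolerance after multiplication by [h ^ 2]. It is split evenly between [d * C], the time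
   increment [A * w] and the space increment; [A >= 1] lets one mesh [w] serve time and space. *)
pose s := e / 3 * h ^+ 2.
have s0 : 0 < s by rewrite /s mulr_gt0 //; lra.
pose d := s / (3 * (C + 1)).
have d0 : 0 < d by rewrite /d divr_gt0 // mulr_gt0.
pose A := C + d^-1 + d * C + 1.
have q1 : 0 < d^-1 by rewrite invr_gt0.
have q2 : 0 <= d * C by apply: mulr_ge0 => //; exact: ltW.
have A1 : 1 <= A by rewrite /A; lra.
have A0 : 0 < A by lra.
pose w := s / (3 * A).
have w0 : 0 < w by rewrite /w divr_gt0 // mulr_gt0.
have dC : d * C <= s / 3.
  have -> : s / 3 = d * (C + 1) by rewrite /d; field; rewrite gt_eqF.
  by apply: ler_wpM2l; lra.
have wA : A * w = s / 3 by rewrite /w; field; rewrite gt_eqF.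
have wle : w <= s / 3 by rewrite -wA ler_peMl // ltW.
have [|||F [q hq]] := @finite_net R (fun n t y => smoothed (N n) (L n) (c n) (p n ^~ t) h y)
  h^-1 T r (e / 3) w _ w0 (ltW T0).
- by lra.
- by move=> n t y; exact: (smoothed_itv (ctl n) t y h0).
- move=> n s' t y z s0' st tT ts yz.
  apply: le_trans (smoothed_equicont (ctl n) y z h0 d0 s0' st tT) _.
  rewrite ler_pdivrMr // -/s.
  have : (C + d^-1 + d * C) * (t - s') <= A * w.
    by apply: ler_pM => //; [lra|rewrite subr_ge0|rewrite /A; lra].
  lra.
exists F, q => n m qnm t y tT yr; have := hq n m qnm t y tT yr; lra.
Qed.

Lemma particle_totally_bounded : totally_bounded_seq (fun n m => l1dist T (v n) (v m)).
Proof.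
move=> e e0; have C0' := C0; have T0' := T0.
have tc0 : 0 <= tail_const T C.
  by rewrite /tail_const addr_ge0 ?mulr_ge0 ?addr_ge0 ?mulr_ge0 // ltW.
pose tc := tail_const T C.
(* The order is essential: [r] is fixed by the tails, [d] by the window, [Cd] by [d], [h] by [Cd],
   and the mesh bound [l] by [h]. Tails, mesh, uniform errors and jumps receive [e / 4], [e / 8],
   [3 e / 8] and [e / 4]. *)
pose r := 4 * T * (2 * tc + 4) / e.
have r0 : 0 < r by rewrite /r divr_gt0 // !mulr_gt0 //; rewrite /tc; lra.
have Tr0 : 0 < T * r by rewrite mulr_gt0.
pose d := e / (16 * (T * r)).
have d0 : 0 < d by rewrite /d divr_gt0 // mulr_gt0.
have [Cd Cd0 hCd] := phi_mod d0.
have CC : 0 <= Cd * C by exact: mulr_ge0.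
have CC1 : 0 < Cd * C + 1 by lra.
pose h := e / (48 * (Cd * C + 1)).
have h0 : 0 < h by rewrite /h divr_gt0 // mulr_gt0.
have h2 : 0 < h ^+ 2 by rewrite exprn_gt0.
pose l := e * h ^+ 2 / (48 * (T * r)).
have l0 : 0 < l by rewrite /l divr_gt0 // mulr_gt0.
have [n1 hn1] := L_large (2 * (r + h) + 1).
have [n2 hn2] := mesh_small (ltr01 : 0 < 1 :> R).
have [n3 hn3] := mesh_small l0.
have eta0 : 0 < d by [].
have [F [q hq]] := smoothed_net r h0 d0.
exists F, q, (maxn n1 (maxn n2 n3)) => n m; rewrite !geq_max.
move=> /and3P[a1 a2 a3] /and3P[b1 b2 b3] qnm.
have rh1 : r + h < L n / 2 by have := hn1 n a1; lra.
have rh2 : r + h < L m / 2 by have := hn1 m b1; lra.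
apply: le_trans (pair_dist T0 Mx0 C0 (ctl n) (ctl m) r0 h0 rh1 rh2 (ltW d0) Cd0 (ltW d0) hCd
  (hq n m qnm)) _.
rewrite lee_fin -/tc.
have x1 := hn2 n a2; have x2 := hn2 m b2; have x3 := hn3 n a3; have x4 := hn3 m b3.
have y1 : T * ((2 * tc + 2 * (L n / (N n)%:R + L m / (N m)%:R)) / r) <= e / 4.
  rewrite mulrA ler_pdivrMr //.
  rewrite (_ : e / 4 * r = T * (2 * tc + 4)); last by rewrite /r; field; rewrite gt_eqF.
  by rewrite ler_pM2l //; lra.
have y2 : T * r * (3 / (2 * h ^+ 2) * (L n / (N n)%:R + L m / (N m)%:R)) <= e / 16.
  apply: le_trans (_ : T * r * (3 / (2 * h ^+ 2) * (l + l)) <= _).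
    rewrite ler_pM2l // ler_pM2l; first by apply: lerD.
    by rewrite divr_gt0 // mulr_gt0.
  rewrite le_eqVlt; apply/orP; left; apply/eqP; rewrite /l; field.
  by rewrite !gt_eqF.
have y3 : T * r * d = e / 16 by rewrite /d; field; rewrite !gt_eqF.
have y4 : 12 * Cd * h * C <= e / 4.
  rewrite (_ : e / 4 = 12 * h * (Cd * C + 1)); last by rewrite /h; field; rewrite gt_eqF.
  rewrite (_ : 12 * Cd * h * C = 12 * h * (Cd * C)); last by ring.
  by apply: ler_wpM2l; [rewrite mulr_ge0 // ltW|lra].
rewrite [leLHS](_ : _ = T * ((2 * tc + 2 * (L n / (N n)%:R + L m / (N m)%:R)) / r) +
  2 * (T * r * (3 / (2 * h ^+ 2) * (L n / (N n)%:R + L m / (N m)%:R))) + 6 * (T * r * d) +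
  12 * Cd * h * C); last by ring.
by lra.
Qed.

Lemma particle_compactness :
  exists psi : nat -> nat, (forall n, (psi n < psi n.+1)%N) /\
  exists rho : R -> R -> R, [/\ jointly_measurable rho,
    forall t y, 0 <= rho t y <= Mx &
    (l1dist T (v (psi n)) rho @[n --> \oo] --> 0%E)].
Proof.
have pos (k : nat) : 0 < 1 / (2 ^ k.+1)%:R :> R by rewrite divr_gt0 // ltr0n expn_gt0.
have [psi [psi_lt hpsi]] := cauchy_extraction
  pos particle_totally_bounded.
exists psi; split => //.
apply: l1_complete => // [n|n t y].
- exact: vfield_measurable (ctl (psi n)).
- exact: vfield_itv (ctl (psi n)) t y.
Qed.
End compactness.

Lemma cvge0P {R : realType} (u : nat -> \bar R) : (forall n, 0 <= u n)%E ->
  (u @ \oo --> 0%E) <->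
  forall e : R, 0 < e -> exists n0, forall n, (n0 <= n)%N -> (u n <= e%:E)%E.
Proof.
move=> u0; split=> [/fine_cvgP[uf /cvgrPdist_le h] e e0|h].
  have [n0 _ hn0] : \forall n \near \oo, (u n <= e%:E)%E.
    near=> n; have fn : u n \is a fin_num by near: n.
    rewrite -(fineK fn) lee_fin.
    have : `|0 - fine (u n)| <= e by near: n; exact: h.
    by rewrite sub0r normrN; apply: le_trans; exact: ler_norm.
  by exists n0.
have fin e n : 0 < e -> (u n <= e%:E)%E -> u n \is a fin_num.
  by move=> e0 ue; rewrite ge0_fin_numE //; exact: le_lt_trans ue (ltry _).
apply/fine_cvgP; split.
  have [n0 hn0] := h 1 ltr01; exists n0 => // n /= /hn0; exact: fin.
apply/cvgrPdist_le => e e0; have [n0 hn0] := h e e0.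
exists n0 => // n /= /hn0 ue.
rewrite sub0r normrN ger0_norm ?fine_ge0 //.
by rewrite -lee_fin fineK // (fin e).
Unshelve. all: by end_near. Qed.

Lemma zext_measurable {R : realType} (L : R) (f : R -> R -> R) :
  jointly_measurable f -> jointly_measurable (zext L f).
Proof.
move=> mf; pose A := [set z : R * R | z.2 \in `[(- (L / 2)), (L / 2)[].
have mA : measurable A.
  rewrite (_ : A = setT `*` `[(- (L / 2)), (L / 2)[%classic); first exact: measurableX.
  by apply/seteqP; split => z /=; [|case].
have := measurable_funM (measurable_indic mA) mf.
congr measurable_fun; apply/funext => z /=.
rewrite /zext indicE; case: ifPn => hz.
  by rewrite mem_set ?mul1r // /A /= in_itv.
by rewrite memNset ?mul0r // /A /= in_itv; exact/negP.
Qed.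

(** * Passage to the limit *)

Definition admissible_datum {R : realType} (M m1 : R) (f : R -> R) : Prop :=
  [/\ measurable_fun setT f, forall y, 0 <= f y,
      {ae @lebesgue_measure R, forall y, f y <= M},
      (\int[@lebesgue_measure R]_y (f y)%:E = 1)%E &
      (\int[@lebesgue_measure R]_y (`|y| * f y)%:E <= m1%:E)%E].

Section limits.
Context {R : realType}.
Local Notation mu := (@lebesgue_measure R).
Variables (K W : R -> R) (c0 c1 c2 rhat rbar T M m1 : R).
Hypothesis KA : kernel_assumptions K.
Hypothesis WA : W_assumptions W c0 c1 c2 rhat rbar.
Hypothesis T0 : 0 < T.
Hypothesis M0 : 0 < M.

Lemma l1dist_vfield_zext (N : nat) (L c : R) (x : nat -> R -> R) (f : R -> R -> R) :
  l1dist T (vfield T N L c (fun k t => ppos L N x k t)) (zext L f) =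
  (\int[mu]_(t in `[0%R, T]) \int[mu]_(y in `[(- (L / 2))%R, (L / 2)%R[)
     (`|pdensity L N c x t y - f t y|)%:E)%E.
Proof.
apply: eq_integral => t; rewrite inE /= in_itv /= => tT.
rewrite [RHS]integral_mkcond; apply: eq_integral => y _.
rewrite /vfield /zext tT patchE /= mem_setE /= in_itv /=.
by case: ifP => _; rewrite ?subrr ?normr0.
Qed.

(** [u] is any sequence within [1 / (n + 1)] of the torus limits: these limits themselves when only
    [L] varies, the densities on the line when the datum varies. *)
Lemma sequence_compactness (f : nat -> R -> R) (L : nat -> R) (g u : nat -> R -> R -> R) :
  (forall n, admissible_datum M m1 (f n)) ->
  (forall n, 1 <= L n) -> (forall n, 2 * m1 < L n) ->
  (forall b, exists n0, forall n, (n0 <= n)%N -> b <= L n) ->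
  (forall n, particle_limit K W (f n) (L n) T (g n)) ->
  (forall n, jointly_measurable (u n)) ->
  (forall n, l1dist T (zext (L n) (g n)) (u n) <= (n.+1%:R^-1)%:E)%E ->
  exists psi : nat -> nat, (forall n, (psi n < psi n.+1)%N) /\
  exists rho : R -> R -> R, [/\ jointly_measurable rho,
    exists B, forall t y, 0 <= rho t y <= B &
    l1dist T (u (psi n)) rho @[n --> \oo] --> 0%E].
Proof.
move=> fadm L1 Lm Linf gl um gu.
have [Mx [C [Mx0 C0 ctl]]] := particle_controlled KA WA m1 T0 M0.
have /choice[S hS] n : exists S : nat * (nat -> R -> R),
    [/\ controlled T Mx C (phiW W) S.1 (L n) (massL (f n) (L n)) S.2,
        L n / S.1%:R <= n.+1%:R^-1 &
        (l1dist T (vfield T S.1 (L n) (massL (f n) (L n)) S.2) (zext (L n) (g n))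
           <= (n.+1%:R^-1)%:E)%E].
  have [_ [_ [Ns [Nlt [xs [sol cvg0]]]]]] := gl n.
  have n0 : 0 < n.+1%:R^-1 :> R by rewrite invr_gt0.
  have [j0 hj0] : exists j0, forall j, (j0 <= j)%N ->
      (\int[mu]_(t in `[0%R, T%R]) \int[mu]_(y in `[(- (L n / 2))%R, (L n / 2)%R[)
        (`|pdensity (L n) (Ns j) (massL (f n) (L n)) (xs j) t y - g n t y|)%:E
         <= (n.+1%:R^-1)%:E)%E.
    apply: (proj1 (cvge0P _) cvg0) => // j.
    by apply: integral_ge0 => t _; apply: integral_ge0 => y _; rewrite lee_fin.
  have L0 : 0 < L n := lt_le_trans ltr01 (L1 n).
  (* The second index makes [L / N] at most [1 / (n + 1)], since [Ns j >= j]. *)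
  pose j := maxn j0 (Num.truncn (L n * n.+1%:R)).+1.
  exists (Ns j, fun k t => ppos (L n) (Ns j) (xs j) k t) => /=; split.
  - have [f1 f2 f3 f4 f5] := fadm n.
    by apply: ctl => //; exact: sol.
  - have jN : L n * n.+1%:R <= (Ns j)%:R.
      apply: le_trans (_ : (Num.truncn (L n * n.+1%:R)).+1%:R <= _).
        by have /andP[_ /ltW] := truncn_itv (mulr_ge0 (ltW L0) (ler0n R n.+1)).
      by rewrite ler_nat; apply: leq_trans (strict_mono_ge Nlt j); exact: leq_maxr.
    have Nj : 0 < (Ns j)%:R :> R by apply: lt_le_trans jN; rewrite mulr_gt0.
    by rewrite ler_pdivrMr // mulrC ler_pdivlMr.
  - by rewrite l1dist_vfield_zext; apply: hj0; exact: leq_maxl.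
have inv_small (e : R) : 0 < e -> exists n0, forall n, (n0 <= n)%N -> n.+1%:R^-1 <= e.
  move=> e0; exists (Num.truncn e^-1) => n hn.
  have ei : 0 < e^-1 by rewrite invr_gt0.
  have /andP[_ h] := truncn_itv (ltW ei).
  rewrite -[e]invrK lef_pV2 ?posrE //.
  by apply: ltW; apply: lt_le_trans h _; rewrite ler_nat.
have hctl n : controlled T Mx C (phiW W) (S n).1 (L n) (massL (f n) (L n)) (S n).2.
  by have [] := hS n.
have hphi d (d0 : 0 < d) := phi_modulus WA (ltW Mx0) d0.
have hmesh (e : R) : 0 < e -> exists n0, forall n, (n0 <= n)%N -> L n / (S n).1%:R <= e.
  move=> e0; have [n0 hn0] := inv_small e e0; exists n0 => n hn.
  by have [_ h _] := hS n; apply: le_trans h (hn0 n hn).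
have [psi [psi_lt [rho [mrho rhoM rho_cvg]]]] :=
  particle_compactness T0 Mx0 C0 hphi hctl Linf hmesh.
exists psi; split; first exact: psi_lt.
exists rho; split; [exact: mrho|by exists Mx|].
apply/cvge0P => [n|e e0]; first exact: l1dist_ge0.
have e3 : 0 < e / 3 by lra.
have [n1 hn1] := inv_small _ e3.
have [n2 hn2] := proj1 (cvge0P (fun n => l1dist_ge0 T _ _)) rho_cvg _ e3.
exists (maxn n1 n2) => n; rewrite geq_max => /andP[nn1 nn2].
have psin : (n1 <= psi n)%N by apply: leq_trans nn1 (strict_mono_ge psi_lt n).
have [ct _ a1] := hS (psi n); have mv := vfield_measurable T0 ct.
have [mg _] := gl (psi n).
have a2 := gu (psi n); rewrite l1dist_sym in a2; rewrite l1dist_sym in a1.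
have a3 := hn2 n nn2; have a4 := hn1 _ psin.
have mz l := zext_measurable l mg.
apply: le_trans (l1dist_triangle T (um (psi n)) (mz (L (psi n))) mrho) _.
apply: le_trans (leeD2l _ (l1dist_triangle T (mz (L (psi n))) mv mrho)) _.
apply: (@le_trans _ _ ((e / 3)%:E + ((e / 3)%:E + (e / 3)%:E))%E); last first.
  by rewrite -!EFinD lee_fin; lra.
apply: leeD; first by apply: le_trans a2 _; rewrite lee_fin.
by apply: leeD; [apply: le_trans a1 _; rewrite lee_fin|exact: a3].
Qed.

End limits.
Theorem theorem5p6 (R : realType) (K W : R -> R) (c0 c1 c2 rhat rbar : R)
  (rho0 : R -> R) (T : R) :
  kernel_assumptions K ->
  W_assumptions W c0 c1 c2 rhat rbar ->
  measurable_fun [set: R] rho0 ->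
  (forall x, 0 <= rho0 x) ->
  (exists M : R, \forall x \ae (@lebesgue_measure R), `|rho0 x| <= M) ->
  (\int[(@lebesgue_measure R)]_x (rho0 x)%:E = 1)%E ->
  (energy K W rho0 < +oo)%E ->
  (\int[(@lebesgue_measure R)]_x (`|x| * rho0 x)%:E < +oo)%E ->
  0 < T ->
  (* Part 1: L -> +oo *)
  (forall (Ls : nat -> R) (rhos : nat -> R -> R -> R),
     (forall n, 0 < Ls n) -> (Ls n @[n --> \oo] --> +oo) ->
     (forall n, particle_limit K W rho0 (Ls n) T (rhos n)) ->
     exists psi : nat -> nat, (forall n, (psi n < psi n.+1)%N) /\
     exists rho : R -> R -> R,
       measurable_fun [set: R * R] (fun z : R * R => rho z.1 z.2) /\
       (exists M : R, forall t y, 0 <= rho t y <= M) /\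
       (l1dist T (zext (Ls (psi n)) (rhos (psi n))) rho @[n --> \oo] --> 0%E))
  /\
  (* Part 2: approximating initial data rho0^lambda *)
  (forall (rho0s : nat -> R -> R) (rhol : nat -> R -> R -> R),
     (forall l, measurable_fun [set: R] (rho0s l)) ->
     (forall l x, 0 < rho0s l x) ->
     (forall l (M : R), (\forall x \ae (@lebesgue_measure R), `|rho0 x| <= M) ->
                 \forall x \ae (@lebesgue_measure R), `|rho0s l x| <= 2 * M) ->
     (forall l, (energy K W (rho0s l) <= 2%:E * energy K W rho0)%E) ->
     (forall l, (\int[(@lebesgue_measure R)]_x (rho0s l x)%:E = 1)%E) ->
     (exists C : R, forall l,
        (\int[(@lebesgue_measure R)]_x (`|x| * rho0s l x)%:E <= C%:E)%E) ->
     ((\int[(@lebesgue_measure R)]_x (`|rho0s l x - rho0 x|)%:E)%E @[l --> \oo] --> 0%E) ->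
     (forall l, full_limit K W (rho0s l) T (rhol l)) ->
     exists psi : nat -> nat, (forall n, (psi n < psi n.+1)%N) /\
     exists rhobar : R -> R -> R,
       measurable_fun [set: R * R] (fun z : R * R => rhobar z.1 z.2) /\
       (exists M : R, forall t y, 0 <= rhobar t y <= M) /\
       (l1dist T (rhol (psi n)) rhobar @[n --> \oo] --> 0%E)).
Proof.
move=> KA WA mrho0 rho0_ge0 [M0 hM0] int1 _ mom T0.
pose M := Num.max M0 1.
have M0' : 0 < M by rewrite /M lt_max ltr01 orbT.
have hM : {ae @lebesgue_measure R, forall x, `|rho0 x| <= M}.
  by case: hM0 => Z [mZ Z0 hZ]; exists Z; split => // x /= nx; apply: hZ => /= fx;
     apply: nx; rewrite /M le_max fx.
have large (Ls : nat -> R) : (Ls n @[n --> \oo] --> +oo) ->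
    forall b, exists n0, forall n, (n0 <= n)%N -> b <= Ls n.
  by move=> /cvgryPge h b; have [n0 _ hn0] := h b; exists n0.
split.
  move=> Ls rhos Ls0 Linf hlim.
  pose m1 := fine (\int[(@lebesgue_measure R)]_x (`|x| * rho0 x)%:E).
  have adm : admissible_datum M m1 rho0.
    split => //.
      by case: hM => Z [mZ Z0 hZ]; exists Z; split => // x /= nx; apply: hZ => /= fx;
         apply: nx; apply: le_trans fx; exact: ler_norm.
    rewrite /m1 fineK // ge0_fin_numE //.
    by apply: integral_ge0 => y _; rewrite lee_fin mulr_ge0.
  (* The uniform bounds require [1 <= L] and [2 * m1 < L], the latter for positive mass in the
     period, so the sequence is started at [n0]. *)
  have [n0 hn0] := large Ls Linf (Num.max 1 (2 * m1 + 1)).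
  have hL n : 1 <= Ls (n + n0)%N /\ 2 * m1 < Ls (n + n0)%N.
    have := hn0 (n + n0)%N (leq_addl _ _); rewrite ge_max => /andP[h1 h2].
    by split => //; lra.
  have [|||||||psi [psi_lt [rho [mrho rhoB rho_cvg]]]] := @sequence_compactness R K W c0 c1 c2
    rhat rbar T M m1 KA WA T0 M0' (fun=> rho0) (fun n => Ls (n + n0)%N)
    (fun n => rhos (n + n0)%N) (fun n => zext (Ls (n + n0)%N) (rhos (n + n0)%N)).
  - by [].
  - by move=> n; have [] := hL n.
  - by move=> n; have [] := hL n.
  - move=> b; have [n1 hn1] := large Ls Linf b; exists n1 => n nn1.
    by apply: hn1; exact: leq_trans nn1 (leq_addr _ _).
  - by move=> n; exact: hlim.
  - by move=> n; have [mg _] := hlim (n + n0)%N; exact: zext_measurable.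
  - move=> n; rewrite /l1dist; under eq_integral => t _ do
      (under eq_integral do rewrite subrr normr0; rewrite integral0).
    by rewrite integral0 lee_fin invr_ge0.
  exists (fun n => psi n + n0)%N; split; first by move=> n; rewrite ltn_add2r.
  by exists rho.
move=> rho0s rhol ms pos hMs _ ints [m1 moms] _ hfull.
(* A torus side and a torus limit close to [rhol l]; the term [l%:R] in the maximum drives the sides
   to infinity. *)
have /choice[G hG] l : exists G : R * (R -> R -> R),
    [/\ Num.max l%:R (Num.max 1 (2 * m1 + 1)) <= G.1,
        particle_limit K W (rho0s l) G.1 T G.2 &
        (l1dist T (zext G.1 G.2) (rhol l) <= (l.+1%:R^-1)%:E)%E].
  have [_ [Ls [_ [Linf [rhos [hlim hcvg]]]]]] := hfull l.
  have l0 : 0 < l.+1%:R^-1 :> R by rewrite invr_gt0.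
  have [n1 hn1] := large Ls Linf (Num.max l%:R (Num.max 1 (2 * m1 + 1))).
  have [n2 hn2] := proj1 (cvge0P (fun n => l1dist_ge0 T _ _)) hcvg _ l0.
  pose n := maxn n1 n2.
  exists (Ls n, rhos n); split => //=; first by apply: hn1; exact: leq_maxl.
  by apply: hn2; exact: leq_maxr.
have hL l : [/\ l%:R <= (G l).1, 1 <= (G l).1 & 2 * m1 < (G l).1].
  have [h _ _] := hG l; move: h; rewrite !ge_max => /and3P[h1 h2 h3].
  by split => //; lra.
have M2 : 0 < 2 * M by rewrite mulr_gt0.
have [|||||||psi [psi_lt [rho [mrho rhoB rho_cvg]]]] := @sequence_compactness R K W c0 c1 c2
  rhat rbar T (2 * M) m1 KA WA T0 M2 rho0s (fun l => (G l).1) (fun l => (G l).2) rhol.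
- move=> l; split => //; first by move=> y; exact: ltW.
  case: (hMs l M hM) => Z [mZ Z0 hZ]; exists Z; split => // x /= nx; apply: hZ => /= fx.
  by apply: nx; apply: le_trans fx; exact: ler_norm.
- by move=> l; have [] := hL l.
- by move=> l; have [] := hL l.
- move=> b; exists (Num.truncn `|b|).+1 => l bl; have [h _ _] := hL l.
  apply: le_trans h; have /andP[_ h] := truncn_itv (normr_ge0 b).
  apply: le_trans (ler_norm b) _; apply: ltW; apply: lt_le_trans h _.
  by rewrite ler_nat.
- by move=> l; have [] := hG l.
- by move=> l; have [] := hfull l.
- by move=> l; have [] := hG l.
by exists psi; split => //; exists rho.
Qed.
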